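(* Fix $\alpha\in\mathbb{Z}_+$ and $f_0,\dots,f_{\alpha-1}>0$. If $\nu$ is a compactly supported probability measure on $\mathbb{R}$ with $\#(\operatorname{supp}\nu)\ge35\alpha$, then the Lyapunov exponent satisfies $L(E)>0$ for all $E\in\mathbb{R}$.
   Context: Lyapunov exponent of the generalized Anderson model (with $V_0\equiv0$): for $E,\lambda\in\mathbb{R}$ let $T_i(\lambda,E)=\begin{pmatrix}E-f_i\lambda&-1\\1&0\end{pmatrix}$ and let the $\alpha$-step transfer matrix be $M_\lambda(E)=T_{\alpha-1}(\lambda,E)\cdots T_0(\lambda,E)\in SL(2,\mathbb{R})$. Let $\lambda_1,\lambda_2,\dots$ be i.i.d. with law $\nu$. Then $L(E)=\lim_{n\to\infty}\frac1n\log\|M_{\lambda_n}(E)\cdots M_{\lambda_1}(E)\|$, which exists and is almost surely constant. *)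

(* Defs.v *)
From HB Require Import structures.
From mathcomp Require Import all_boot all_order all_algebra.
From mathcomp Require Import all_classical all_reals all_analysis.
Set Implicit Arguments. Unset Strict Implicit. Unset Printing Implicit Defensive.
Import Order.TTheory GRing.Theory Num.Theory.
Import numFieldNormedType.Exports.
Local Open Scope classical_set_scope.
Local Open Scope ring_scope.

Definition transfer {R : realType} (fi lam E : R) : 'M[R]_2 :=
  \matrix_(i < 2, j < 2)
    (if (i == 0 :> nat) then (if (j == 0 :> nat) then E - fi * lam else -1)
     else (if (j == 0 :> nat) then 1 else 0)).

Definition blockM {R : realType} (alpha : nat) (f : nat -> R) (lam E : R)
  : 'M[R]_2 :=
  \prod_(i <- rev (iota 0 alpha)) transfer (f i) lam E.

Definition vnorm {R : realType} (v : 'cV[R]_2) : R :=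
  Num.sqrt (v 0 0 ^+ 2 + v 1 0 ^+ 2).

Definition opnorm {R : realType} (A : 'M[R]_2) : R :=
  sup [set vnorm (A *m v) | v in [set v : 'cV[R]_2 | vnorm v = 1]].

Definition msupport {R : realType} (nu : set R -> \bar R) : set R :=
  [set x | forall r : R, 0 < r -> (0 < nu (ball x r))%E].

Definition compactly_supported {R : realType} (nu : set R -> \bar R) : Prop :=
  exists K : set R, compact K /\ msupport nu `<=` K.

Definition support_card_ge {R : realType} (nu : set R -> \bar R) (k : nat)
  : Prop :=
  exists s : seq R, uniq s /\ size s = k /\ (forall x, x \in s -> msupport nu x).

Definition iid_independent {d} {T : measurableType d} {R : realType}
  (P : probability T R) (X : nat -> T -> R) : Prop :=
  forall (I : seq nat) (B : nat -> set R), uniq I ->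
    (forall i, measurable (B i)) ->
    P (\bigcap_(i in [set j | j \in I]) (X i @^-1` B i)) =
    (\prod_(i <- I) P (X i @^-1` B i))%E.

Definition iid_with_law {d} {T : measurableType d} {R : realType}
  (P : probability T R) (X : nat -> T -> R) (nu : set R -> \bar R) : Prop :=
  (forall n, measurable_fun setT (X n)) /\
  iid_independent P X /\
  (forall n (B : set R), measurable B -> P (X n @^-1` B) = nu B).

(* n-step product M_{lambda_{n}} ... M_{lambda_1} (with lambda_{k+1} = X k) *)
Definition nstep {R : realType} (alpha : nat) (f : nat -> R) (E : R)
  (lam : nat -> R) (n : nat) : 'M[R]_2 :=
  \prod_(k <- rev (iota 0 n)) blockM alpha f (lam k) E.

(* Main.v *)
Require Import Defs.
From HB Require Import structures.
From mathcomp Require Import all_boot all_order all_algebra.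
From mathcomp Require Import all_classical all_reals all_analysis.
From mathcomp Require Import measurable_realfun.
From mathcomp Require Import zify ring lra.
Set Implicit Arguments. Unset Strict Implicit. Unset Printing Implicit Defensive.
Import Order.TTheory GRing.Theory Num.Theory.
Import numFieldNormedType.Exports.
Local Open Scope classical_set_scope.
Local Open Scope ring_scope.

(* The group SL(2,R) preserves Lebesgue measure on the plane, so it acts by isometries on L2(R^2), and a spectral gap for the averaging operator (Q h)(v) = \int h (M_t v) dnu(t) makes P(||M_n ... M_1|| <= q^n) decay exponentially for some q > 1, hence L > 0. Without a gap there would be functions h for which the mass h^2 dv, seen on directions, is almost invariant under all M_s M_s M_t^-1 M_t^-1 with s, t in the support of nu. This is impossible: the entries of M_t M_t are polynomials in t of degree at most 2 alpha with nonzero leading coefficients, so with more than 4 alpha points s the matrices neither preserve a common quadratic form (a word of large norm then squeezes the mass towards two directions) nor do their inverses map some direction into a set of two.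

The limit itself comes from Steele's covering argument for subadditive processes together with the zero-one law for shift-invariant events. It gives liminf >= L for log ||M_n ... M_1||, and limsup <= L when applied to minus the sums of the log norms of consecutive blocks of fixed length. *)

(** * Two-by-two matrices *)

(** The energy identity only shows that [h] composed with [M_t] is close to the average [Qop h] for
    suitable [t]; it does not compare [h] with an average of itself. Hence two different masses [m]
    and [m'] occur, and only quotients [g i * (g j)^-1] act almost invariantly on [m]. This is why
    words are built from quotients.

    The contradiction has to survive small errors: the couplings found are merely close to the
    chosen support points, and invariance is only approximate. It therefore uses one fixed word and
    finitely many cones, with explicit tolerances, and no invariant measure on directions is ever
    constructed.

    The number 4 alpha is the degree of the polynomials whose roots must be avoided: a product of
    two polynomials of degree at most 2 alpha for the third direction, and a quadratic form in
    entries of degree at most 2 alpha.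

    Two changes do not affect the limit: the operator norm is exchanged for the sum of the absolute
    values of the entries, which differs by a factor at most 4, and couplings are clamped to an
    interval containing the support. *)

Section matrices2.
Context {R : realType}.
Implicit Types (A B : 'M[R]_2) (u v x y : R * R).

Definition mk2 (a b c d : R) : 'M[R]_2 :=
  \matrix_(i < 2, j < 2)
    (if i == 0 then (if j == 0 then a else b) else (if j == 0 then c else d)).

Lemma mx2P A B : A 0 0 = B 0 0 -> A 0 1 = B 0 1 -> A 1 0 = B 1 0 ->
  A 1 1 = B 1 1 -> A = B.
Proof.
move=> h00 h01 h10 h11; apply/matrixP => i j.
have h (k : 'I_2) : k = 0 \/ k = 1.
  by case: k => [[|[|//]]] hk; [left|right]; apply/val_inj.
by have [->|->] := h i; have [->|->] := h j.
Qed.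

Lemma mul2E A B i j : (A * B) i j = A i 0 * B 0 j + A i 1 * B 1 j.
Proof.
rewrite mxE !big_ord_recl big_ord0 addr0.
by rewrite (_ : lift ord0 ord0 = 1 :> 'I_2)//; apply/val_inj.
Qed.

Lemma one2E : ((1 : 'M[R]_2) 0 0 = 1) * ((1 : 'M[R]_2) 0 1 = 0) *
  ((1 : 'M[R]_2) 1 0 = 0) * ((1 : 'M[R]_2) 1 1 = 1).
Proof. by rewrite !mxE. Qed.

Lemma mk2E a b c d : (mk2 a b c d 0 0 = a) * (mk2 a b c d 0 1 = b) *
  (mk2 a b c d 1 0 = c) * (mk2 a b c d 1 1 = d).
Proof. by rewrite !mxE. Qed.

Lemma add2E A B i j : (A + B) i j = A i j + B i j. Proof. by rewrite mxE. Qed.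
Lemma opp2E A i j : (- A) i j = - A i j. Proof. by rewrite mxE. Qed.

(** Entrywise formulas in place of the general determinant and trace keep identities within reach of
    [ring]. When [dt A = 1], the matrix [adj A] is the inverse of [A], and it has the same norm
    [nn]. *)
Definition dt A := A 0 0 * A 1 1 - A 0 1 * A 1 0.
Definition tr2 A := A 0 0 + A 1 1.
Definition adj A := mk2 (A 1 1) (- A 0 1) (- A 1 0) (A 0 0).
Definition nn A := `|A 0 0| + `|A 0 1| + `|A 1 0| + `|A 1 1|.
(** Vectors are pairs rather than columns, so that the plane carries the product sigma-algebra and
    the product measure. *)
Definition act A v : R * R :=
  (A 0 0 * v.1 + A 0 1 * v.2, A 1 0 * v.1 + A 1 1 * v.2).
Definition vn v := `|v.1| + `|v.2|.
Definition wedge u v := u.1 * v.2 - u.2 * v.1.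

Let E2 := (mul2E, mk2E, one2E, add2E, opp2E).

Lemma dtM A B : dt (A * B) = dt A * dt B.
Proof. by rewrite /dt !E2; ring. Qed.
Lemma dt1 : dt 1 = 1. Proof. by rewrite /dt !E2; ring. Qed.
Lemma dt_adj A : dt (adj A) = dt A.
Proof. by rewrite /dt /adj !E2; ring. Qed.
Lemma mul_adj A : dt A = 1 -> A * adj A = 1.
Proof.
rewrite /dt => h.
by apply: mx2P; rewrite /adj !E2 -?h; ring.
Qed.
Lemma adj_mul A : dt A = 1 -> adj A * A = 1.
Proof.
rewrite /dt => h.
by apply: mx2P; rewrite /adj !E2 -?h; ring.
Qed.
Lemma adjM A B : adj (A * B) = adj B * adj A.
Proof. by apply: mx2P; rewrite /adj !E2; ring. Qed.
Lemma adjK A : adj (adj A) = A.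
Proof. by apply: mx2P; rewrite /adj !E2; ring. Qed.
Lemma adjB A B : adj (A - B) = adj A - adj B.
Proof. by apply: mx2P; rewrite /adj !E2; ring. Qed.

Lemma nn_ge0 A : 0 <= nn A.
Proof. by rewrite /nn !addr_ge0. Qed.
Lemma vn_ge0 v : 0 <= vn v.
Proof. by rewrite /vn !addr_ge0. Qed.
Lemma vn_eq0 v : (vn v == 0) = (v == 0).
Proof. by case: v => a b; rewrite /vn paddr_eq0// !normr_eq0. Qed.
Lemma vn_gt0 v : (0 < vn v) = (v != 0).
Proof. by rewrite lt0r vn_ge0 andbT vn_eq0. Qed.
Lemma nn_adj A : nn (adj A) = nn A.
Proof. by rewrite /nn /adj !E2 !normrN; ring. Qed.
Lemma nnD A B : nn (A + B) <= nn A + nn B.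
Proof.
rewrite /nn !E2.
have := ler_normD (A 0 0) (B 0 0); have := ler_normD (A 0 1) (B 0 1).
have := ler_normD (A 1 0) (B 1 0); have := ler_normD (A 1 1) (B 1 1).
lra.
Qed.
Lemma nnN A : nn (- A) = nn A.
Proof. by rewrite /nn !E2 !normrN. Qed.
Lemma nnM A B : nn (A * B) <= nn A * nn B.
Proof.
rewrite /nn !E2.
have h (a b c d : R) : `|a * b + c * d| <= `|a| * `|b| + `|c| * `|d|.
  by rewrite -!normrM ler_normD.
have := h (A 0 0) (B 0 0) (A 0 1) (B 1 0).
have := h (A 0 0) (B 0 1) (A 0 1) (B 1 1).
have := h (A 1 0) (B 0 0) (A 1 1) (B 1 0).
have := h (A 1 0) (B 0 1) (A 1 1) (B 1 1).
have q (a b : R) : 0 <= `|a| * `|b| by rewrite mulr_ge0.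
have := q (A 0 0) (B 1 0); have := q (A 0 0) (B 1 1).
have := q (A 0 1) (B 0 0); have := q (A 0 1) (B 0 1).
have := q (A 1 0) (B 1 0); have := q (A 1 0) (B 1 1).
have := q (A 1 1) (B 0 0); have := q (A 1 1) (B 0 1).
lra.
Qed.
Lemma nn_ge1 A : dt A = 1 -> 1 <= nn A.
Proof.
rewrite /dt /nn => h.
have h1 : 1 <= `|A 0 0| * `|A 1 1| + `|A 0 1| * `|A 1 0|.
  rewrite -!normrM -[leLHS]normr1 -h.
  exact: ler_normB.
have := normr_ge0 (A 0 0); have := normr_ge0 (A 0 1).
have := normr_ge0 (A 1 0); have := normr_ge0 (A 1 1).
nra.
Qed.
Lemma nn1 : nn 1 = 2.
Proof. by rewrite /nn !E2 normr0 normr1; ring. Qed.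

Lemma vn_act A v : vn (act A v) <= nn A * vn v.
Proof.
rewrite /vn /act /nn /=.
have h (a b c d : R) : `|a * b + c * d| <= `|a| * `|b| + `|c| * `|d|.
  by rewrite -!normrM ler_normD.
have := h (A 0 0) v.1 (A 0 1) v.2; have := h (A 1 0) v.1 (A 1 1) v.2.
have q (a b : R) : 0 <= `|a| * `|b| by rewrite mulr_ge0.
have := q (A 0 0) v.2; have := q (A 1 0) v.2.
have := q (A 0 1) v.1; have := q (A 1 1) v.1.
lra.
Qed.
Lemma wedge_le u v : `|wedge u v| <= vn u * vn v.
Proof.
rewrite /wedge /vn; apply: (le_trans (ler_normB _ _)); rewrite !normrM.
have q (a b : R) : 0 <= `|a| * `|b| by rewrite mulr_ge0.
have := q u.1 v.1; have := q u.2 v.2; lra.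
Qed.
Lemma actM A B v : act (A * B) v = act A (act B v).
Proof. by rewrite /act !E2 /=; congr pair; ring. Qed.
Lemma act1 v : act 1 v = v.
Proof. by case: v => a b; rewrite /act !E2 /=; congr pair; ring. Qed.
Lemma wedge_act A u v : wedge (act A u) (act A v) = dt A * wedge u v.
Proof. by rewrite /wedge /act /dt /=; ring. Qed.
Lemma wedge_adj A u v : wedge (act A u) v = wedge u (act (adj A) v).
Proof. by rewrite /wedge /act /adj !E2 /=; ring. Qed.

Lemma act_eq0 A v : dt A = 1 -> (act A v == 0) = (v == 0).
Proof.
move=> hA; apply/eqP/eqP => [h|->].
  by rewrite -(act1 v) -(adj_mul hA) actM h /act /= !mulr0 addr0.
by rewrite /act /= !mulr0 addr0.
Qed.

Lemma nn_mul_close A A' B B' :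
  nn (A * B - A' * B') <= nn (A - A') * nn B + nn A' * nn (B - B').
Proof.
have -> : A * B - A' * B' = (A - A') * B + A' * (B - B').
  by rewrite mulrBl mulrBr addrA addrNK.
exact: le_trans (nnD _ _) (lerD (nnM _ _) (nnM _ _)).
Qed.

Lemma nn_le_close A B : nn A <= nn B + nn (B - A).
Proof.
have {1}-> : A = B + (- (B - A)) by rewrite opprB addrC subrK.
by rewrite (le_trans (nnD _ _))// nnN.
Qed.

Lemma wedge_close (A A' B B' : 'M[R]_2) x :
  `|wedge (act A x) (act B x) - wedge (act A' x) (act B' x)| <=
  (nn (A - A') * nn B + nn A' * nn (B - B')) * vn x ^+ 2.
Proof.
have -> : wedge (act A x) (act B x) - wedge (act A' x) (act B' x) =
   wedge (act (A - A') x) (act B x) + wedge (act A' x) (act (B - B') x).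
  by rewrite /wedge /act !E2 /=; ring.
apply: (le_trans (ler_normD _ _)); rewrite mulrDl.
have h C D : `|wedge (act C x) (act D x)| <= nn C * nn D * vn x ^+ 2.
  apply: (le_trans (wedge_le _ _)).
  have -> : nn C * nn D * vn x ^+ 2 = (nn C * vn x) * (nn D * vn x) by ring.
  by apply: ler_pM; rewrite ?vn_ge0 ?vn_act.
exact: lerD.
Qed.

(** Cramer's relation [wedge y y' * v = wedge v y' * y - wedge v y * y'], taken coordinate by
    coordinate: a vector almost parallel to both [y] and [y'] forces these to be almost parallel. *)
Lemma wedge_elim (v y y' : R * R) :
  vn v * `|wedge y y'| <= vn y * `|wedge v y'| + vn y' * `|wedge v y|.
Proof.
have h (a b c : R) (w1 w2 : R) : a * c = b * w1 - w2 ->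
   `|a| * `|c| <= `|b| * `|w1| + `|w2|.
  by move=> h; rewrite -!normrM h ler_normB.
have := @h v.1 y.1 (wedge y y') (wedge v y') (y'.1 * wedge v y).
have := @h v.2 y.2 (wedge y y') (wedge v y') (y'.2 * wedge v y).
rewrite !(normrM _ (wedge v y)) /vn => /(_ _)-h2 /(_ _)-h1.
rewrite !mulrDl addrACA.
by apply: lerD; [apply: h1|apply: h2]; rewrite /wedge; ring.
Qed.

(** A thickened line, unchanged when [v] or [x] is rescaled. The origin is left out because it would
    otherwise lie in every cone and in every preimage of one. *)
Definition cone x (e : R) : set (R * R) :=
  [set v | v != 0 /\ `|wedge v x| <= e * vn v * vn x].

(* With [r] the longer row of [g], every [v] far from the line killed by [r] has [|g v|] large, while [wedge (g v) (g e_j) = wedge v e_j] stays bounded. *)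
Lemma large_contracts (e : R) : 0 < e -> exists2 B : R, 0 < B &
  forall g, dt g = 1 -> B < nn g ->
  exists x x', [/\ x != 0, x' != 0 &
    forall v, v != 0 -> ~ cone x e v -> cone x' e (act g v)].
Proof.
(* The last estimate needs [1 <= e ^+ 2 * (nn g / 2) ^+ 2]: the summand 4 gives [nn g / 2 > 2], the
   other one gives [e ^+ 2 * (nn g / 2) > 2]. *)
move=> e0; exists (4 + 4 / e ^+ 2).
  by rewrite addr_gt0// divr_gt0// exprn_gt0.
move=> g dg Bg.
pose rw i : R * R := (- g i 1, g i 0).
pose cl j : R * R := (g 0 j, g 1 j).
pose ej (j : 'I_2) : R * R := if j == 0 then (1, 0) else (0, 1).
have [i hi] : exists i, nn g / 2 <= vn (rw i).
  have [h|h] := leP (nn g / 2) (vn (rw 0)); first by exists 0.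
  by exists 1; move: h; rewrite /vn /rw /nn /= !normrN; lra.
have [j hj] : exists j, nn g / 2 <= vn (cl j).
  have [h|h] := leP (nn g / 2) (vn (cl 0)); first by exists 0.
  by exists 1; move: h; rewrite /vn /cl /nn /=; lra.
have e20 : 0 < 4 / e ^+ 2 by rewrite divr_gt0// exprn_gt0.
have B2 : 2 < nn g / 2 by lra.
exists (rw i), (cl j); split.
- by rewrite -vn_gt0; lra.
- by rewrite -vn_gt0; lra.
move=> v v0 ncv; split; first by rewrite act_eq0.
have {}ncv : e * vn v * vn (rw i) < `|wedge v (rw i)|.
  by rewrite ltNge; apply/negP => h; apply: ncv.
have hrow : `|wedge v (rw i)| <= vn (act g v).
  rewrite /wedge /rw /vn /act /= mulrN opprK.
  have -> : v.1 * g i 0 + v.2 * g i 1 = g i 0 * v.1 + g i 1 * v.2 by ring.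
  case: i {hi ncv} => [[|[|//]]] hi.
    rewrite (_ : Ordinal hi = 0); last exact/val_inj.
    by rewrite lerDl.
  rewrite (_ : Ordinal hi = 1); last exact/val_inj.
  by rewrite lerDr.
have hcl : cl j = act g (ej j).
  rewrite /cl /act /ej; case: j {hj} => [[|[|//]]] hj /=.
    by rewrite (_ : Ordinal hj = 0) /=; [congr pair; ring|exact/val_inj].
  by rewrite (_ : Ordinal hj = 1) /=; [congr pair; ring|exact/val_inj].
rewrite [in leLHS]hcl wedge_act dg mul1r.
have h1 : `|wedge v (ej j)| <= vn v.
  rewrite (le_trans (wedge_le _ _))// /ej.
  by case: ifP => _; rewrite /vn /= normr0 normr1 ?addr0 ?add0r mulr1.
apply: (le_trans h1).
have vv : 0 < vn v by rewrite vn_gt0.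
have h2 : e * vn v * (nn g / 2) <= vn (act g v).
  apply: le_trans hrow; apply: le_trans (ltW ncv).
  by rewrite ler_wpM2l// mulr_ge0// ltW.
have h3 : e * (e * vn v * (nn g / 2)) * (nn g / 2) <= e * vn (act g v) * vn (cl j).
  apply: ler_pM => //; [|lra|].
    by rewrite !mulr_ge0//; lra.
  by rewrite ler_wpM2l// ltW.
apply: le_trans h3.
have -> : e * (e * vn v * (nn g / 2)) * (nn g / 2) =
  vn v * (e ^+ 2 * (nn g / 2) * (nn g / 2)) by ring.
rewrite ler_peMr ?ltW//.
have : e ^+ 2 * (4 / e ^+ 2) = 4 by rewrite mulrCA divff ?mulr1// expf_neq0// gt_eqF.
have e2 : 0 < e ^+ 2 by rewrite exprn_gt0.
move: e2 Bg B2 e20; set s := e ^+ 2; set t := 4 / s; set n := nn g; nra.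
Qed.

(** By [wedge_adj], if [g v] is almost parallel to [x] then [v] is almost parallel to [adj g x]. A
    common [v] would make the two pulled-back directions almost parallel by [wedge_elim], against
    the lower bound [c]. *)
Lemma cone_disjoint (g g' : 'M[R]_2) x (K e c : R) : x != 0 ->
  nn g <= K -> nn g' <= K -> 0 <= e -> 2 * e * K ^+ 2 < c ->
  c * vn x ^+ 2 <= `|wedge (act (adj g) x) (act (adj g') x)| ->
  forall v, cone x e (act g v) -> cone x e (act g' v) -> False.
Proof.
move=> x0 gK gK' e0 ec hc v [gv0 hg] [_ hg'].
have v0 : v != 0.
  by apply: contraNneq gv0 => ->; rewrite /act /= !mulr0 addr0.
have vv : 0 < vn v by rewrite vn_gt0.
have xx : 0 < vn x by rewrite vn_gt0.
have K0 : 0 <= K by rewrite (le_trans (nn_ge0 g)).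
have aux (h : 'M[R]_2) : nn h <= K -> `|wedge (act h v) x| <= e * vn (act h v) * vn x ->
    `|wedge v (act (adj h) x)| <= e * K * vn v * vn x /\ vn (act (adj h) x) <= K * vn x.
  move=> hK hh; split.
    rewrite -wedge_adj (le_trans hh)// ler_wpM2r ?(ltW xx)//.
    rewrite -(mulrA e K) ler_wpM2l// (le_trans (vn_act _ _))//.
    by rewrite ler_wpM2r// ltW.
  by rewrite (le_trans (vn_act _ _))// nn_adj ler_wpM2r// ltW.
have [a1 a2] := aux _ gK hg; have [b1 b2] := aux _ gK' hg'.
have := wedge_elim v (act (adj g) x) (act (adj g') x).
set W := wedge (act (adj g) x) (act (adj g') x) in hc *.
have c1 : vn (act (adj g) x) * `|wedge v (act (adj g') x)| <= (K * vn x) * (e * K * vn v * vn x).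
  by apply: ler_pM; rewrite ?vn_ge0.
have c2 : vn (act (adj g') x) * `|wedge v (act (adj g) x)| <= (K * vn x) * (e * K * vn v * vn x).
  by apply: ler_pM; rewrite ?vn_ge0.
move=> h.
have : vn v * (c * vn x ^+ 2) <= vn v * `|W| by rewrite ler_wpM2l// ltW.
have : (2 * e * K ^+ 2) * (vn x ^+ 2 * vn v) < c * (vn x ^+ 2 * vn v).
  by rewrite ltr_pM2r// mulr_gt0// exprn_gt0.
move: h c1 c2; set p := vn (act (adj g) x) * _; set q := vn (act (adj g') x) * _.
set z := vn v * `|W|.
have -> : (K * vn x) * (e * K * vn v * vn x) = e * K ^+ 2 * (vn x ^+ 2 * vn v) by ring.
have -> : vn v * (c * vn x ^+ 2) = c * (vn x ^+ 2 * vn v) by ring.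
have -> : 2 * e * K ^+ 2 * (vn x ^+ 2 * vn v) = 2 * (e * K ^+ 2 * (vn x ^+ 2 * vn v)) by ring.
lra.
Qed.

End matrices2.


(** * Words with unbounded norm *)

Section words.
Context {R : realType}.
Implicit Types (A B : 'M[R]_2).

Lemma scale2E (t : R) A i j : (t *: A) i j = t * A i j.
Proof. by rewrite mxE. Qed.

Let E2 := (@mul2E R, @mk2E R, @one2E R, @add2E R, @opp2E R, scale2E).

Definition bounded_powers A := exists b : R, forall n, nn (A ^+ n) <= b.

Lemma tr2_le A : `|tr2 A| <= nn A.
Proof.
rewrite /tr2 /nn (le_trans (ler_normD _ _))//.
have := normr_ge0 (A 0 1); have := normr_ge0 (A 1 0); lra.
Qed.

Lemma cayley2 A : dt A = 1 -> A * A = tr2 A *: A - 1.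
Proof.
rewrite /dt => h; apply: mx2P; rewrite !E2 /tr2 -?h; ring.
Qed.

Lemma dtX A n : dt A = 1 -> dt (A ^+ n) = 1.
Proof.
by move=> h; elim: n => [|n ih]; rewrite ?expr0 ?dt1// exprS dtM h ih mulr1.
Qed.

Lemma nnZ (t : R) A : nn (t *: A) = `|t| * nn A.
Proof. by rewrite /nn !mxE !normrM; ring. Qed.

Lemma tr2_sq A : dt A = 1 -> tr2 (A * A) = tr2 A ^+ 2 - 2.
Proof.
rewrite /dt => h; rewrite /tr2 !E2.
have -> : (2 : R) = 2 * (A 0 0 * A 1 1 - A 0 1 * A 1 0) by rewrite h mulr1.
ring.
Qed.

(** Along repeated squaring the trace follows [t -> t ^+ 2 - 2], whose fixed point 2 is repelling:
    an excess [s] over 2 at least doubles at each squaring. *)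
Lemma bounded_powers_tr A : dt A = 1 -> bounded_powers A -> `|tr2 A| <= 2.
Proof.
move=> hA [b hb]; rewrite leNgt; apply/negP => h.
have step k : tr2 (A ^+ (2 ^ k.+1)) = tr2 (A ^+ (2 ^ k)) ^+ 2 - 2.
  by rewrite expnS mul2n -addnn exprD tr2_sq// dtX.
pose s := tr2 A ^+ 2 - 4.
have s0 : 0 < s.
  by rewrite /s -real_normK ?num_real//; nra.
have grow k : 2 + s * (2 ^ k)%:R <= tr2 (A ^+ (2 ^ k.+1)).
  elim: k => [|k ih].
    by rewrite step expn0 expr1 mulr1 /s; lra.
  have p0 : 0 < (2 ^ k)%:R :> R by rewrite ltr0n expn_gt0.
  rewrite step; move: ih; set t := tr2 _; rewrite expnS natrM; set p := (2 ^ k)%:R in p0 *.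
  have := mulr_gt0 s0 p0; set q := s * p => q0 ih.
  have -> : s * (2 * p) = 2 * q by rewrite /q; ring.
  nra.
have b0 : 0 <= b by rewrite (le_trans (nn_ge0 _) (hb 0%N)).
have [k hk] : exists k : nat, b / s < k%:R.
  by exists (Num.bound (b / s)); rewrite archi_boundP// divr_ge0// ltW.
have : b < s * (2 ^ k)%:R.
  rewrite mulrC -ltr_pdivrMr// (lt_le_trans hk)// ler_nat ltnW//.
  exact: ltn_expl.
have := grow k; have := hb (2 ^ k.+1)%N; have := tr2_le (A ^+ (2 ^ k.+1)).
have := ler_norm (tr2 (A ^+ (2 ^ k.+1))); lra.
Qed.

(** By Cayley-Hamilton [D = A - 1] has square zero, so [A ^+ n = 1 + n%:R *: D] grows linearly
    unless [D = 0]. *)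
Lemma bounded_powers_parabolic A : dt A = 1 -> tr2 A = 2 ->
  bounded_powers A -> A = 1.
Proof.
move=> hA htr [b hb].
pose D := A - 1.
have AD : A = 1 + D by rewrite /D addrC subrK.
have DD : D * D = 0.
  have hd : A 1 1 = 2 - A 0 0 by rewrite -htr /tr2 addrC addKr.
  have hbc : A 0 1 * A 1 0 = A 0 0 * A 1 1 - 1 by rewrite -hA /dt; ring.
  have hcb : A 1 0 * A 0 1 = A 0 0 * A 1 1 - 1 by rewrite mulrC hbc.
  apply: mx2P; rewrite /D !E2 ?oppr0 ?addr0 ?hbc ?hcb hd [RHS]mxE; ring.
have pw n : A ^+ n = 1 + n%:R *: D.
  elim: n => [|n ih]; first by rewrite expr0 scale0r addr0.
  rewrite exprS ih {1}AD mulrDl mul1r mulrDr mulr1 -scalerAr DD scaler0 addr0.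
  by rewrite -addrA; congr (_ + _); rewrite -natr1 scalerDl scale1r.
have D0 : nn D = 0.
  apply/eqP; rewrite eq_le nn_ge0 andbT leNgt; apply/negP => D0.
  pose k := Num.bound ((b + 2) / nn D).
  have b0 : 0 <= b by rewrite (le_trans (nn_ge0 _) (hb 0%N)).
  have : (b + 2) / nn D < k%:R by rewrite archi_boundP// divr_ge0 ?addr_ge0// ltW.
  rewrite ltr_pdivrMr// => hk.
  have := nn_le_close (k%:R *: D) (A ^+ k).
  rewrite pw addrK nn1 nnZ ger0_norm// -pw; have := hb k; lra.
have z i j : D i j = 0.
  apply/eqP; rewrite -normr_eq0; apply/eqP.
  have hk (k : 'I_2) : k = 0 \/ k = 1.
    by case: k => [[|[|//]]] hk; [left|right]; apply/val_inj.
  move: D0; rewrite /nn.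
  have := normr_ge0 (D 0 0); have := normr_ge0 (D 0 1).
  have := normr_ge0 (D 1 0); have := normr_ge0 (D 1 1).
  by have [->|->] := hk i; have [->|->] := hk j; lra.
by rewrite AD; apply: mx2P; rewrite (add2E 1 D) z addr0.
Qed.

Lemma bounded_powers_sq A : bounded_powers A -> bounded_powers (A * A).
Proof. by move=> [b hb]; exists b => n; rewrite -expr2 -exprM. Qed.

(** If the trace is 2 or -2, then [A * A] has trace 2, hence equals 1 by the parabolic case, and
    Cayley-Hamilton reads [tr2 A *: A = 2]. *)
Lemma bounded_powers_dichotomy A : dt A = 1 -> bounded_powers A ->
  (exists t : R, t ^+ 2 = 1 /\ A = t *: 1) \/ `|tr2 A| < 2.
Proof.
move=> hA bA; have := bounded_powers_tr hA bA.
rewrite le_eqVlt => /orP[/eqP h|]; last by right.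
left; have t2 : tr2 A ^+ 2 = 4 by rewrite -real_normK ?num_real// h; ring.
have AA : A * A = 1.
  apply: bounded_powers_parabolic; first by rewrite dtM hA mulr1.
    by rewrite tr2_sq// t2; ring.
  exact: bounded_powers_sq.
have := cayley2 hA; rewrite AA => /eqP; rewrite eq_sym subr_eq => /eqP hh.
exists (tr2 A / 2); split; first by rewrite expr_div_n t2 -natrX divff.
have t0 : tr2 A != 0 by apply/eqP => t0; move: t2; rewrite t0 expr2 mulr0 => /eqP; rewrite eq_sym pnatr_eq0.
apply: (scalerI t0); rewrite hh scalerA mulrA -expr2 t2.
rewrite -[in LHS](scale1r (1 : 'M[R]_2)) -scalerDl; congr (_ *: _).
by rewrite (natrM _ 2 2) mulfK// natrD.
Qed.

(** The group commutator, when both determinants are 1. *)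
Definition comm2 A B := A * B * adj A * adj B.

(* [k, u, w] are the entries of the matrix commutator [A * B - B * A], and [tr2 (comm2 A B) - 2 = k ^+ 2 + u * w] becomes a sum of squares when the traceless part of [A] is definite. *)
Lemma elliptic_commutator A B : dt A = 1 -> dt B = 1 -> `|tr2 A| < 2 ->
  tr2 (comm2 A B) <= 2 -> A * B = B * A.
Proof.
move=> hA hB htr hc.
have {}htr : tr2 A ^+ 2 < 4.
  have -> : 4 = 2 ^+ 2 :> R by ring.
  by rewrite -real_normK ?num_real// ltr_pXn2r// nnegrE.
move: hA hB htr hc; rewrite /dt /tr2 /comm2 /adj !E2.
set a := A 0 0; set b := A 0 1; set c := A 1 0; set d := A 1 1.
set p := B 0 0; set q := B 0 1; set r := B 1 0; set t := B 1 1.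
move=> hA hB htr hc.
pose x := a - d; pose y := p - t.
pose k := b * r - c * q; pose u := x * q - b * y; pose w := c * y - x * r.
have hdisc : x ^+ 2 + 4 * b * c < 0.
  have -> : x ^+ 2 + 4 * b * c = (a + d) ^+ 2 - 4 * (a * d - b * c) by rewrite /x; ring.
  by rewrite hA mulr1 subr_lt0.
have htrc : k ^+ 2 + u * w <= 0.
  move: hc.
  set T := (X in X <= 2 -> _).
  have -> : T = k ^+ 2 + u * w + 2 * ((a * d - b * c) * (p * t - q * r)).
    by rewrite /T /k /u /w /x /y; ring.
  by rewrite hA hB !mulr1; lra.
have rel : c * u + b * w = - x * k by rewrite /u /w /k; ring.
have b0 : b != 0.
  by apply/eqP => b0; move: hdisc; rewrite b0 mulr0 mul0r addr0 ltNge sqr_ge0.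
(* The relation [rel] eliminates [w]. The coefficient of [u ^+ 2] is minus the discriminant
   [tr2 A ^+ 2 - 4], hence positive, so [u] and then [k] must vanish. *)
have hsq : 4 * b ^+ 2 * (k ^+ 2 + u * w) = (2 * b * k - x * u) ^+ 2 - (x ^+ 2 + 4 * b * c) * u ^+ 2.
  have -> : 4 * b ^+ 2 * (k ^+ 2 + u * w) = 4 * b ^+ 2 * k ^+ 2 + 4 * b * u * (b * w) by ring.
  have -> : b * w = - x * k - c * u by rewrite -rel; ring.
  ring.
have b2 : 0 < b ^+ 2 by rewrite exprn_even_gt0.
have h1 : 4 * b ^+ 2 * (k ^+ 2 + u * w) <= 0.
  by apply: mulr_ge0_le0 => //; rewrite mulr_ge0// ltW.
have s1 := sqr_ge0 (2 * b * k - x * u); have s2 := sqr_ge0 u.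
have u2 : u ^+ 2 = 0.
  apply/eqP; rewrite eq_le s2 andbT leNgt; apply/negP => u2.
  have : 0 < - (x ^+ 2 + 4 * b * c) * u ^+ 2 by rewrite mulr_gt0// oppr_gt0.
  rewrite mulNr; lra.
have u0 : u = 0 by apply/eqP; rewrite -sqrf_eq0 u2.
have k0 : k = 0.
  move: h1 s1; rewrite hsq u0 expr0n /= !mulr0 !subr0 => h1 s1.
  have : (2 * b * k) ^+ 2 == 0 by rewrite eq_le h1 s1.
  by rewrite sqrf_eq0 !mulf_eq0 pnatr_eq0 (negbTE b0) /= => /eqP.
have w0 : w = 0.
  move: rel; rewrite u0 k0 !mulr0 add0r => /eqP; rewrite mulf_eq0 (negbTE b0) /=.
  by move/eqP.
apply: mx2P; rewrite !E2 -/a -/b -/c -/d -/p -/q -/r -/t; apply/eqP; rewrite -subr_eq0; apply/eqP.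
- by rewrite -[RHS]k0 /k; ring.
- by rewrite -[RHS]u0 /u /x /y; ring.
- by rewrite -[RHS]w0 /w /x /y; ring.
- by rewrite -[RHS](oppr0) -[in RHS]k0 /k; ring.
Qed.

Variable N : nat.
Implicit Types (g h : 'I_N -> 'M[R]_2) (w : seq ('I_N * 'I_N)).

(* A letter [(i, j)] stands for [g i * (g j)^-1], so words are closed under inverses. *)
Fixpoint wordval g w : 'M[R]_2 :=
  if w is p :: w' then g p.1 * adj (g p.2) * wordval g w' else 1.

Lemma wordval_cat g w w' : wordval g (w ++ w') = wordval g w * wordval g w'.
Proof. by elim: w => [|p w ih] /=; rewrite ?mul1r// ih mulrA. Qed.

Lemma dt_wordval g w : (forall i, dt (g i) = 1) -> dt (wordval g w) = 1.
Proof.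
by move=> hg; elim: w => [|p w ih] /=; rewrite ?dt1// !dtM dt_adj !hg ih !mulr1.
Qed.

Lemma wordval_close g w (e : R) : 0 < e -> exists2 r : R, 0 < r &
  forall h, (forall i, nn (g i - h i) <= r) -> nn (wordval g w - wordval h w) <= e.
Proof.
elim: w e => [|[i j] w ih] e e0 /=.
  by exists 1 => // h _; rewrite subrr /nn !mxE normr0 !addr0 ltW.
pose K := nn (g i) + nn (g j) + nn (wordval g w) + 1.
have K1 : 1 <= K by rewrite /K lerDr !addr_ge0 ?nn_ge0.
have gi : nn (g i) <= K - 1 by rewrite /K; have := nn_ge0 (g j); have := nn_ge0 (wordval g w); lra.
have gj : nn (g j) <= K - 1 by rewrite /K; have := nn_ge0 (g i); have := nn_ge0 (wordval g w); lra.
have gw : nn (wordval g w) <= K - 1 by rewrite /K; have := nn_ge0 (g j); have := nn_ge0 (g i); lra.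
(* Three errors of at most [e1 * K ^+ 2] arise: one for each of the two factors of the first letter,
   and one for the rest of the word. *)
pose e1 := e / (3 * K ^+ 2).
have K20 : 0 < K ^+ 2 by rewrite exprn_gt0//; lra.
have e10 : 0 < e1 by rewrite divr_gt0// mulr_gt0.
have [r r0 hr] := ih e1 e10.
exists (Num.min 1 (Num.min r e1)); first by rewrite !lt_min ltr01 r0.
move=> h hh.
have h1 k : nn (g k - h k) <= 1 by rewrite (le_trans (hh k))// ge_min lexx.
have h2 k : nn (g k - h k) <= e1 by rewrite (le_trans (hh k))// !ge_min lexx !orbT.
have h3 : nn (wordval g w - wordval h w) <= e1.
  by apply: hr => k; rewrite (le_trans (hh k))// !ge_min lexx !orbT.
have hK k : nn (g k) <= K - 1 -> nn (h k) <= K.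
  move=> gk; have := nn_le_close (h k) (g k); have := h1 k; lra.
apply: (le_trans (nn_mul_close _ _ _ _)).
have c1 := nn_mul_close (g i) (h i) (adj (g j)) (adj (h j)).
have c2 : nn (h i * adj (h j)) <= K * K.
  by rewrite (le_trans (nnM _ _))// nn_adj ler_pM ?nn_ge0 ?hK.
rewrite -adjB !nn_adj in c1.
have c3 : nn (g i * adj (g j) - h i * adj (h j)) <= e1 * K + K * e1.
  apply: (le_trans c1); apply: lerD; apply: ler_pM; rewrite ?nn_ge0 ?h2 ?hK//; lra.
have -> : e = (e1 * K + K * e1) * K + (K * K) * e1.
  by rewrite /e1; field; rewrite gt_eqF//; lra.
apply: lerD; apply: ler_pM; rewrite ?nn_ge0//; lra.
Qed.

(* If all words are bounded then none is hyperbolic or nontrivially parabolic. Either all the [A i = g i * (g i0)^-1] are [1] or [-1], or one of them is elliptic; bounded commutators then force the others to commute with it and so to preserve its invariant quadratic form. Either way the form takes one value on all the first columns of the [g i]. *)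
Lemma unbounded_words g (i0 : 'I_N) : (forall i, dt (g i) = 1) ->
  (forall p q r : R, p != 0 -> exists i j,
     p * g i 0 0 ^+ 2 + q * g i 0 0 * g i 1 0 + r * g i 1 0 ^+ 2 !=
     p * g j 0 0 ^+ 2 + q * g j 0 0 * g j 1 0 + r * g j 1 0 ^+ 2) ->
  forall b : R, exists w, b < nn (wordval g w).
Proof.
move=> hg hform b; apply: contrapT => hb.
have {}hb w : nn (wordval g w) <= b.
  by rewrite leNgt; apply/negP => h; apply: hb; exists w.
have bp w : bounded_powers (wordval g w).
  exists b => n; suff [w' ->] : exists w', wordval g w ^+ n = wordval g w' by [].
  elim: n => [|n [w' ih]]; first by exists [::].
  by exists (w ++ w'); rewrite exprS ih wordval_cat.
pose A i := g i * adj (g i0).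
have Aw i : A i = wordval g [:: (i, i0)] by rewrite /= mulr1.
have A'w i : adj (A i) = wordval g [:: (i0, i)] by rewrite /= mulr1 /A adjM adjK.
have dA i : dt (A i) = 1 by rewrite Aw dt_wordval.
have gA i : g i = A i * g i0 by rewrite /A -mulrA adj_mul// mulr1.
suff [p [q [r [p0 hpres]]]] : exists p q r : R, p != 0 /\ forall i (v : R * R),
    p * (act (A i) v).1 ^+ 2 + q * (act (A i) v).1 * (act (A i) v).2 + r * (act (A i) v).2 ^+ 2
    = p * v.1 ^+ 2 + q * v.1 * v.2 + r * v.2 ^+ 2.
  have [i [j]] := hform p q r p0.
  have main k : p * g k 0 0 ^+ 2 + q * g k 0 0 * g k 1 0 + r * g k 1 0 ^+ 2 =
     p * g i0 0 0 ^+ 2 + q * g i0 0 0 * g i0 1 0 + r * g i0 1 0 ^+ 2.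
    by rewrite (gA k) !(mul2E (A k)); apply: (hpres k (g i0 0 0, g i0 1 0)).
  by rewrite !main eqxx.
have [allsc|] := pselect (forall i, exists t : R, t ^+ 2 = 1 /\ A i = t *: 1).
  exists 1, 0, 1; split; first exact: oner_neq0.
  move=> i v; have [t [t1 ->]] := allsc i; rewrite /act !scale2E !one2E /=.
  by rewrite -[RHS]mul1r -[X in _ = X * _]t1; ring.
move/existsNP => [i1 ni1].
have el : `|tr2 (A i1)| < 2.
  have bA : bounded_powers (A i1) by rewrite Aw.
  by have [|] := bounded_powers_dichotomy (dA i1) bA.
have comm i : A i1 * A i = A i * A i1.
  apply: elliptic_commutator => //.
  have cw : comm2 (A i1) (A i) =
      wordval g ([:: (i1, i0)] ++ [:: (i, i0)] ++ [:: (i0, i1)] ++ [:: (i0, i)]).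
    by rewrite !wordval_cat -!A'w -!Aw /comm2 !mulrA.
  have : `|tr2 (comm2 (A i1) (A i))| <= 2.
    by rewrite cw; apply: bounded_powers_tr => //; rewrite dt_wordval.
  exact/le_trans/ler_norm.
pose B := A i1.
(* These are the coefficients of [u -> wedge u (act B u)], a form invariant under every matrix of
   determinant 1 commuting with [B]. If [B 1 0] vanished, the diagonal entries would have product 1
   and the trace would have absolute value at least 2. *)
exists (B 1 0), (B 1 1 - B 0 0), (- B 0 1); split.
  apply/eqP => B10.
  have : tr2 B ^+ 2 < 4.
    have -> : 4 = 2 ^+ 2 :> R by ring.
    by rewrite -real_normK ?num_real// ltr_pXn2r// nnegrE.
  have := dA i1; rewrite -/B /dt /tr2 B10 mulr0 subr0 => hd.
  have -> : (B 0 0 + B 1 1) ^+ 2 = (B 0 0 - B 1 1) ^+ 2 + 4 * (B 0 0 * B 1 1) by ring.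
  rewrite hd; have := sqr_ge0 (B 0 0 - B 1 1); lra.
move=> i v.
have form u : B 1 0 * u.1 ^+ 2 + (B 1 1 - B 0 0) * u.1 * u.2 + - B 0 1 * u.2 ^+ 2 = wedge u (act B u).
  by rewrite /wedge /act /=; ring.
by rewrite !form -actM comm actM wedge_act dA mul1r.
Qed.

End words.


(** * Almost invariant masses *)

Section core.
Context {R : realType} (N : nat).
Implicit Types (G g : 'I_N -> 'M[R]_2) (x v : R * R).

Definition spread G x (c : R) i j :=
  c <= `|wedge (act (adj (G i)) x) (act (adj (G j)) x)|.

Definition three_directions G := forall x, x != 0 -> exists i j k,
  [/\ wedge (act (adj (G i)) x) (act (adj (G j)) x) != 0,
      wedge (act (adj (G j)) x) (act (adj (G k)) x) != 0 &
      wedge (act (adj (G i)) x) (act (adj (G k)) x) != 0].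

Lemma quadratic_continuous (a b c : R) :
  continuous (fun s : R => a + b * s + c * s ^+ 2).
Proof.
move=> s; apply: cvgD; first apply: cvgD; first exact: cvg_cst.
  by apply: cvgM; [exact: cvg_cst|exact: cvg_id].
by apply: cvgM; [exact: cvg_cst|exact: exprn_continuous].
Qed.

Lemma nn_bound G : exists2 K : R, 1 <= K & forall i, nn (G i) <= K.
Proof.
exists (1 + \sum_i nn (G i)); first by rewrite lerDl sumr_ge0// => i _; exact: nn_ge0.
move=> i; rewrite (bigD1 i)//= addrCA lerDl addr_ge0// sumr_ge0// => j _.
exact: nn_ge0.
Qed.

(** Compactness in one chart of the projective line. The sum [F] over all triples of the products of
    the three wedges is continuous and positive, so it has a positive minimum. Some triple then has
    a product bounded below, and since two of its factors are at most [Q], so does the third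
    factor. *)
Lemma three_directions_segment G (l : R -> R * R) :
  three_directions G ->
  (forall i j, exists a b c : R, forall s,
    wedge (act (adj (G i)) (l s)) (act (adj (G j)) (l s)) = a + b * s + c * s ^+ 2) ->
  (forall s, l s != 0) -> (forall s, -1 <= s <= 1 -> vn (l s) <= 2) ->
  exists2 c : R, 0 < c & forall s, -1 <= s <= 1 -> exists i j k,
    [/\ spread G (l s) c i j, spread G (l s) c j k & spread G (l s) c i k].
Proof.
move=> h3 hq hl hv.
pose q i j s := wedge (act (adj (G i)) (l s)) (act (adj (G j)) (l s)).
pose F s := \sum_(t : 'I_N * 'I_N * 'I_N) `|q t.1.1 t.1.2 s * q t.1.2 t.2 s * q t.1.1 t.2 s|.
have qc i j : continuous (q i j).
  have [a [b [c habc]]] := hq i j.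
  rewrite (_ : q i j = fun s => a + b * s + c * s ^+ 2); last exact/funext.
  exact: quadratic_continuous.
have Fc : continuous F.
  move=> s; rewrite /F; apply: cvg_big; first exact: add_continuous.
  move=> t _.
  apply: (@cvg_norm _ R^o).
  by apply: cvgM; [apply: cvgM|]; exact: qc.
have F0 s : 0 < F s.
  have [i [j [k [h1 h2 h4]]]] := h3 _ (hl s).
  rewrite /F (bigD1 (i, j, k))//= ltr_pwDl// ?sumr_ge0//.
  by rewrite normr_gt0 !mulf_neq0.
have [s0 _ hs0] : exists2 c, c \in `[(-1 : R), 1]%R & forall t, t \in `[(-1 : R), 1]%R -> F c <= F t.
  apply: EVT_min; first by lra.
  exact: continuous_subspaceT.
have [K K1 hK] := nn_bound G.
have Q0 : 0 < 4 * K ^+ 2 by rewrite mulr_gt0// exprn_gt0//; lra.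
pose Q := 4 * K ^+ 2.
have qQ i j s : -1 <= s <= 1 -> `|q i j s| <= Q.
  move=> hs; apply: (le_trans (wedge_le _ _)).
  have -> : Q = (K * 2) * (K * 2) by rewrite /Q; ring.
  by apply: ler_pM; rewrite ?vn_ge0//; apply: (le_trans (vn_act _ _));
     apply: ler_pM; rewrite ?vn_ge0 ?nn_ge0 ?nn_adj ?hK ?hv.
pose n := (#|{: 'I_N * 'I_N * 'I_N}|%:R + 1 : R).
have n0 : 0 < n by rewrite ltr_wpDl.
pose c := F s0 / (n * Q ^+ 2).
have c0 : 0 < c by rewrite divr_gt0// mulr_gt0// exprn_gt0.
exists c => // s hs.
have [[[i j] k] /= ht] : exists t : 'I_N * 'I_N * 'I_N,
    F s0 / n <= `|q t.1.1 t.1.2 s * q t.1.2 t.2 s * q t.1.1 t.2 s|.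
  apply: contrapT => /forallNP hn.
  have : F s <= \sum_(t : 'I_N * 'I_N * 'I_N) (F s0 / n).
    by apply: ler_sum => t _; rewrite ltW// ltNge; apply/negP/hn.
  rewrite sumr_const -mulr_natr leNgt => /negP; apply.
  apply: (@lt_le_trans _ _ (F s0)); last by apply: hs0; rewrite in_itv /=.
  by rewrite mulrAC ltr_pdivrMr// ltr_pM2l// /n ltrDl.
exists i, j, k.
have aux (a b d : R) : `|b| <= Q -> `|d| <= Q -> F s0 / n <= `|a| * (`|b| * `|d|) -> c <= `|a|.
  move=> hb hd h; rewrite /c invfM mulrA ler_pdivrMr ?exprn_gt0//.
  apply: (le_trans h); rewrite ler_wpM2l// expr2.
  exact: ler_pM.
rewrite !normrM in ht.
have [h1 h2 h4] := And3 (qQ i j s hs) (qQ j k s hs) (qQ i k s hs).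
by split; rewrite /spread; [apply: (aux _ _ _ h2 h4)|apply: (aux _ _ _ h1 h4)|apply: (aux _ _ _ h1 h2)];
  apply: (le_trans ht); rewrite le_eqVlt; apply/orP; left; apply/eqP; rewrite -/(q _ _ _); ring.
Qed.

(** The charts [(1, s)] and [(s, 1)] with [s] in [-1, 1] cover all directions, and both sides of
    [spread] are homogeneous of degree two in [x]. *)
Lemma three_directions_uniform G : three_directions G ->
  exists2 c : R, 0 < c & forall x, exists i j k,
    [/\ spread G x (c * vn x ^+ 2) i j, spread G x (c * vn x ^+ 2) j k &
        spread G x (c * vn x ^+ 2) i k].
Proof.
move=> h3.
have [c1 c10 h1] : exists2 c : R, 0 < c & forall s, -1 <= s <= 1 -> exists i j k,
    [/\ spread G (1, s) c i j, spread G (1, s) c j k & spread G (1, s) c i k].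
  apply: (three_directions_segment h3).
  - move=> i j; set A := adj _; set B := adj _.
    exists (A 0 0 * B 1 0 - A 1 0 * B 0 0),
      (A 0 0 * B 1 1 + A 0 1 * B 1 0 - A 1 0 * B 0 1 - A 1 1 * B 0 0),
      (A 0 1 * B 1 1 - A 1 1 * B 0 1) => s; rewrite /wedge /act /=; ring.
  - by move=> s; rewrite -vn_gt0 /vn /= normr1 ltr_pwDl.
  - move=> s; rewrite -ler_norml /vn /= normr1; lra.
have [c2 c20 h2] : exists2 c : R, 0 < c & forall s, -1 <= s <= 1 -> exists i j k,
    [/\ spread G (s, 1) c i j, spread G (s, 1) c j k & spread G (s, 1) c i k].
  apply: (three_directions_segment h3).
  - move=> i j; set A := adj _; set B := adj _.
    exists (A 0 1 * B 1 1 - A 1 1 * B 0 1),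
      (A 0 0 * B 1 1 + A 0 1 * B 1 0 - A 1 0 * B 0 1 - A 1 1 * B 0 0),
      (A 0 0 * B 1 0 - A 1 0 * B 0 0) => s; rewrite /wedge /act /=; ring.
  - by move=> s; rewrite -vn_gt0 /vn /= normr1 ltr_wpDl.
  - move=> s; rewrite -ler_norml /vn /= normr1; lra.
(* Dividing [x] by its larger coordinate [t] reaches a chart, and [vn x <= 2 * |t|]; the square of
   this 2 is the factor 4. *)
pose c := Num.min c1 c2 / 4.
have m0 : 0 < Num.min c1 c2 by rewrite lt_min c10.
exists c => [|x]; first by rewrite divr_gt0.
have [x0|x0] := eqVneq x 0.
  have [i [j [k _]]] := h1 0 (ltac:(lra)).
  by exists i, j, k; rewrite /spread x0 /vn /= normr0 addr0 expr0n /= mulr0.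
have scale (z : R * R) (t : R) i j d : x = (t * z.1, t * z.2) ->
    vn x <= 2 * `|t| -> Num.min c1 c2 <= d -> spread G z d i j -> spread G x (c * vn x ^+ 2) i j.
  rewrite /spread => -> hv hd hz.
  have -> : wedge (act (adj (G i)) (t * z.1, t * z.2)) (act (adj (G j)) (t * z.1, t * z.2)) =
     t ^+ 2 * wedge (act (adj (G i)) z) (act (adj (G j)) z).
    by rewrite /wedge /act /=; ring.
  rewrite normrM normrX.
  apply: (@le_trans _ _ (c * (2 * `|t|) ^+ 2)).
    rewrite ler_wpM2l//; first by rewrite ltW// divr_gt0.
    by rewrite ler_pXn2r ?nnegrE ?vn_ge0// mulr_ge0.
  have -> : c * (2 * `|t|) ^+ 2 = `|t| ^+ 2 * Num.min c1 c2 by rewrite /c; field.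
  by rewrite ler_wpM2l ?exprn_ge0// (le_trans hd).
have [hx|hx] := leP `|x.2| `|x.1|.
  have x10 : x.1 != 0.
    apply: contraNneq x0 => x10; move: hx; rewrite x10 normr0 normr_le0 => /eqP x20.
    by rewrite (surjective_pairing x) x10 x20.
  have hs : -1 <= x.2 / x.1 <= 1.
    by rewrite -ler_norml normrM normfV ler_pdivrMr ?normr_gt0// mul1r.
  have [i [j [k [a1 a2 a3]]]] := h1 _ hs.
  exists i, j, k.
  have e : x = (x.1 * 1, x.1 * (x.2 / x.1)).
    by rewrite mulr1 mulrCA divff// mulr1 -surjective_pairing.
  have hv : vn x <= 2 * `|x.1| by rewrite /vn; lra.
  have hm : Num.min c1 c2 <= c1 by rewrite ge_min lexx.
  by split; apply: (scale (1, x.2 / x.1) x.1 _ _ c1 e hv hm).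
have x20 : x.2 != 0.
  by apply: contraTneq hx => ->; rewrite normr0 -leNgt.
have hs : -1 <= x.1 / x.2 <= 1.
  by rewrite -ler_norml normrM normfV ler_pdivrMr ?normr_gt0// mul1r ltW.
have [i [j [k [a1 a2 a3]]]] := h2 _ hs.
exists i, j, k.
have e : x = (x.2 * (x.1 / x.2), x.2 * 1).
  by rewrite mulr1 mulrCA divff// mulr1 -surjective_pairing.
have hv : vn x <= 2 * `|x.2| by rewrite /vn; lra.
have hm : Num.min c1 c2 <= c2 by rewrite ge_min lexx orbT.
by split; apply: (scale (x.1 / x.2, 1) x.2 _ _ c2 e hv hm).
Qed.

(* Finitely additive masses suffice: only finitely many cones are compared. *)
Definition mass (m : set (R * R) -> R) :=
  (forall V, measurable V -> 0 <= m V) /\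
  (forall U V, measurable U -> measurable V -> U `&` V = set0 ->
     m (U `|` V) = m U + m V).

Lemma mass_le m U V : mass m -> measurable U -> measurable V -> U `<=` V -> m U <= m V.
Proof.
move=> [m0 mA] mU mV UV.
have -> : V = U `|` (V `\` U) by rewrite setDUK.
rewrite mA//; [|exact: measurableD|by rewrite setDIK].
by rewrite lerDl m0//; exact: measurableD.
Qed.

Lemma measurable_act (A : 'M[R]_2) : measurable_fun [set: R * R] (act A).
Proof.
apply/measurable_fun_pairP; split; rewrite /comp /act /=; apply: measurable_funD;
  by apply: measurable_funM => //; exact: measurable_cst.
Qed.

Lemma measurable_preact (A : 'M[R]_2) V : measurable V -> measurable (act A @^-1` V).
Proof. by move=> mV; rewrite -[X in measurable X]setTI; exact: measurable_act. Qed.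

Lemma measurable_origin : measurable [set 0 : R * R].
Proof.
rewrite (_ : [set 0] = [set 0] `*` [set 0]); last first.
  by apply/seteqP; split => [[a b]|[a b]] /= => [[-> ->]|[-> ->]].
by apply: measurableX.
Qed.

Lemma measurable_cone x (e : R) : measurable (cone x e).
Proof.
have -> : cone x e = ~` [set 0] `&` [set v | `|wedge v x| <= e * vn v * vn x].
  by apply/seteqP; split => v /= -[/eqP]; [move=> ? ?; split|move=> ? ?; split => //; apply/eqP].
apply: measurableI.
  by apply: measurableC; exact: measurable_origin.
rewrite (_ : [set v | _] = [set v | (fun v => `|wedge v x|) v <= (fun v => e * vn v * vn x) v]); last by [].
have -> : [set v | (fun v => `|wedge v x|) v <= (fun v => e * vn v * vn x) v] =
    (fun v => `|wedge v x| <= e * vn v * vn x) @^-1` [set true] by [].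
rewrite -[X in measurable X]setTI.
apply: measurable_fun_ler => //.
  apply: measurableT_comp => //; apply: measurable_funB; apply: measurable_funM => //; exact: measurable_cst.
apply: measurable_funM; last exact: measurable_cst.
apply: measurable_funM; first exact: measurable_cst.
by apply: measurable_funD; exact: measurableT_comp.
Qed.

(* A word of large norm pushes almost all of [m] into two thin cones, so one of them carries nearly half of the mass. Its preimages under three [g i] spread out in the sense of [three_directions] are disjoint and together too heavy. *)
Theorem no_almost_invariant_mass G : (forall i, dt (G i) = 1) ->
  three_directions G -> (forall b : R, exists w, b < nn (wordval G w)) ->
  exists r e : R, [/\ 0 < r, 0 < e & forall g m m',
    (forall i, dt (g i) = 1) -> (forall i, nn (G i - g i) <= r) ->
    mass m -> mass m' -> m setT = 1 -> m [set 0] = 0 ->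
    (forall i V, measurable V -> `|m V - m' (act (g i) @^-1` V)| <= e) -> False].
Proof.
move=> dG h3 hub.
have [c c0 hc] := three_directions_uniform h3.
have [K0 K01 hK0] := nn_bound G.
pose K := K0 + 1.
have K0' : 0 < K ^+ 2 by rewrite exprn_gt0// /K; lra.
pose del := c / (8 * K ^+ 2).
have del0 : 0 < del by rewrite divr_gt0// mulr_gt0.
have [B B0 hB] := large_contracts del0.
have [w hw] := hub (B + 1).
have [r2 r20 hr2] := wordval_close G w (ltr01 : 0 < 1 :> R).
pose l : R := (size w)%:R.
have l0 : 0 <= l by rewrite /l.
(* Three disjoint sets of [m']-mass at least [(1 - 2 * e * l) / 2 - e] must not fit into a total of
   at most [1 + e]; this amounts to [e * (6 * l + 8) < 1]. *)
pose e := ((8 * l + 16)^-1 : R).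
have e0 : 0 < e by rewrite invr_gt0; lra.
(* Replacing [G] by [g] costs at most [r1 * K + K * r1 = c / 2] of the spread. The remaining [c / 2]
   suffices for [cone_disjoint], since [2 * del * K ^+ 2 = c / 4]. *)
pose r1 := c / (4 * K).
have K1 : 1 < K by rewrite /K; lra.
have r10 : 0 < r1 by rewrite divr_gt0//; lra.
exists (Num.min 1 (Num.min r1 r2)), e; split => //.
  by rewrite !lt_min ltr01 r10.
move=> g m m' dg hg mm mm' mT m0 hinv.
have g1 i : nn (G i - g i) <= 1 by rewrite (le_trans (hg i))// ge_min lexx.
have g2 i : nn (G i - g i) <= r1 by rewrite (le_trans (hg i))// !ge_min lexx ?orbT.
have g3 i : nn (G i - g i) <= r2 by rewrite (le_trans (hg i))// !ge_min lexx !orbT.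
have hK i : nn (g i) <= K.
  have := nn_le_close (g i) (G i); have := hK0 i; have := g1 i; rewrite /K; lra.
(* The mass [m'] cancels between the indices [i] and [j]: what remains is an almost invariance of
   [m] alone, at twice the error. *)
have letter i j V : measurable V -> `|m V - m (act (g i * adj (g j)) @^-1` V)| <= 2 * e.
  move=> mV; have a1 := hinv i V mV.
  have a2 := hinv j _ (measurable_preact (g i * adj (g j)) mV).
  have E : act (g j) @^-1` (act (g i * adj (g j)) @^-1` V) = act (g i) @^-1` V.
    by apply/seteqP; split => v /=; rewrite -actM -mulrA adj_mul// mulr1.
  rewrite E in a2.
  have -> : m V - m (act (g i * adj (g j)) @^-1` V) =
    (m V - m' (act (g i) @^-1` V)) - (m (act (g i * adj (g j)) @^-1` V) - m' (act (g i) @^-1` V)) by ring.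
  apply: (le_trans (ler_normB _ _)); lra.
have word V : measurable V -> `|m V - m (act (wordval g w) @^-1` V)| <= 2 * e * l.
  rewrite /l; elim: (w) V => [|[i j] w' ih] V mV /=.
    have -> : act 1 @^-1` V = V by apply/seteqP; split => v /=; rewrite act1.
    by rewrite subrr normr0 mulr0.
  have a1 := letter i j V mV.
  have a2 := ih _ (measurable_preact (g i * adj (g j)) mV).
  have E : act (wordval g w') @^-1` (act (g i * adj (g j)) @^-1` V) =
     act (g i * adj (g j) * wordval g w') @^-1` V.
    by apply/seteqP; split => v /=; rewrite -actM.
  rewrite E in a2.
  set a := m V in a1 *; set b := m _ in a1 a2 *; set d := m _ in a2 *.
  have -> : a - d = (a - b) + (b - d) by ring.
  apply: (le_trans (ler_normD _ _)); rewrite -natr1; lra.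
have Bw : B < nn (wordval g w).
  have := nn_le_close (wordval G w) (wordval g w).
  have -> : wordval g w - wordval G w = - (wordval G w - wordval g w) by rewrite opprB.
  rewrite nnN; have := hr2 g g3; lra.
have [x [x' [x0 x'0 hxx']]] := hB _ (dt_wordval w dg) Bw.
pose V := ~` (cone x del `|` [set 0]).
have m0s := measurable_origin.
have mc1 := measurable_cone x del; have mc2 := measurable_cone x' del.
have mcU : measurable (cone x del `|` [set 0]) by exact: measurableU.
have mV : measurable V by exact: measurableC.
have mVE : m V = 1 - m (cone x del).
  have := mm.2 (cone x del `|` [set 0]) V mcU mV; rewrite setICr setUCr mT.
  move=> /(_ erefl).
  rewrite (mm.2 (cone x del) [set 0])//; first by rewrite m0; lra.
  by apply/seteqP; split => // v /= [[vn0 _] v0]; rewrite v0 eqxx in vn0.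
have hV : m V <= m (act (wordval g w) @^-1` cone x' del).
  apply: mass_le => //; first exact: measurable_preact.
  move=> v /= /not_orP[n1 n2]; apply: hxx' => //; exact/eqP.
have big : exists y, y != 0 /\ (1 - 2 * e * l) / 2 <= m (cone y del).
  have := word _ mc2; rewrite ler_norml => /andP[+ _].
  have [h|h] := leP ((1 - 2 * e * l) / 2) (m (cone x del)); first by exists x.
  by move=> hh; exists x'; split => //; lra.
have [y [y0 hy]] := big.
have [i [j [k [s1 s2 s3]]]] := hc y.
have y20 : 0 < vn y ^+ 2 by rewrite exprn_gt0// vn_gt0.
have disj a b : spread G y (c * vn y ^+ 2) a b ->
    (act (g a) @^-1` cone y del) `&` (act (g b) @^-1` cone y del) = set0.
  move=> sab; apply/seteqP; split => // v [/= va vb].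
  apply: (@cone_disjoint _ (g a) (g b) y K del (c / 2) y0 _ _ (ltW del0) _ _ v va vb) => //.
    have -> : 2 * del * K ^+ 2 = c / 4 by rewrite /del; field; rewrite gt_eqF//; lra.
    lra.
  have := wedge_close (adj (G a)) (adj (g a)) (adj (G b)) (adj (g b)) y.
  rewrite -!adjB !nn_adj => hcl.
  have bnd : nn (G a - g a) * nn (G b) + nn (g a) * nn (G b - g b) <= c / 2.
    have -> : c / 2 = r1 * K + K * r1 by rewrite /r1; field; rewrite gt_eqF//; lra.
    by apply: lerD; apply: ler_pM; rewrite ?nn_ge0//; have := hK0 b; rewrite /K; lra.
  move: sab hcl; rewrite /spread; set P := wedge _ _; set P' := wedge _ _ => sab hcl.
  have : `|P - P'| <= c / 2 * vn y ^+ 2 by rewrite (le_trans hcl)// ler_wpM2r// ltW.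
  move: sab; set X := c * vn y ^+ 2; have -> : c / 2 * vn y ^+ 2 = X / 2 by rewrite /X; field.
  have := lerB_dist P P'; lra.
have mp a : measurable (act (g a) @^-1` cone y del).
  by apply: measurable_preact; exact: measurable_cone.
have lb a : (1 - 2 * e * l) / 2 - e <= m' (act (g a) @^-1` cone y del).
  have := hinv a _ (measurable_cone y del); rewrite ler_norml => /andP[_]; lra.
have tot : m' setT <= 1 + e.
  have := hinv i setT measurableT; rewrite preimage_setT mT ler_norml => /andP[+ _]; lra.
have : m' (act (g i) @^-1` cone y del `|` act (g j) @^-1` cone y del `|` act (g k) @^-1` cone y del) <= m' setT.
  by apply: mass_le => //; apply: measurableU => //; exact: measurableU.
rewrite mm'.2//; [|exact: measurableU|by rewrite setIUl !disj// setU0].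
rewrite mm'.2//; last exact: disj.
have := lb i; have := lb j; have := lb k.
have : e * (8 * l + 16) = 1 by rewrite mulVf// gt_eqF//; lra.
rewrite mulrDr; have -> : 2 * e * l = 2 * (e * l) by ring.
have -> : e * (8 * l) = 8 * (e * l) by ring.
lra.
Qed.

End core.


(** * Polynomial dependence on the coupling *)

Section transfer_polynomials.
Context {R : realType} (f : nat -> R) (E : R).

Lemma blockMS n (t : R) : blockM n.+1 f t E = transfer (f n) t E * blockM n f t E.
Proof.
have -> : blockM n.+1 f t E = \prod_(i <- rev (iota 0 n ++ [:: n])) transfer (f i) t E.
  by rewrite /blockM (_ : iota 0 n.+1 = iota 0 n ++ [:: n])// -addn1 iotaD.
by rewrite rev_cat big_cat /= big_seq1.
Qed.

Lemma blockM0 (t : R) : blockM 0 f t E = 1.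
Proof. by rewrite /blockM big_nil. Qed.

Lemma transferE (y t : R) : (transfer y t E 0 0 = E - y * t) * (transfer y t E 0 1 = -1) *
  (transfer y t E 1 0 = 1) * (transfer y t E 1 1 = 0).
Proof. by rewrite !mxE. Qed.

Lemma dt_transfer (y t : R) : dt (transfer y t E) = 1.
Proof. by rewrite /dt !transferE; ring. Qed.

Lemma dt_blockM n (t : R) : dt (blockM n f t E) = 1.
Proof.
by elim: n => [|n ih]; rewrite ?blockM0 ?dt1// blockMS dtM dt_transfer ih mulr1.
Qed.

(* The two columns of [blockM n f t E] are the values at [t] of the columns started from [(1, 0)] and [(0, 1)]. *)
Fixpoint pcol (u : {poly R} * {poly R}) n : {poly R} * {poly R} :=
  if n is m.+1 then
    let p := pcol u m in ((E%:P - f m *: 'X) * p.1 - p.2, p.1)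
  else u.

Lemma blockM_pcol n (t : R) :
  [/\ blockM n f t E 0 0 = (pcol (1, 0) n).1.[t],
      blockM n f t E 1 0 = (pcol (1, 0) n).2.[t],
      blockM n f t E 0 1 = (pcol (0, 1) n).1.[t] &
      blockM n f t E 1 1 = (pcol (0, 1) n).2.[t]].
Proof.
elim: n => [|n [h1 h2 h3 h4]] /=; first by rewrite blockM0 !one2E !hornerE.
by rewrite blockMS !mul2E !transferE h1 h2 h3 h4; split; rewrite ?hornerE; ring.
Qed.

Lemma size_pcol_step (y : R) (u v : {poly R}) : y != 0 -> (size v < size u)%N ->
  size ((E%:P - y *: 'X) * u - v) = (size u).+1.
Proof.
move=> y0 uv; have u0 : u != 0 by rewrite -size_poly_gt0 (leq_ltn_trans _ uv).
have s2 : size (E%:P - y *: 'X) = 2%N.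
  rewrite -opprB size_polyN size_polyDl ?size_scale ?size_polyX// size_polyN.
  exact: leq_ltn_trans (size_polyC_leq1 _) _.
have s3 : size ((E%:P - y *: 'X) * u) = (size u).+1.
  by rewrite size_mul ?s2// -size_poly_gt0 s2.
by rewrite size_polyDl s3// size_polyN ltnS ltnW.
Qed.

Lemma size_pcol1 n : (forall i, (i < n)%N -> f i != 0) ->
  size (pcol (1, 0) n).1 = n.+1 /\ size (pcol (1, 0) n).2 = n.
Proof.
elim: n => [|n ih] hf; first by rewrite /= size_poly1 size_poly0.
have [h1 h2] := ih (fun i hi => hf i (ltnW hi)).
by rewrite /= size_pcol_step ?hf// ?h1// h2.
Qed.

Lemma size_pcol2 n : (forall i, (i < n.+1)%N -> f i != 0) ->
  size (pcol (0, 1) n.+1).1 = n.+1 /\ size (pcol (0, 1) n.+1).2 = n.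
Proof.
elim: n => [|n ih] hf.
  by rewrite /= mulr0 sub0r size_polyN size_poly1 size_poly0.
have [h1 h2] := ih (fun i hi => hf i (ltnW hi)).
have -> : (pcol (0, 1) n.+2).2 = (pcol (0, 1) n.+1).1 by [].
split; last exact: h1.
have -> : (pcol (0, 1) n.+2).1 = (E%:P - f n.+1 *: 'X) * (pcol (0, 1) n.+1).1 - (pcol (0, 1) n.+1).2 by [].
by rewrite size_pcol_step ?hf// ?h1// h2.
Qed.

(* Squares are needed because for [n = 1] the inverse of [blockM] sends [(1, 0)] to the same direction for all [t], so that [three_directions] fails. *)
Definition sqM n (t : R) := blockM n f t E * blockM n f t E.

(** The degrees [2n], [2n - 1], [2n - 1], [2n - 2] strictly decrease along rows and columns, which
    later prevents leading terms from cancelling. In the square of a two-by-two matrix the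
    off-diagonal entries are the old ones times the trace. *)
Lemma sqM_poly n : (0 < n)%N -> (forall i, (i < n)%N -> f i != 0) ->
  exists A B C D : {poly R},
    [/\ size A = (2 * n).+1, size B = (2 * n)%N, size C = (2 * n)%N & size D = (2 * n).-1] /\
    (forall t, [/\ sqM n t 0 0 = A.[t], sqM n t 0 1 = B.[t],
        sqM n t 1 0 = C.[t] & sqM n t 1 1 = D.[t]]).
Proof.
case: n => // n _ hf.
have [sa sc] := size_pcol1 hf; have [sb sd] := size_pcol2 hf.
set a := (pcol (1, 0) n.+1).1 in sa *; set c := (pcol (1, 0) n.+1).2 in sc *.
set b := (pcol (0, 1) n.+1).1 in sb *; set d := (pcol (0, 1) n.+1).2 in sd *.
have a0 : a != 0 by rewrite -size_poly_gt0 sa.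
have b0 : b != 0 by rewrite -size_poly_gt0 sb.
have c0 : c != 0 by rewrite -size_poly_gt0 sc.
have sbc : size (b * c) = (2 * n).+1.
  by rewrite size_mul// sb sc; lia.
have sad : size (a + d) = n.+2 by rewrite size_polyDl sa// sd; lia.
have ad0 : a + d != 0 by rewrite -size_poly_gt0 sad.
have saa : size (a * a) = (2 * n).+3 by rewrite size_mul// sa; lia.
exists (a * a + b * c), (b * (a + d)), (c * (a + d)), (d * d + b * c); split.
  split.
  - by rewrite size_polyDl saa ?sbc; lia.
  - by rewrite size_mul// sb sad; lia.
  - by rewrite size_mul// sc sad; lia.
  - rewrite addrC size_polyDl sbc; first by lia.
    (* For a block of a single transfer matrix [d] is the zero polynomial. *)
    have [->|d0] := eqVneq d 0; first by rewrite mul0r size_poly0.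
    have : (0 < size d)%N by rewrite size_poly_gt0.
    by rewrite size_mul// sd; lia.
move=> t; have [h1 h2 h3 h4] := blockM_pcol n.+1 t.
by rewrite /sqM !mul2E h1 h2 h3 h4 -/a -/b -/c -/d; split; rewrite !hornerE; ring.
Qed.

Variables (n : nat) (S : seq R).
Hypotheses (n0 : (0 < n)%N) (hf : forall i, (i < n)%N -> f i != 0).
Hypotheses (uS : uniq S) (sS : (4 * n < size S)%N).

Let G (i : 'I_(size S)) := sqM n (nth 0 S i).

(** The form in which the number of support points enters: more than [4 * n] distinct points cannot
    all be roots of a nonzero polynomial of degree at most [4 * n]. *)
Lemma not_all_roots (p : {poly R}) : p != 0 -> (size p <= (4 * n).+1)%N ->
  exists i : 'I_(size S), ~~ root p (nth 0 S i).
Proof.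
move=> p0 hp; apply: contrapT => /forallNP h.
have : all (root p) S.
  apply/(all_nthP 0) => i hi; have := h (Ordinal hi).
  by move=> /negP; rewrite negbK.
move=> /(max_poly_roots p0)/(_ uS); rewrite ltnNge => /negP; apply.
by rewrite (leq_trans hp).
Qed.

(** The polynomial is a combination of the four entries. Because their degrees drop along rows and
    columns, the entry selected by the nonzero coordinates of [x] and [y] has a leading term that
    nothing cancels. *)
Lemma wedge_sqM_poly (x y : R * R) : x != 0 -> y != 0 ->
  exists p : {poly R}, [/\ p != 0, (size p <= (2 * n).+1)%N &
    forall t, p.[t] = wedge (act (sqM n t) y) x].
Proof.
move=> x0 y0; have [A [B [C [D [[sA sB sC sD] hE]]]]] := sqM_poly n0 hf.
exists (x.2 *: (y.1 *: A + y.2 *: B) - x.1 *: (y.1 *: C + y.2 *: D)); split.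
- have n1 : ((2 * n).-1 < 2 * n)%N by lia.
  have D0 : (0 < size D)%N by rewrite sD; lia.
  have x12 : x.1 = 0 -> x.2 != 0.
    by move=> x1; apply: contraNneq x0 => x2; rewrite (surjective_pairing x) x1 x2.
  have y12 : y.1 = 0 -> y.2 != 0.
    by move=> y1; apply: contraNneq y0 => y2; rewrite (surjective_pairing y) y1 y2.
  have szAB : y.1 != 0 -> size (y.1 *: A + y.2 *: B) = (2 * n).+1.
    move=> y1; rewrite size_polyDl (size_scale _ y1) sA//.
    by rewrite (leq_ltn_trans (size_scale_leq _ _))// sB.
  have szCD : y.1 != 0 -> size (y.1 *: C + y.2 *: D) = (2 * n)%N.
    move=> y1; rewrite size_polyDl (size_scale _ y1) sC//.
    by rewrite (leq_ltn_trans (size_scale_leq _ _))// sD.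
  rewrite -size_poly_gt0.
  have [y1|y1] := eqVneq y.1 0.
    rewrite y1 !scale0r !add0r; have y2 := y12 y1.
    have [x2|x2] := eqVneq x.2 0.
      have x1 : x.1 != 0 by apply/eqP => /x12; rewrite x2 eqxx.
      by rewrite x2 scale0r sub0r size_polyN !size_scale.
    have sB2 : size (x.2 *: (y.2 *: B)) = (2 * n)%N by rewrite !size_scale.
    rewrite size_polyDl sB2; first by lia.
    by rewrite size_polyN (leq_ltn_trans (size_scale_leq _ _))// size_scale// sD.
  have [x2|x2] := eqVneq x.2 0.
    have x1 : x.1 != 0 by apply/eqP => /x12; rewrite x2 eqxx.
    by rewrite x2 scale0r sub0r size_polyN size_scale// szCD//; lia.
  rewrite size_polyDl (size_scale _ x2) szAB//.
  by rewrite size_polyN (leq_ltn_trans (size_scale_leq _ _))// szCD.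
- apply: (leq_trans (size_polyD _ _)); rewrite size_polyN geq_max.
  rewrite !(leq_trans (size_scale_leq _ _))// (leq_trans (size_polyD _ _))// geq_max;
    by rewrite !(leq_trans (size_scale_leq _ _))// ?sA ?sB ?sC ?sD//; lia.
move=> t; have [h1 h2 h3 h4] := hE t.
by rewrite /wedge /act h1 h2 h3 h4 !hornerE /=; ring.
Qed.

Lemma dt_sqM m (t : R) : dt (sqM m t) = 1.
Proof. by rewrite /sqM dtM dt_blockM mulr1. Qed.

(** The indices are chosen one after the other. Being parallel to an earlier direction is a
    polynomial condition of degree at most [2 * n], so the third index must avoid the roots of a
    product of degree at most [4 * n]. *)
Lemma sqM_three_directions : three_directions G.
Proof.
move=> x x0.
have dir i : exists p : {poly R}, [/\ p != 0, (size p <= (2 * n).+1)%N &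
    forall j, ~~ root p (nth 0 S j) -> forall hj : (j < size S)%N,
    wedge (act (adj (G i)) x) (act (adj (G (Ordinal hj))) x) != 0].
  have yi0 : act (adj (G i)) x != 0 by rewrite act_eq0// dt_adj dt_sqM.
  have [p [p0 sp hp]] := wedge_sqM_poly x0 yi0.
  exists p; split => // j nr hj; rewrite -wedge_adj /G /= -hp.
  by move: nr; rewrite /root.
have [i _] : exists i : 'I_(size S), ~~ root (1 : {poly R}) (nth 0 S i).
  by apply: not_all_roots; rewrite ?oner_neq0// size_poly1.
have [p [p0 sp hp]] := dir i.
have [j hj] : exists j : 'I_(size S), ~~ root p (nth 0 S j).
  by apply: not_all_roots => //; rewrite (leq_trans sp)//; lia.
have [q [q0 sq hq]] := dir j.
have [k hk] : exists k : 'I_(size S), ~~ root (p * q) (nth 0 S k).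
  apply: not_all_roots; first by rewrite mulf_neq0.
  rewrite size_mul//; move: sp sq; move: (size p) (size q) => a b; by lia.
move: hk; rewrite rootM negb_or => /andP[kp kq].
have ordE (l : 'I_(size S)) : Ordinal (ltn_ord l) = l by exact/val_inj.
exists i, j, k; split.
- by have := hp j hj (ltn_ord j); rewrite ordE.
- by have := hq k kq (ltn_ord k); rewrite ordE.
- by have := hp k kp (ltn_ord k); rewrite ordE.
Qed.

(** Since [A] has larger degree than [C], the term [p *: (A * A)] dominates: the form minus any
    constant has degree exactly [4 * n] and cannot vanish at all the points. *)
Lemma sqM_no_form (p q r : R) : p != 0 -> exists i j,
  p * G i 0 0 ^+ 2 + q * G i 0 0 * G i 1 0 + r * G i 1 0 ^+ 2 !=
  p * G j 0 0 ^+ 2 + q * G j 0 0 * G j 1 0 + r * G j 1 0 ^+ 2.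
Proof.
move=> p0; have [A [B [C [D [[sA sB sC sD] hE]]]]] := sqM_poly n0 hf.
have S0 : (0 < size S)%N by rewrite (leq_ltn_trans _ sS).
pose i0 := Ordinal S0.
pose c := p * G i0 0 0 ^+ 2 + q * G i0 0 0 * G i0 1 0 + r * G i0 1 0 ^+ 2.
pose Q := p *: (A * A) + (q *: (A * C) + r *: (C * C) - c%:P).
have A0 : A != 0 by rewrite -size_poly_gt0 sA.
have C0 : C != 0 by rewrite -size_poly_gt0 sC; lia.
have sQ : size Q = (4 * n).+1.
  have sAA : size (p *: (A * A)) = (4 * n).+1 by rewrite size_scale// size_mul// sA; lia.
  rewrite /Q size_polyDl sAA// ltnS.
  apply: (leq_trans (size_polyD _ _)); rewrite size_polyN geq_max.
  apply/andP; split; last by rewrite (leq_trans (size_polyC_leq1 _))//; lia.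
  apply: (leq_trans (size_polyD _ _)); rewrite geq_max.
  apply/andP; split; apply: (leq_trans (size_scale_leq _ _)); rewrite size_mul// ?sA ?sC; lia.
have [i hi] : exists i : 'I_(size S), ~~ root Q (nth 0 S i).
  by apply: not_all_roots; rewrite ?sQ// -size_poly_gt0 sQ.
exists i, i0; apply: contraNneq hi => h.
have [h1 _ h3 _] := hE (nth 0 S i).
have {}h : c = p * A.[nth 0 S i] ^+ 2 + q * A.[nth 0 S i] * C.[nth 0 S i] + r * C.[nth 0 S i] ^+ 2.
  by rewrite -h1 -h3; exact/esym.
rewrite /root /Q !(hornerD, hornerN, hornerZ, hornerM, hornerC) h; apply/eqP; ring.
Qed.

Lemma sqM_no_almost_invariant_mass : exists r e : R, [/\ 0 < r, 0 < e &
  forall (g : 'I_(size S) -> 'M[R]_2) m m',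
    (forall i, dt (g i) = 1) -> (forall i, nn (G i - g i) <= r) ->
    mass m -> mass m' -> m setT = 1 -> m [set 0] = 0 ->
    (forall i V, measurable V -> `|m V - m' (act (g i) @^-1` V)| <= e) -> False].
Proof.
have S0 : (0 < size S)%N by rewrite (leq_ltn_trans _ sS).
apply: no_almost_invariant_mass; first by move=> i; exact: dt_sqM.
  exact: sqM_three_directions.
apply: (unbounded_words (Ordinal S0)); first by move=> i; exact: dt_sqM.
exact: sqM_no_form.
Qed.

End transfer_polynomials.


(** * The averaging operator on square-integrable functions of the plane *)

Section area.
Context {R : realType}.
Local Open Scope ereal_scope.

(* [lebesgue_measure] lives on [measurableTypeR R], whose display differs from that of the canonical sigma-algebra of [R]. *)
Definition leb : set R -> \bar R := @lebesgue_measure R.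
Lemma leb0 : leb set0 = 0%E. Proof. exact: (measure0 (@lebesgue_measure R)). Qed.
Lemma leb_ge0 A : (0 <= leb A)%E. Proof. exact: (measure_ge0 (@lebesgue_measure R)). Qed.
Lemma leb_sigma : semi_sigma_additive leb.
Proof. exact: (@measure_semi_sigma_additive _ _ _ (@lebesgue_measure R)). Qed.
HB.instance Definition _ := isMeasure.Build _ _ _ leb leb0 leb_ge0 leb_sigma.
Lemma leb_sf : sigma_finite setT leb.
Proof. exact: (@sigma_finiteT _ _ _ (@lebesgue_measure R)). Qed.
HB.instance Definition _ := Measure_isSigmaFinite.Build _ _ _ leb leb_sf.

Definition area : set (R * R)%type -> \bar R := (leb \x leb)%E.
HB.instance Definition _ := Measure.on area.
Lemma area_sf : sigma_finite setT area.
Proof.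
have /sigma_finiteP[F [TF ndF Foo]] := sigma_finiteT (@lebesgue_measure R).
exists (fun n => F n `*` F n).
  apply/seteqP; split => // -[x y] _.
  have [n _ Fx] : (\bigcup_n F n) x by rewrite -TF.
  have [k _ Fy] : (\bigcup_n F n) y by rewrite -TF.
  exists (maxn n k) => //; split => /=.
    by move: x Fx; exact/subsetPset/ndF/leq_maxl.
  by move: y Fy; exact/subsetPset/ndF/leq_maxr.
move=> k; have [m1 m2] := Foo k; split; first exact: measurableX.
by rewrite /area product_measure1E// lte_mul_pinfty// ge0_fin_numE.
Qed.
HB.instance Definition _ := Measure_isSigmaFinite.Build _ _ _ area area_sf.


(** The image of Lebesgue measure under a reflection gives half-open intervals their length, so
    uniqueness of the measure applies. *)
Lemma leb_reflection (c : R) (F : R -> \bar R) :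
  measurable_fun setT F -> (forall x, 0 <= F x) ->
  \int[leb]_x F (c - x)%R = \int[leb]_x F x.
Proof.
move=> mF F0.
have mr : measurable_fun setT (fun x : R => (c - x)%R).
  by apply: measurable_funB => //; exact: measurable_cst.
pose r : {mfun R >-> R} := HB.pack (fun x : R => (c - x)%R) (isMeasurableFun.Build _ _ _ _ _ mr).
pose fl : measurableTypeR R -> measurableTypeR R := fun x : R => (c - x)%R.
have mr' : measurable_fun setT fl := mr.
pose r' : {mfun measurableTypeR R >-> measurableTypeR R} :=
  HB.pack fl (isMeasurableFun.Build _ _ (measurableTypeR R) (measurableTypeR R) _ mr').
have E A : measurable A -> leb A = pushforward leb r A.
  apply: (@lebesgue_measure_unique R (pushforward (@lebesgue_measure R) r')) => X [[a b] _ <-] /=.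
  rewrite /pushforward.
  have -> : r' @^-1` `]a, b]%classic = `[(c - b)%R, (c - a)%R[%classic.
    apply/seteqP; split => [x|x]; rewrite /preimage /= !in_itv /= /fl.
      by rewrite ltrBrDr lerBlDr -lerBlDl -ltrBrDl andbC.
    by rewrite ltrBrDr lerBlDr -lerBlDl -ltrBrDl andbC.
  rewrite !lebesgue_measure_itv /= !lte_fin ltrD2l ltrN2.
  by case: ifP => // _; rewrite -!EFinB; congr EFin; ring.
transitivity (\int[pushforward leb r]_(x in [set: R]) F x).
  by rewrite ge0_integral_pushforward//.
by apply: eq_measure_integral => A mA _; exact/esym/E.
Qed.

Definition area_preserving (A : 'M[R]_2) := forall F : R * R -> \bar R,
  measurable_fun setT F -> (forall x, 0 <= F x) ->
  \int[area]_v F (act A v) = \int[area]_v F v.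

Lemma area_preserving1 : area_preserving 1%R.
Proof. by move=> F _ _; apply: eq_integral => v _; rewrite act1. Qed.

Lemma area_preservingM A B : area_preserving A -> area_preserving B ->
  area_preserving (A * B)%R.
Proof.
move=> hA hB F mF F0; rewrite -[RHS]hA//.
rewrite -[RHS]hB//; last by apply: measurableT_comp => //; exact: measurable_act.
by apply: eq_integral => v _; rewrite actM.
Qed.

(** For a fixed first coordinate, the transfer matrix reflects the second one and then exchanges the
    two. Integrating in opposite orders on the two sides absorbs the exchange. *)
Lemma area_preserving_transfer (y t E : R) : area_preserving (transfer y t E).
Proof.
move=> F mF F0.
have mFA : measurable_fun setT (F \o act (transfer y t E)).
  by apply: measurableT_comp => //; exact: measurable_act.
rewrite [LHS](fubini_tonelli1 (F \o act (transfer y t E)))//; last by move=> x; exact: F0.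
rewrite [RHS](fubini_tonelli2 F)//; apply: eq_integral => x _.
rewrite /fubini_F /fubini_G /=.
rewrite -[RHS](@leb_reflection ((E - y * t) * x)%R (fun z => F (z, x)))//; last first.
  by apply: (measurableT_comp mF); exact: pair2_measurable.
by apply: eq_integral => z _; rewrite /act !transferE /=; congr (F (_, _)); ring.
Qed.

Lemma area_preserving_blockM n f t E : area_preserving (blockM n f t E).
Proof.
elim: n => [|n ih]; first by rewrite blockM0; exact: area_preserving1.
by rewrite blockMS; apply: area_preservingM ih; exact: area_preserving_transfer.
Qed.

Lemma area_set0 : area [set 0%R] = 0.
Proof.
rewrite (_ : [set 0%R] = [set 0%R] `*` [set 0%R]); last first.
  by apply/seteqP; split => [[a b]|[a b]] /= => [[-> ->]|[-> ->]].
by rewrite /area /= product_measure1E//= /leb lebesgue_measure_set1 mule0.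
Qed.

End area.


(** * The averaging operator: energy identity and contraction *)

Section averaging.
Context {R : realType} (nu : probability R R) (M : R -> 'M[R]_2).
Hypothesis mM : forall i j, measurable_fun setT (fun t => M t i j).
Hypothesis dM : forall t, dt (M t) = 1.
Hypothesis pM : forall t, area_preserving (M t).
Local Open Scope ereal_scope.

(** Values in [0, 1] make the inner average finite at every point, so that [fine] in [Qop] loses
    nothing, and the class is stable under [Qop]. *)
Definition unit_fun (h : R * R -> R) :=
  measurable_fun setT h /\ forall v, (0 <= h v <= 1)%R.

Definition Qop (h : R * R -> R) (v : R * R) : R :=
  fine (\int[nu]_t (h (act (M t) v))%:E).

Definition L2 (h : R * R -> R) := \int[area]_v (h v ^+ 2)%:E.

Lemma measurable_act_joint :
  measurable_fun setT (fun z : (R * R) * R => act (M z.2) z.1).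
Proof.
have m2 i j : measurable_fun setT (fun z : (R * R) * R => M z.2 i j).
  exact: (measurableT_comp (mM i j)).
have m11 : measurable_fun setT (fun z : (R * R) * R => z.1.1) by exact: measurableT_comp.
have m12 : measurable_fun setT (fun z : (R * R) * R => z.1.2) by exact: measurableT_comp.
by apply/measurable_fun_pairP; split; rewrite /comp /act /=;
  apply: measurable_funD; exact: measurable_funM.
Qed.

Lemma measurable_act_param v : measurable_fun setT (fun t => act (M t) v).
Proof.
exact: (measurableT_comp measurable_act_joint (pair1_measurable v)).
Qed.

Lemma Qop_fin h v : unit_fun h ->
  [/\ (Qop h v)%:E = \int[nu]_t (h (act (M t) v))%:E, (0 <= Qop h v)%R & (Qop h v <= 1)%R].
Proof.
move=> [mh h01].
have m1 : measurable_fun setT (fun t => (h (act (M t) v))%:E).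
  by apply/measurable_EFinP; apply: (measurableT_comp mh); exact: measurable_act_param.
have i0 : 0 <= \int[nu]_t (h (act (M t) v))%:E.
  by apply: integral_ge0 => t _; rewrite lee_fin; have /andP[] := h01 (act (M t) v).
have i1 : \int[nu]_t (h (act (M t) v))%:E <= 1.
  have -> : 1 = \int[nu]_(t in [set: R]) (cst 1 t) :> \bar R.
    by rewrite integral_cst//= probability_setT mule1.
  apply: ge0_le_integral => //.
  - by move=> t _; rewrite lee_fin; have /andP[] := h01 (act (M t) v).
  - by move=> t _ /=; rewrite lee_fin; have /andP[] := h01 (act (M t) v).
have fn : \int[nu]_t (h (act (M t) v))%:E \is a fin_num.
  by rewrite ge0_fin_numE// (le_lt_trans i1)// ltry.
have E : (Qop h v)%:E = \int[nu]_t (h (act (M t) v))%:E by rewrite /Qop fineK.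
by split => //; rewrite -lee_fin E.
Qed.

Lemma Qop_unit h : unit_fun h -> unit_fun (Qop h).
Proof.
move=> uh; split; last by move=> v; have [_ -> ->] := Qop_fin v uh.
have [mh h01] := uh.
apply/measurable_EFinP.
rewrite (_ : EFin \o Qop h = fubini_F nu (fun z => (h (act (M z.2) z.1))%:E)); last first.
  by apply/funext => v /=; have [-> _ _] := Qop_fin v uh.
apply: measurable_fun_fubini_tonelli_F.
- by apply/measurable_EFinP; apply: (measurableT_comp mh); exact: measurable_act_joint.
- by move=> z; rewrite lee_fin; have /andP[] := h01 (act (M z.2) z.1).
Qed.

Lemma measurable_sqE d (T : measurableType d) (D : set T) (f : T -> R) :
  measurable_fun D f -> measurable_fun D (fun x => (f x ^+ 2)%:E).
Proof. by move=> mf; apply/measurable_EFinP; exact: measurable_funX. Qed.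

Lemma variance h v : unit_fun h ->
  \int[nu]_t ((h (act (M t) v) - Qop h v) ^+ 2)%:E + (Qop h v ^+ 2)%:E =
  \int[nu]_t (h (act (M t) v) ^+ 2)%:E.
Proof.
move=> uh; have [hE k0 k1] := Qop_fin v uh; have [mh h01] := uh.
set k := Qop h v in hE k0 k1 *.
pose X t := h (act (M t) v).
have mX : measurable_fun setT X.
  by apply: (measurableT_comp mh); exact: measurable_act_param.
have X0 t : (0 <= X t)%R by have /andP[] := h01 (act (M t) v).
have mXk : measurable_fun setT (fun t => (X t - k)%R).
  by apply: measurable_funB => //; exact: measurable_cst.
(* The expanded square is arranged with nonnegative terms on both sides, so that additivity of the
   integral applies without subtraction. *)
have e1 : \int[nu]_t (((X t - k) ^+ 2)%:E + (2 * k * X t)%:E) =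
    \int[nu]_t ((X t ^+ 2)%:E + (k ^+ 2)%:E).
  by apply: eq_integral => t _; rewrite -!EFinD; congr EFin; ring.
move: e1; rewrite ge0_integralD//; first last.
- apply/measurable_EFinP; apply: measurable_funM => //; exact: measurable_cst.
- by move=> t _; rewrite lee_fin !mulr_ge0.
- exact: measurable_sqE.
- by move=> t _; rewrite lee_fin sqr_ge0.
rewrite [RHS]ge0_integralD//; first last.
- by move=> t _; rewrite lee_fin sqr_ge0.
- exact: measurable_sqE.
- by move=> t _; rewrite lee_fin sqr_ge0.
rewrite integral_cst//= probability_setT mule1.
have -> : \int[nu]_t (2 * k * X t)%:E = (2 * k * k)%:E.
  under eq_integral do rewrite EFinM.
  rewrite ge0_integralZl_EFin//; first by rewrite -hE -EFinM.
  - by move=> t _; rewrite lee_fin.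
  - exact/measurable_EFinP.
  - by rewrite mulr_ge0.
have -> : (2 * k * k)%R = (k ^+ 2 + k ^+ 2)%R by ring.
rewrite EFinD addeA => e2.
rewrite -[LHS](@addeK _ (k ^+ 2)%:E) ?e2 ?addeK//.
Qed.

Lemma L2_ge0 h : 0 <= L2 h.
Proof. by apply: integral_ge0 => v _; rewrite lee_fin sqr_ge0. Qed.

Definition deviation h t :=
  \int[area]_v ((h (act (M t) v) - Qop h v) ^+ 2)%:E.

Lemma measurable_deviation_joint h : unit_fun h ->
  measurable_fun setT (fun z : (R * R) * R =>
    ((h (act (M z.2) z.1) - Qop h z.1) ^+ 2)%:E).
Proof.
move=> uh; have [mh _] := uh; have [mq _] := Qop_unit uh.
apply: measurable_sqE; apply: measurable_funB.
  by apply: (measurableT_comp mh); exact: measurable_act_joint.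
exact: (measurableT_comp mq).
Qed.

Lemma measurable_deviation h : unit_fun h -> measurable_fun setT (deviation h).
Proof.
move=> uh.
apply: (measurable_fun_fubini_tonelli_G (m1 := area)
  (fun z : (R * R) * R => ((h (act (M z.2) z.1) - Qop h z.1) ^+ 2)%:E)).
  exact: measurable_deviation_joint.
by move=> z; rewrite lee_fin sqr_ge0.
Qed.

(** The pointwise variance formula is integrated over the plane. After exchanging the integrals,
    area preservation turns each second moment into [L2 h]. *)
Lemma energy_identity h : unit_fun h ->
  \int[nu]_t deviation h t + L2 (Qop h) = L2 h.
Proof.
move=> uh; have [mh h01] := uh; have uq := Qop_unit uh; have [mq q01] := uq.
pose F z : \bar R := ((h (act (M z.2) z.1) - Qop h z.1) ^+ 2)%:E.
have mF : measurable_fun setT F by exact: measurable_deviation_joint.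
have F0 z : 0 <= F z by rewrite lee_fin sqr_ge0.
have -> : \int[nu]_t deviation h t = \int[area]_v \int[nu]_t F (v, t).
  by rewrite (fubini_tonelli F).
pose H z : \bar R := (h (act (M z.2) z.1) ^+ 2)%:E.
have mH : measurable_fun setT H.
  by apply: measurable_sqE; apply: (measurableT_comp mh); exact: measurable_act_joint.
have H0 z : 0 <= H z by rewrite lee_fin sqr_ge0.
rewrite /L2 -ge0_integralD//; first last.
- exact: measurable_sqE.
- by move=> v _; rewrite lee_fin sqr_ge0.
- exact: (measurable_fun_fubini_tonelli_F F).
- by move=> v _; apply: integral_ge0.
transitivity (\int[area]_v \int[nu]_t H (v, t)).
  by apply: eq_integral => v _; rewrite /F /H /= variance.
rewrite (fubini_tonelli H)//.
transitivity (\int[nu]_(t in [set: R]) cst (L2 h) t).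
  apply: eq_integral => t _ /=; rewrite /L2 -(pM t)//; first exact: measurable_sqE.
  by move=> x; rewrite lee_fin sqr_ge0.
by rewrite integral_cst//= probability_setT mule1.
Qed.

Lemma L2_Qop_le h : unit_fun h -> L2 (Qop h) <= L2 h.
Proof.
move=> uh; rewrite -[leRHS]energy_identity// leeDr//.
by apply: integral_ge0 => t _; apply: integral_ge0 => v _; rewrite lee_fin sqr_ge0.
Qed.

(** Markov's inequality: a larger deviation on all of [U], whose weight is at least [w], would cost
    at least [2 * k * N], while the energy identity leaves at most [k * N]. *)
Lemma small_deviation h (N k w : R) (U : set R) : unit_fun h ->
  L2 h = N%:E -> (0 < N)%R -> (0 < k)%R -> (0 < w)%R -> measurable U -> w%:E <= nu U ->
  ((1 - k) * N)%:E <= L2 (Qop h) ->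
  exists2 t, U t & deviation h t <= (2 * k / w * N)%:E.
Proof.
move=> uh hN N0 k0 w0 mU wU hQ; apply: contrapT => hno.
have big t : U t -> (2 * k / w * N)%:E <= deviation h t.
  by move=> Ut; rewrite leNgt; apply/negP => hlt; apply: hno; exists t => //; exact: ltW.
have dev0 t : 0 <= deviation h t by apply: integral_ge0 => v _; rewrite lee_fin sqr_ge0.
have c0 : (0 <= 2 * k / w * N)%R by rewrite !mulr_ge0 ?invr_ge0// ltW.
have step1 : (2 * k * N)%:E <= \int[nu]_t deviation h t.
  apply: (@le_trans _ _ (\int[nu]_(t in U) deviation h t)); last first.
    by apply: ge0_subset_integral => //; exact: measurable_deviation.
  apply: (@le_trans _ _ (\int[nu]_(t in U) cst (2 * k / w * N)%:E t)).
    rewrite integral_cst//.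
    apply: (@le_trans _ _ ((2 * k / w * N)%:E * w%:E)).
      by rewrite -EFinM lee_fin; have -> : (2 * k / w * N * w = 2 * k * N)%R by field; rewrite gt_eqF.
    by apply: lee_pmul => //; rewrite lee_fin ltW.
  apply: ge0_le_integral => //.
  exact: measurable_funS (measurable_deviation uh).
have := energy_identity uh; rewrite hN => e.
have : (2 * k * N)%:E + ((1 - k) * N)%:E <= N%:E by rewrite -e; exact: leeD.
rewrite -EFinD lee_fin => hle.
have : (0 < k * N)%R by rewrite mulr_gt0.
have -> : (k * N = (2 * k * N + (1 - k) * N) - N)%R by ring.
by rewrite subr_gt0 ltNge hle.
Qed.

Definition msq h (V : set (R * R)) := fine (\int[area]_(v in V) (h v ^+ 2)%:E).

Lemma msq_le h V : unit_fun h -> measurable V ->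
  \int[area]_(v in V) (h v ^+ 2)%:E <= L2 h.
Proof.
move=> [mh _] mV; apply: ge0_subset_integral => //; last by move=> v _; rewrite lee_fin sqr_ge0.
exact: measurable_sqE.
Qed.

Lemma msqE h V : unit_fun h -> measurable V -> L2 h < +oo ->
  (msq h V)%:E = \int[area]_(v in V) (h v ^+ 2)%:E.
Proof.
move=> uh mV hfin; rewrite /msq fineK// ge0_fin_numE.
  exact: le_lt_trans (msq_le uh mV) hfin.
by apply: integral_ge0 => v _; rewrite lee_fin sqr_ge0.
Qed.

Lemma mass_msq h (N : R) : unit_fun h -> L2 h < +oo -> (0 < N)%R ->
  mass (fun V => msq h V / N)%R.
Proof.
move=> uh hfin N0; split => [V mV|U V mU mV UV].
  rewrite divr_ge0 ?(ltW N0)// -lee_fin msqE//.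
  by apply: integral_ge0 => v _; rewrite lee_fin sqr_ge0.
rewrite -mulrDl; congr (_ / N)%R; apply: EFin_inj; rewrite EFinD !msqE//; last exact: measurableU.
have [mh _] := uh.
rewrite ge0_integral_setU//.
- by apply: measurable_sqE; exact: measurable_funS mh.
- by move=> v _; rewrite lee_fin sqr_ge0.
- exact/disj_set2P.
Qed.

Lemma sq_integral_close (X Y : R * R -> R) (W : set (R * R)) (s eta : R) :
  measurable W -> measurable_fun setT X -> measurable_fun setT Y -> (0 < s)%R ->
  \int[area]_v ((X v - Y v) ^+ 2)%:E <= eta%:E ->
  \int[area]_(v in W) (X v ^+ 2)%:E <=
    (1 + s)%:E * \int[area]_(v in W) (Y v ^+ 2)%:E + ((1 + s^-1) * eta)%:E.
Proof.
move=> mW mX mY s0 hd.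
have mXY : measurable_fun setT (fun v => (X v - Y v)%R) by exact: measurable_funB.
have mW' (f : R * R -> R) : measurable_fun setT f -> measurable_fun W (fun v => (f v ^+ 2)%:E).
  by move=> mf; apply: measurable_sqE; exact: measurable_funS mf.
have si : (0 < s^-1)%R by rewrite invr_gt0.
apply: (@le_trans _ _ (\int[area]_(v in W) ((1 + s)%:E * (Y v ^+ 2)%:E + (1 + s^-1)%:E * ((X v - Y v) ^+ 2)%:E))).
  apply: ge0_le_integral => //.
  - by move=> v _; rewrite lee_fin sqr_ge0.
  - exact: mW'.
  - by apply: emeasurable_funD; apply: measurable_funeM; exact: mW'.
  - move=> v _; rewrite -!EFinM -EFinD lee_fin.
    (* Young's inequality *)
    rewrite -subr_ge0.
    have -> : ((1 + s) * Y v ^+ 2 + (1 + s^-1) * (X v - Y v) ^+ 2 - X v ^+ 2 =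
       s^-1 * ((X v - Y v) - s * Y v) ^+ 2)%R by field; rewrite gt_eqF.
    by rewrite mulr_ge0 ?sqr_ge0// ltW.
have a0 (a b : R) : (0 <= a)%R -> 0 <= a%:E * (b ^+ 2)%:E :> \bar R.
  by move=> a0; rewrite -EFinM lee_fin mulr_ge0 ?sqr_ge0.
have s10 : (0 <= 1 + s)%R by rewrite addr_ge0 ?(ltW s0).
have s20 : (0 <= 1 + s^-1)%R by rewrite addr_ge0 ?(ltW si).
rewrite ge0_integralD//; first last.
- by apply: measurable_funeM; exact: mW'.
- by move=> v _; exact: a0.
- by apply: measurable_funeM; exact: mW'.
- by move=> v _; exact: a0.
rewrite !ge0_integralZl_EFin//; first last.
- exact: mW'.
- by move=> v _; rewrite lee_fin sqr_ge0.
- exact: mW'.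
- by move=> v _; rewrite lee_fin sqr_ge0.
apply: leeD2l; rewrite EFinM; apply: lee_wpmul2l; first by rewrite lee_fin.
apply: le_trans hd; apply: ge0_subset_integral => //.
  exact: measurable_sqE.
by move=> v _; rewrite lee_fin sqr_ge0.
Qed.

(** Area preservation rewrites the mass of [V] under [h] as that of its preimage under [h] composed
    with [M t]. This function and [Qop h] are then compared on the preimage in both directions. *)
Lemma msq_close h (N s eta : R) t V : unit_fun h -> L2 h <= N%:E ->
  (0 < s)%R -> deviation h t <= eta%:E -> measurable V ->
  (`|msq h V - msq (Qop h) (act (M t) @^-1` V)| <= s * N + (1 + s^-1) * eta)%R.
Proof.
move=> uh hN s0 hd mV; have [mh h01] := uh; have uq := Qop_unit uh; have [mq q01] := uq.
have hfin : L2 h < +oo by rewrite (le_lt_trans hN)// ltry.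
have qN : L2 (Qop h) <= N%:E by rewrite (le_trans (L2_Qop_le uh)).
have qfin : L2 (Qop h) < +oo by rewrite (le_lt_trans qN)// ltry.
set W := act (M t) @^-1` V.
have mW : measurable W by exact: measurable_preact.
pose X v := h (act (M t) v).
have mX : measurable_fun setT X by apply: (measurableT_comp mh); exact: measurable_act.
have hE : (msq h V)%:E = \int[area]_(v in W) (X v ^+ 2)%:E.
  rewrite msqE// integral_mkcond [RHS]integral_mkcond -(pM t).
  - by apply: eq_integral => v _; rewrite !patchE /W /X; congr (if _ then _ else _); apply/asbool_equiv_eq.
  - apply/(measurable_restrictT _ _).1 => //; apply: measurable_sqE; exact: measurable_funS mh.
  - by move=> v; rewrite patchE; case: ifP => // _; rewrite lee_fin sqr_ge0.
have kE := msqE uq mW qfin.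
have h1 := sq_integral_close mW mX mq s0 hd.
have h2 : \int[area]_(v in W) (Qop h v ^+ 2)%:E <=
    (1 + s)%:E * \int[area]_(v in W) (X v ^+ 2)%:E + ((1 + s^-1) * eta)%:E.
  apply: sq_integral_close => //.
  apply: le_trans hd; apply: ge0_le_integral => //.
  - by move=> v _; rewrite lee_fin sqr_ge0.
  - by apply: measurable_sqE; exact: measurable_funB.
  - by apply: measurable_sqE; exact: measurable_funB.
  - by move=> v _; rewrite lee_fin -sqrrN opprB.
move: h1 h2; rewrite -hE -kE -!EFinM -!EFinD !lee_fin => h1 h2.
have a1 : (msq h V <= N)%R by rewrite -lee_fin msqE//; exact: le_trans (msq_le uh mV) hN.
have a2 : (msq (Qop h) W <= N)%R by rewrite -lee_fin msqE//; exact: le_trans (msq_le uq mW) qN.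
have b1 : (s * msq h V <= s * N)%R by rewrite ler_wpM2l// ltW.
have b2 : (s * msq (Qop h) W <= s * N)%R by rewrite ler_wpM2l// ltW.
move: h1 h2; rewrite !mulrDl !mul1r => h1 h2.
rewrite ler_norml; apply/andP; split; lra.
Qed.

Lemma positive_lower_bound (I : finType) (F : I -> R) :
  (forall i, 0 < F i)%R -> exists2 w : R, (0 < w)%R & forall i, (w <= F i)%R.
Proof.
move=> F0; have S0 : (0 <= \sum_i (F i)^-1)%R.
  by apply: sumr_ge0 => i _; rewrite invr_ge0 ltW.
(* This witness needs no minimum and also covers an empty index type. *)
exists (\sum_i (F i)^-1 + 1)^-1%R; first by rewrite invr_gt0 ltr_wpDl.
move=> i; rewrite -[leRHS]invrK lef_pV2 ?posrE ?invr_gt0 ?ltr_wpDl//.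
rewrite (bigD1 i)//= -addrA lerDl addr_ge0// sumr_ge0// => j _.
by rewrite invr_ge0 ltW.
Qed.

(* If averaging twice hardly decreases the L2 norm, then by the energy identity [h \o M t] is close to [Qop h], and [Qop h \o M t'] close to [Qop (Qop h)], for some [t], [t'] near each [tau i], so the mass [h ^+ 2] is almost invariant in the sense excluded by the hypothesis on [g], [m], [m']. *)
Theorem Qop2_contraction (n : nat) (tau : 'I_n -> R) (r e : R) :
  (0 < r)%R -> (0 < e)%R ->
  (forall (g : 'I_n -> 'M[R]_2) m m',
    (forall i, dt (g i) = 1%R) ->
    (forall i, nn (M (tau i) * M (tau i) - g i) <= r)%R ->
    mass m -> mass m' -> m setT = 1%R -> m [set 0%R] = 0%R ->
    (forall i V, measurable V -> `|m V - m' (act (g i) @^-1` V)| <= e)%R -> False) ->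
  (forall i (rho : R), (0 < rho)%R -> 0 < nu (ball (tau i) rho)) ->
  (forall i (rho : R), (0 < rho)%R -> exists2 de : R, (0 < de)%R &
     forall t, ball (tau i) de t -> (nn (M (tau i) - M t) <= rho)%R) ->
  exists k : R, (0 < k < 1)%R /\ forall h, unit_fun h -> L2 h < +oo ->
    L2 (Qop (Qop h)) <= (1 - k)%:E * L2 h.
Proof.
move=> r0 e0 core supp cont.
have hnear i : exists de : R, (0 < de)%R /\ forall t t', ball (tau i) de t ->
    ball (tau i) de t' -> (nn (M (tau i) * M (tau i) - M t * M t') <= r)%R.
  pose K := (nn (M (tau i)) + 1)%R.
  have K1 : (1 <= K)%R by rewrite /K lerDr nn_ge0.
  pose rho := Num.min 1%R (r / (2 * K))%R.
  have rho0 : (0 < rho)%R by rewrite lt_min ltr01 divr_gt0// mulr_gt0//; lra.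
  have [de de0 hde] := cont i _ rho0.
  exists de; split => // t t' /hde ht /hde ht'.
  apply: (le_trans (nn_mul_close _ _ _ _)).
  have h1 : (rho <= 1)%R by rewrite ge_min lexx.
  have h2 : (rho <= r / (2 * K))%R by rewrite ge_min lexx orbT.
  have tK : (nn (M t) <= K)%R.
    have := nn_le_close (M t) (M (tau i)); rewrite /K; lra.
  have iK : (nn (M (tau i)) <= K)%R by rewrite /K; lra.
  have -> : r = (r / (2 * K) * K + K * (r / (2 * K)))%R by field; rewrite gt_eqF//; lra.
  by apply: lerD; apply: ler_pM; rewrite ?nn_ge0//; lra.
have [de hde] := choice hnear.
pose U i := ball (tau i) (de i).
have mU i : measurable (U i) by exact: measurable_ball.
have Ufin i : nu (U i) \is a fin_num by exact: fin_num_measure.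
have [w w0 hw] : exists2 w : R, (0 < w)%R & forall i, (w <= fine (nu (U i)))%R.
  apply: positive_lower_bound => i; apply: fine_gt0; rewrite ltey_eq Ufin andbT.
  by apply: supp; have [] := hde i.
have hwE i : w%:E <= nu (U i) by rewrite -(fineK (Ufin i)) lee_fin.
(* Two comparisons are made, from [h] to [Qop h] and on to [Qop (Qop h)]. Each costs [s * N] plus
   [(1 + s^-1) * eta * N], that is two quarters of [e * N]. *)
pose s := (e / 4)%R; pose eta := (e / (4 * (1 + s^-1)))%R.
have s0 : (0 < s)%R by rewrite divr_gt0.
have si : (0 < 1 + s^-1)%R by rewrite addr_gt0 ?invr_gt0.
have eta0 : (0 < eta)%R by rewrite divr_gt0// mulr_gt0.
(* The first bound keeps [1 - k] positive, the second makes the deviation [2 * k / w] at most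
   [eta]. *)
pose k := Num.min (1 / 2)%R (eta * w / 2)%R.
have k0 : (0 < k)%R by rewrite lt_min divr_gt0//= divr_gt0// mulr_gt0.
have k12 : (k <= 1 / 2)%R by rewrite ge_min lexx.
have keta : (2 * k / w <= eta)%R.
  rewrite ler_pdivrMr//.
  have : (k <= eta * w / 2)%R by rewrite ge_min lexx orbT.
  lra.
exists k; split; first by apply/andP; split => //; lra.
move=> h uh hfin; rewrite leNgt; apply/negP => hlt.
have [N hN] : exists N : R, L2 h = N%:E.
  by exists (fine (L2 h)); rewrite fineK// ge0_fin_numE ?L2_ge0.
rewrite hN -EFinM in hlt.
have uq := Qop_unit uh; have uqq := Qop_unit uq.
have le1 := L2_Qop_le uh; have le2 := L2_Qop_le uq.
rewrite hN in le1.
have N0 : (0 < N)%R.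
  have N0' : (0 <= N)%R by rewrite -lee_fin -hN L2_ge0.
  rewrite lt0r N0' andbT; apply/eqP => Nz.
  have := lt_le_trans hlt (le_trans le2 le1).
  by rewrite Nz mulr0 ltxx.
have [N1 hN1] : exists N1 : R, L2 (Qop h) = N1%:E.
  exists (fine (L2 (Qop h))); rewrite fineK// ge0_fin_numE ?L2_ge0//.
  by rewrite (le_lt_trans le1)// ltry.
rewrite hN1 lee_fin in le1.
(* As [Qop] never increases [L2], a small loss over two averages bounds the loss of each single
   one. *)
have lb1 : ((1 - k) * N <= N1)%R by rewrite -lee_fin -hN1 (le_trans (ltW hlt)).
have N10 : (0 < N1)%R.
  by rewrite (lt_le_trans _ lb1)// mulr_gt0//; lra.
have lb2 : ((1 - k) * N1)%:E <= L2 (Qop (Qop h)).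
  apply: le_trans (ltW hlt); rewrite lee_fin ler_wpM2l//; lra.
have dev i : exists t, U i t /\ deviation h t <= (eta * N)%:E.
  have [|t Ut ht] := small_deviation uh hN N0 k0 w0 (mU i) (hwE i).
    by rewrite hN1 lee_fin.
  exists t; split => //; apply: (le_trans ht).
  by rewrite lee_fin ler_wpM2r// ltW.
have dev' i : exists t, U i t /\ deviation (Qop h) t <= (eta * N)%:E.
  have [//|t Ut ht] := small_deviation uq hN1 N10 k0 w0 (mU i) (hwE i).
  exists t; split => //; apply: (le_trans ht).
  rewrite lee_fin; apply: ler_pM => //; last exact: ltW.
  by rewrite !mulr_ge0 ?invr_ge0// ltW.
have [t ht] := choice dev; have [t' ht'] := choice dev'.
have qfin : L2 (Qop h) < +oo by rewrite hN1 ltry.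
have qqfin : L2 (Qop (Qop h)) < +oo by rewrite (le_lt_trans le2).
have hle : L2 h <= N%:E by rewrite hN.
have qle : L2 (Qop h) <= N%:E by rewrite hN1 lee_fin.
apply: (core (fun i => M (t i) * M (t' i))%R
  (fun V => msq h V / N)%R (fun V => msq (Qop (Qop h)) V / N)%R).
- by move=> i; rewrite dtM !dM mulr1.
- by move=> i; have [_ hd] := hde i; apply: hd; [have [] := ht i|have [] := ht' i].
- exact: mass_msq.
- exact: mass_msq.
- have : (msq h setT)%:E = N%:E by rewrite msqE//.
  by case=> ->; rewrite divff// gt_eqF.
- rewrite /msq; suff -> : \int[area]_(v in [set 0%R]) (h v ^+ 2)%:E = 0 by rewrite /= mul0r.
  apply: null_set_integral; [exact: measurable_origin| |exact: area_set0].
  by apply: measurable_sqE; have [mh _] := uh; exact: measurable_funS mh.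
move=> i V mV.
have [Ut dt1] := ht i; have [Ut' dt2] := ht' i.
have c1 := msq_close uh hle s0 dt1 mV.
have mV1 : measurable (act (M (t i)) @^-1` V) by exact: measurable_preact.
have c2 := msq_close uq qle s0 dt2 mV1.
have E : act (M (t' i)) @^-1` (act (M (t i)) @^-1` V) = act (M (t i) * M (t' i))%R @^-1` V.
  by apply/seteqP; split => v /=; rewrite actM.
rewrite E in c2.
rewrite -mulrBl normrM [X in (_ * X <= _)%R]gtr0_norm ?invr_gt0// ler_pdivrMr//.
have -> : (e * N = (s * N + (1 + s^-1) * (eta * N)) + (s * N + (1 + s^-1) * (eta * N)))%R.
  have hs : ((1 + s^-1) * eta = e / 4)%R by rewrite /eta; move: si; set z := (1 + s^-1)%R => z0; field; rewrite gt_eqF.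
  by rewrite (mulrA (1 + s^-1)%R eta N) hs /s; field.
set a := msq h V in c1 *; set b := msq (Qop h) _ in c1 c2; set c := msq (Qop (Qop h)) _ in c2 *.
have -> : (a - c = (a - b) + (b - c))%R by ring.
by apply: (le_trans (ler_normD _ _)); exact: lerD.
Qed.

End averaging.


(** * Sequence space and zero-one law *)

Section sequence_space.
Context {R : realType}.
Local Open Scope ereal_scope.

Definition cyl (B : nat -> set R) n : set (nat -> R) :=
  [set x | forall i, (i < n)%N -> B i (x i)].

Definition cylinders : set (set (nat -> R)) :=
  [set A | exists B n, (forall i, measurable (B i)) /\ A = cyl B n].

(** Sequences with the sigma-algebra of cylinders. The given probability space need not carry a
    shift, so the law of the process is studied here. *)
Definition seqT := g_sigma_algebraType cylinders.
HB.instance Definition _ := Measurable.on seqT.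

Definition theta (x : seqT) : seqT := fun n => x n.+1.

Lemma measurable_cyl B n : (forall i, measurable (B i)) ->
  measurable (cyl B n : set seqT).
Proof. by move=> mB; apply: sub_sigma_algebra; exists B, n. Qed.

Lemma setI_closed_cylinders : setI_closed cylinders.
Proof.
move=> _ _ [B [n [mB ->]]] [B' [n' [mB' ->]]].
exists (fun i => (if (i < n)%N then B i else setT) `&` (if (i < n')%N then B' i else setT)),
  (maxn n n'); split.
  by move=> i; apply: measurableI; case: ifP.
apply/seteqP; split => x.
  by move=> [h h'] i _; split; case: ifP => // hi; [exact: h|exact: h'].
move=> h; split => i hi.
  by have := h i; rewrite leq_max hi => /(_ isT)[].
by have := h i; rewrite leq_max hi orbT => /(_ isT)[_].
Qed.

Lemma cyl0 B : cyl B 0 = setT.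
Proof. by apply/seteqP; split. Qed.

Lemma cylS B n : cyl B n.+1 = [set x : seqT | B 0%N (x 0%N) /\ cyl (fun i => B i.+1) n (theta x)].
Proof.
apply/seteqP; split => x.
  by move=> h; split; [exact: h|move=> i hi; exact: h].
by move=> [h0 h] [|i] hi //; exact: h.
Qed.

Lemma measurable_coord i : measurable_fun setT (fun x : seqT => x i).
Proof.
move=> _ B mB; rewrite setTI.
have -> : (fun x : seqT => x i) @^-1` B = cyl (fun j => if j == i then B else setT) i.+1.
  apply/seteqP; split => x.
    by move=> h j _; case: eqP => // ->.
  by move=> /(_ i (ltnSn i)); rewrite eqxx.
by apply: measurable_cyl => j; case: ifP.
Qed.

Lemma measurable_to_seqT d (T : measurableType d) (Y : nat -> T -> R) :
  (forall n, measurable_fun setT (Y n)) ->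
  measurable_fun setT ((fun w n => Y n w) : T -> seqT).
Proof.
move=> mY; apply: (@measurability _ _ T seqT setT _ cylinders) => //.
move=> _ [_ [B [n [mB ->]]] <-]; rewrite setTI.
have -> : (fun w n => Y n w) @^-1` cyl B n = \bigcap_(i in `I_n) (Y i @^-1` B i) by [].
apply: fin_bigcap_measurable; first exact: finite_II.
by move=> i _; rewrite -[X in measurable X]setTI; exact: mY.
Qed.

Lemma measurable_theta : measurable_fun setT theta.
Proof.
apply: (measurable_to_seqT (Y := fun n (x : seqT) => x n.+1)) => n.
exact: measurable_coord.
Qed.

Lemma measurable_iter_theta n : measurable_fun setT (iter n theta).
Proof.
elim: n => [|n ih] /=; first exact: measurable_id.
exact: (measurableT_comp measurable_theta ih).
Qed.

Lemma iter_thetaE n (x : seqT) i : iter n theta x i = x (n + i)%N.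
Proof. by elim: n i => [|n ih] i //=; rewrite /theta ih addnS addSn. Qed.

Variables (nu : probability R R) (Pr : probability seqT R).
Hypothesis Pr_cyl : forall B n, (forall i, measurable (B i)) ->
  Pr (cyl B n) = \prod_(i < n) nu (B i).

(** Independence of the first coordinate from the shifted sequence: both sides are finite measures
    in [S] that agree on cylinders, a family closed under intersection. *)
Lemma Pr_rect (A : set R) (S : set seqT) : measurable A -> measurable S ->
  Pr [set x | A (x 0%N) /\ S (theta x)] = nu A * Pr S.
Proof.
move=> mA mS.
have mD : measurable ((fun x : seqT => x 0%N) @^-1` A).
  by rewrite -[X in measurable X]setTI; exact: measurable_coord.
have nA : nu A \is a fin_num by exact: fin_num_measure.
have nA0 : (0 <= fine (nu A))%R by exact: fine_ge0.
have E : pushforward (mrestr Pr mD) theta S = mscale (NngNum nA0) Pr S.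
  have cT : cylinders setT by exists (fun=> setT), 0%N; split => //; rewrite cyl0.
  have cU : \bigcup_(k : nat) [set: seqT] = setT by apply/seteqP; split => // x _; exists 0%N.
  unshelve refine (@measure_unique _ R seqT cylinders (fun=> setT) erefl
    setI_closed_cylinders (fun=> cT) cU (pushforward (mrestr Pr mD) theta) (mscale (NngNum nA0) Pr) _ _ S mS).
  - exact: measurable_theta.
  - move=> _ [B [n [mB ->]]].
    rewrite /= /pushforward /mrestr /mscale /= fineK//.
    pose B' i := if i is j.+1 then B j else A.
    have mB' i : measurable (B' i) by case: i.
    have -> : theta @^-1` cyl B n `&` (fun x : seqT => x 0%N) @^-1` A = cyl B' n.+1.
      by rewrite cylS; apply/seteqP; split => x /= [].
    by rewrite !Pr_cyl// big_ord_recl.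
  - move=> _; rewrite /= /pushforward /mrestr preimage_setT setTI.
    exact: le_lt_trans (probability_le1 Pr mD) (ltry _).
move: E; rewrite /= /pushforward /mrestr /mscale /= fineK// => <-.
by congr (Pr _); apply/seteqP; split => x /= [].
Qed.

Lemma Pr_theta S : measurable S -> Pr (theta @^-1` S) = Pr S.
Proof.
move=> mS; rewrite -[RHS]mul1e -(probability_setT nu) -Pr_rect//.
by congr (Pr _); apply/seteqP; split => x //= [].
Qed.

Lemma Pr_cyl_tail B n S : (forall i, measurable (B i)) -> measurable S ->
  Pr (cyl B n `&` (iter n theta @^-1` S)) = Pr (cyl B n) * Pr S.
Proof.
move=> + mS; elim: n B => [|n ih] B mB.
  by rewrite cyl0 setTI probability_setT mul1e.
have mU : measurable (cyl (fun i => B i.+1) n `&` (iter n theta @^-1` S) : set seqT).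
  apply: measurableI; first exact: measurable_cyl.
  by rewrite -[X in measurable X]setTI; exact: measurable_iter_theta.
have -> : cyl B n.+1 `&` (iter n.+1 theta @^-1` S) =
    [set x | B 0%N (x 0%N) /\ (cyl (fun i => B i.+1) n `&` (iter n theta @^-1` S)) (theta x)].
  by rewrite cylS; apply/seteqP; split => x /=; rewrite -iterSr; tauto.
rewrite Pr_rect// ih// muleA; congr (_ * _).
by rewrite cylS Pr_rect//; exact: measurable_cyl.
Qed.

(** An invariant set equals its preimage under arbitrarily many shifts, so it is independent of
    every cylinder, hence of itself, and [Pr S = Pr S ^+ 2]. General [N] is needed for the block
    sums, whose shift is [iter N theta]. *)
Lemma zero_one N (S : set seqT) : (0 < N)%N -> measurable S ->
  iter N theta @^-1` S = S -> Pr S = 0 \/ Pr S = 1.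
Proof.
move=> N0 mS inv.
have invk k : iter (k * N) theta @^-1` S = S.
  elim: k => [|k ih]; first by rewrite mul0n; apply/seteqP; split.
  rewrite mulSn; apply/seteqP; split => x /=; rewrite iterD.
    move=> h; have : (iter N theta @^-1` S) (iter (k * N) theta x) by [].
    by rewrite inv -[S _]/((iter (k * N) theta @^-1` S) x) ih.
  move=> h; rewrite -[S _]/((iter N theta @^-1` S) (iter (k * N) theta x)) inv.
  by rewrite -[S _]/((iter (k * N) theta @^-1` S) x) ih.
have nS : Pr S \is a fin_num by exact: fin_num_measure.
have nS0 : (0 <= fine (Pr S))%R by exact: fine_ge0.
have E : mrestr Pr mS S = mscale (NngNum nS0) Pr S.
  have cT : cylinders setT by exists (fun=> setT), 0%N; split => //; rewrite cyl0.
  have cU : \bigcup_(k : nat) [set: seqT] = setT by apply/seteqP; split => // x _; exists 0%N.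
  refine (@measure_unique _ R seqT cylinders (fun=> setT) erefl
    setI_closed_cylinders (fun=> cT) cU (mrestr Pr mS) (mscale (NngNum nS0) Pr) _ _ S mS).
  - move=> _ [B [n [mB ->]]].
    rewrite /= /mrestr /mscale /= fineK//.
    (* Padding to length [n * N] makes the length of the cylinder a multiple of [N], so that the
       invariance of [S] applies. *)
    pose B' i := if (i < n)%N then B i else setT.
    have mB' i : measurable (B' i) by rewrite /B'; case: ifP.
    have -> : cyl B n = cyl B' (n * N).
      apply/seteqP; split => x h i hi; first by rewrite /B'; case: ifP => // /h.
      have := h i; rewrite /B' hi; apply; apply: (leq_trans hi).
      by rewrite leq_pmulr.
    by rewrite -[in LHS](invk n) Pr_cyl_tail// muleC.
  - move=> _; rewrite /= /mrestr setTI.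
    exact: le_lt_trans (probability_le1 Pr mS) (ltry _).
have E1 : mrestr Pr mS S = Pr S by congr (Pr _); exact: setIid.
have {E1}E : Pr S = (fine (Pr S))%:E * Pr S by rewrite -[LHS]E1 E.
move: E; rewrite -(fineK nS) -EFinM => -[].
move/eqP; rewrite -[X in X == _]mulr1 -subr_eq0 -mulrBr mulf_eq0 => /orP[/eqP ->|]; first by left.
by rewrite subr_eq0 => /eqP <-; right.
Qed.

(** By [Pr_rect] the pair formed by the first coordinate and the shifted sequence has the product
    law. *)
Lemma seq_integral (F : R * seqT -> \bar R) : measurable_fun setT F ->
  (forall z, 0 <= F z) ->
  \int[Pr]_x F (x 0%N, theta x) = \int[nu]_t \int[Pr]_x F (t, x).
Proof.
move=> mF F0.
have mj : measurable_fun setT (fun x : seqT => (x 0%N, theta x)).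
  by apply: measurable_fun_pair; [exact: measurable_coord|exact: measurable_theta].
pose j : {mfun seqT >-> (R * seqT)%type} := HB.pack (fun x : seqT => (x 0%N, theta x))
  (isMeasurableFun.Build _ _ _ _ _ mj).
rewrite -(fubini_tonelli1 (m1 := nu) (m2 := Pr) F)//.
transitivity (\int[pushforward Pr j]_(z in [set: R * seqT]) F z).
  by rewrite ge0_integral_pushforward.
apply: eq_measure_integral => A mA _; apply/esym.
unshelve refine (@product_measure_unique _ _ _ _ R nu Pr (pushforward Pr j) _ A mA).
  by move=> B S mB mS; rewrite -Pr_rect//; congr (Pr _); apply/seteqP; split => x /= [].
Qed.

End sequence_space.


(** * Subadditive processes *)

Section expectation.
Context {R : realType} d (T : measurableType d) (P : probability T R).
Implicit Types f g : T -> R.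

(** At each fixed time the processes below are bounded, so this condition replaces integrability and
    is stable under the operations used. *)
Definition bddm f := measurable_fun setT f /\ exists C, forall x, `|f x| <= C.

Definition Ex f : R := \int[P]_x f x.

Lemma bddm_integrable f : bddm f -> P.-integrable setT (EFin \o f).
Proof.
move=> [mf [C hC]]; apply: measurable_bounded_integrable => //.
  by rewrite (le_lt_trans (probability_le1 P measurableT))// ltry.
exists C; split; first exact: num_real.
by move=> y Cy x _ /=; rewrite (le_trans (hC x))// ltW.
Qed.

Lemma bddmD f g : bddm f -> bddm g -> bddm (fun x => f x + g x).
Proof.
move=> [mf [C hC]] [mg [D hD]]; split; first exact: measurable_funD.
by exists (C + D) => x; rewrite (le_trans (ler_normD _ _))// lerD.
Qed.

Lemma bddmZ (r : R) f : bddm f -> bddm (fun x => r * f x).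
Proof.
move=> [mf [C hC]]; split.
  by apply: measurable_funM => //; exact: measurable_cst.
by exists (`|r| * C) => x; rewrite normrM ler_wpM2l.
Qed.

Lemma bddm_cst (r : R) : bddm (fun=> r).
Proof. by split; [exact: measurable_cst|exists `|r|]. Qed.

Lemma bddm_sum (n : nat) (F : nat -> T -> R) : (forall k, bddm (F k)) ->
  bddm (fun x => \sum_(k < n) F k x).
Proof.
move=> hF; elim: n => [|n ih].
  rewrite (_ : (fun x => _) = fun=> 0); first exact: bddm_cst.
  by apply/funext => x; rewrite big_ord0.
rewrite (_ : (fun x => _) = fun x => \sum_(k < n) F k x + F n x); first exact: bddmD.
by apply/funext => x; rewrite big_ord_recr.
Qed.

Lemma bddm_indic (A : set T) : measurable A -> bddm (\1_A : T -> R).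
Proof.
move=> mA; split; first exact: measurable_indic.
by exists 1 => x; rewrite indicE; case: (_ \in _); rewrite ?normr1 ?normr0.
Qed.

Lemma ExD f g : bddm f -> bddm g -> Ex (fun x => f x + g x) = Ex f + Ex g.
Proof. by move=> hf hg; rewrite /Ex RintegralD//; exact: bddm_integrable. Qed.

Lemma ExZ (r : R) f : bddm f -> Ex (fun x => r * f x) = r * Ex f.
Proof. by move=> hf; rewrite /Ex RintegralZl//; exact: bddm_integrable. Qed.

Lemma Ex_cst (r : R) : Ex (fun=> r) = r.
Proof. by rewrite /Ex Rintegral_cst// /= probability_setT mulr1. Qed.

Lemma Ex_le f g : bddm f -> bddm g -> (forall x, f x <= g x) -> Ex f <= Ex g.
Proof. by move=> hf hg h; apply: le_Rintegral => //; exact: bddm_integrable. Qed.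

Lemma Ex_sum (n : nat) (F : nat -> T -> R) : (forall k, bddm (F k)) ->
  Ex (fun x => \sum_(k < n) F k x) = \sum_(k < n) Ex (F k).
Proof.
move=> hF; elim: n => [|n ih].
  rewrite big_ord0 -[RHS](Ex_cst 0); congr Ex.
  by apply/funext => x; rewrite big_ord0.
rewrite (_ : (fun x => _) = fun x => \sum_(k < n) F k x + F n x); last first.
  by apply/funext => x; rewrite big_ord_recr.
by rewrite ExD ?ih ?[RHS]big_ord_recr//; exact: bddm_sum.
Qed.

Lemma Ex_indic (A : set T) : measurable A -> Ex (\1_A : T -> R) = fine (P A).
Proof. by move=> mA; rewrite /Ex /Rintegral integral_indic// setIT. Qed.

Variable th : T -> T.
Hypothesis mth : measurable_fun setT th.
Hypothesis Pth : forall A, measurable A -> P (th @^-1` A) = P A.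

Lemma measurable_iter n : measurable_fun setT (iter n th).
Proof.
elim: n => [|n ih] /=; first exact: measurable_id.
exact: (measurableT_comp mth ih).
Qed.

Lemma P_iter n A : measurable A -> P (iter n th @^-1` A) = P A.
Proof.
elim: n A => [|n ih] A mA; first by congr (P _).
rewrite -[RHS]Pth// -(ih (th @^-1` A)).
  by congr (P _); apply/seteqP; split => x /=.
by rewrite -[X in measurable X]setTI; exact: mth.
Qed.

Lemma bddm_iter n f : bddm f -> bddm (fun x => f (iter n th x)).
Proof.
move=> [mf [C hC]]; split; last by exists C.
by apply: (measurableT_comp mf); exact: measurable_iter.
Qed.

Lemma Ex_iter n f : bddm f -> Ex (fun x => f (iter n th x)) = Ex f.
Proof.
move=> hf; rewrite /Ex /Rintegral; congr fine.
have mn := measurable_iter n.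
have hi := bddm_integrable hf.
transitivity (\int[pushforward P (iter n th)]_(x in [set: T]) (f x)%:E)%E.
  rewrite integral_pushforward//=.
    exact/measurable_EFinP/(proj1 hf).
  have := bddm_integrable (bddm_iter n hf).
  by rewrite preimage_setT.
by apply: eq_measure_integral => A mA _; rewrite /= /pushforward P_iter.
Qed.

End expectation.

(** * Almost sure lower bound for a subadditive process *)

Section subadditive_lower.
Context {R : realType} d (T : measurableType d) (P : probability T R).
Variable th : T -> T.
Hypothesis mth : measurable_fun setT th.
Hypothesis Pth : forall A, measurable A -> P (th @^-1` A) = P A.
Hypothesis ergodic : forall A, measurable A -> th @^-1` A = A -> P A = 0%E \/ P A = 1%E.

Variables (b : nat -> T -> R) (C : R).
Hypothesis mb : forall n, measurable_fun setT (b n).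
Hypothesis b0 : forall x, `|b 0 x| <= C.
Hypothesis bS : forall n x, `|b n.+1 x - b n (th x)| <= C.
Hypothesis subadd : forall m n x, b (m + n) x <= b m x + b n (iter m th x).

Lemma b_bound n x : `|b n x| <= C * n.+1%:R.
Proof.
elim: n x => [|n ih] x; first by rewrite mulr1.
have -> : b n.+1 x = (b n.+1 x - b n (th x)) + b n (th x) by rewrite subrK.
rewrite (le_trans (ler_normD _ _))// -[n.+2%:R]natr1 mulrDr mulr1 addrC.
by rewrite lerD.
Qed.

Lemma bddm_b n : bddm (b n).
Proof. by split => //; exists (C * n.+1%:R) => x; exact: b_bound. Qed.

Lemma C_ge0 : 0 <= C.
Proof. exact: le_trans (normr_ge0 _) (b0 point). Qed.

(* The set where [liminf b n x / n < c], in a form that is exactly shift-invariant and visibly measurable. *)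
Definition lowset (c : R) : set T :=
  [set x | exists j : nat, forall m : nat, exists2 n, (m <= n)%N &
     b n x <= n%:R * (c - j.+1%:R^-1)].

Lemma measurable_lowset c : measurable (lowset c).
Proof.
have -> : lowset c = \bigcup_j \bigcap_m \bigcup_(n in [set n | (m <= n)%N])
    [set x | b n x <= n%:R * (c - j.+1%:R^-1)].
  apply/seteqP; split => x.
    by move=> [j h]; exists j => // m _; have [n mn hn] := h m; exists n.
  by move=> [j _ h]; exists j => m; have [n mn hn] := h m Logic.I; exists n.
apply: bigcup_measurable => j _; apply: bigcap_measurable => // m _.
apply: bigcup_measurable => n _.
rewrite -[X in measurable X]setTI; pose r : R := n%:R * (c - j.+1%:R^-1).
rewrite (_ : [set x | _] = b n @^-1` `]-oo, r]%classic); last first.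
  by apply/seteqP; split => x /=; rewrite in_itv.
by apply: mb => //; exact: measurable_itv.
Qed.

(** Passing from [j] to [j.+1] frees a margin proportional to [n], which absorbs the constant [D]
    for large [n]. *)
Lemma low_shift (c : R) (u v : nat -> R) (D : R) :
  (exists m0, forall n, (m0 <= n)%N -> v n <= u n + D) ->
  (exists j : nat, forall m : nat, exists2 n, (m <= n)%N & u n <= n%:R * (c - j.+1%:R^-1)) ->
  exists j : nat, forall m : nat, exists2 n, (m <= n)%N & v n <= n%:R * (c - j.+1%:R^-1).
Proof.
move=> [m0 huv] [j hj]; exists j.+1 => m.
pose g : R := j.+1%:R^-1 - j.+2%:R^-1.
have gE : g = j.+1%:R^-1 - j.+2%:R^-1 by [].
have g0 : 0 < g by rewrite subr_gt0 ltf_pV2 ?posrE ?ltr0n// ltr_nat.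
clearbody g; pose k := Num.bound (`|D| / g).
have hk : `|D| < k%:R * g by rewrite -ltr_pdivrMr// archi_boundP// divr_ge0// ltW.
have [n hn un] := hj (maxn k (maxn m m0)).
move: hn; rewrite !geq_max => /and3P[kn mn m0n].
exists n => //; apply: (le_trans (huv n m0n)).
have : k%:R * g <= n%:R * g by rewrite ler_wpM2r ?(ltW g0)// ler_nat.
have : n%:R * g = n%:R * j.+1%:R^-1 - n%:R * j.+2%:R^-1 by rewrite gE mulrBr.
have := ler_norm D; move: un; rewrite !mulrBr; clear gE; move: (n%:R / j.+1%:R) (n%:R / j.+2%:R) (n%:R * g) hk => a1 a2 a3; move: (k%:R * g) (n%:R * c) => a4 a5; lra.
Qed.

(** A shift changes [b] by at most [C] and the time by one step; both are bounded changes, absorbed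
    by [low_shift]. *)
Lemma lowset_invariant c : th @^-1` lowset c = lowset c.
Proof.
apply/seteqP; split => x h.
  have h' : exists j : nat, forall m : nat, exists2 n, (m <= n)%N &
      b n.+1 x <= n%:R * (c - j.+1%:R^-1).
    apply: (low_shift (u := fun n => b n (th x)) (D := C)) h.
    by exists 0%N => n _; have := bS n x; rewrite ler_norml => /andP[_]; lra.
  have [j hj] := h'.
  pose u n := b n x + (c - j.+1%:R^-1).
  apply: (low_shift (u := u) (D := - (c - j.+1%:R^-1))).
    by exists 0%N => n _; rewrite /u addrK.
  exists j => m; have [n mn hn] := hj m; exists n.+1; first exact: leq_trans mn _.
  by rewrite /u -[n.+1%:R]natr1 mulrDl mul1r lerD2r.
have [j hj] := h.
pose w n := b n.+1 x - (c - j.+1%:R^-1).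
apply: (low_shift (u := w) (D := C + (c - j.+1%:R^-1))).
  by exists 0%N => n _; have := bS n x; rewrite /w ler_norml => /andP[+ _]; move: (c - _) => z; lra.
exists j => m; have [[|n] mn hn] := hj m.+1; first by [].
exists n; first exact: mn.
move: hn; rewrite /w -[n.+1%:R]natr1 mulrDl mul1r.
move: (c - j.+1%:R^-1) => z; lra.
Qed.

(** Points from which a block of average at most [c] starts, its length being bounded by [N] so that
    the cover has a controlled last piece. *)
Definition goodset (c : R) (N : nat) : set T :=
  [set x | exists2 n, (1 <= n <= N)%N & b n x <= n%:R * c].

Lemma measurable_goodset c N : measurable (goodset c N).
Proof.
have -> : goodset c N = \bigcup_(n in [set n | (1 <= n <= N)%N]) (b n @^-1` `]-oo, (n%:R * c)]%classic).
  apply/seteqP; split => x.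
    by move=> [n hn h]; exists n => //=; rewrite in_itv.
  by move=> [n hn] /=; rewrite in_itv /= => h; exists n.
apply: bigcup_measurable => n _.
by rewrite -[X in measurable X]setTI; apply: mb => //; exact: measurable_itv.
Qed.

(* Cut [0, n) greedily into blocks on which [b] is at most [c] times the length, paying [D] at each visit to the bad set and [D * N] for the last incomplete block. *)
Lemma greedy_cover (c D : R) N n x : (0 < N)%N -> 2 * C + `|c| <= D ->
  b n x <= c * n%:R + D * \sum_(k < n) \1_(~` goodset c N) (iter k th x) + D * N%:R.
Proof.
move=> N0 hD; have C0 := C_ge0.
have D0 : 0 <= D by rewrite (le_trans _ hD)// addr_ge0// mulr_ge0.
have S0 m y : 0 <= \sum_(k < m) (\1_(~` goodset c N) (iter k th y) : R).
  by apply: sumr_ge0 => k _; rewrite indicE.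
have [m hm] := ubnP n; elim: m n x hm => // m ih n x /ltnSE hm.
have [nN|Nn] := leqP n N.
  have h1 := b_bound n x.
  have h2 := ler_norm (b n x).
  have h3 : D * n%:R <= D * N%:R by rewrite ler_wpM2l// ler_nat.
  have h3' : D * 1 <= D * N%:R by rewrite ler_wpM2l// ler1n.
  have h4 : 0 <= D * \sum_(k < n) (\1_(~` goodset c N) (iter k th x) : R) by rewrite mulr_ge0.
  have h5 : - (`|c| * n%:R) <= c * n%:R.
    by rewrite -mulNr ler_wpM2r// lerNl -normrN ler_norm.
  have [n0|n0] := eqVneq n 0%N.
    by move: h1 h2 h4 h5 h3'; rewrite n0 !mulr0 mulr1 !mulr1; have := normr_ge0 c; lra.
  have n1 : 1 <= n%:R :> R by rewrite ler1n lt0n.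
  have h6 : (2 * C + `|c|) * n%:R <= D * n%:R by rewrite ler_wpM2r.
  have h7 : C * 1 <= C * n%:R by rewrite ler_wpM2l.
  move: h1 h6; rewrite -[n.+1%:R]natr1 mulrDr mulr1 mulrDl -mulrA; move: h7; rewrite mulr1.
  set a := C * n%:R; set e := `|c| * n%:R in h5 *; lra.
have [[l /andP[l1 lN] hl]|nx] := pselect (goodset c N x).
  have ln : (l <= n)%N by rewrite (leq_trans lN)// ltnW.
  have nl : n = (l + (n - l))%N by rewrite subnKC.
  have /ih ih' : (n - l < m)%N by rewrite (leq_trans _ hm)// ltn_subrL l1 (leq_trans _ Nn).
  have := subadd l (n - l) x; rewrite -nl => hs.
  apply: (le_trans hs); apply: (le_trans (lerD hl (ih' (iter l th x)))).
  have hsum : \sum_(k < n - l) (\1_(~` goodset c N) (iter k th (iter l th x)) : R) <=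
      \sum_(k < n) (\1_(~` goodset c N) (iter k th x) : R).
    rewrite [in leRHS]nl big_split_ord /= -[leLHS]add0r.
    apply: lerD; first exact: S0.
    by apply: ler_sum => k _; rewrite -iterD addnC.
  have := ler_wpM2l D0 hsum.
  have : l%:R * c + c * (n - l)%:R = c * n%:R by rewrite natrB// mulrC mulrBr addrC subrK.
  lra.
have n0 : (0 < n)%N by rewrite (leq_trans _ Nn).
case: n n0 {Nn} hm => // n _ hm.
have /ih ih' : (n < m)%N by [].
have := subadd 1 n x; rewrite add1n => hs; apply: (le_trans hs).
apply: (le_trans (lerD (lexx _) (ih' (iter 1 th x)))).
rewrite big_ord_recl /= indicE mem_set//= mulrDr mulr1.
have hsum : \sum_(k < n) (\1_(~` goodset c N) (iter k th (th x)) : R) =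
  \sum_(i < n) (\1_(~` goodset c N) (iter (bump 0 i) th x) : R).
  by apply: eq_bigr => k _; rewrite -iterSr.
rewrite hsum.
(* A bad point is left after one step, which costs at most [2 * C] for [b 1 x] and [|c|] for the
   missing rate; this fixes the lower bound on [D]. *)
have h1 := b_bound 1 x; have h2 := ler_norm (b 1 x).
have h3 : - `|c| <= c by rewrite lerNl -normrN ler_norm.
rewrite -[n.+1%:R]natr1 mulrDr mulr1; lra.
Qed.

(** If the low set had probability 1, the good sets would fill the space as [N] grows. Integrating
    the greedy cover would then push the mean rate below [g]. *)
Theorem subadditive_liminf (g e : R) : (forall n, g * n%:R <= Ex P (b n)) -> 0 < e ->
  exists2 Z : set T, measurable Z /\ P Z = 0%E &
    forall x, ~ Z x -> exists n0, forall n, (n0 <= n)%N -> n%:R * (g - e) <= b n x.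
Proof.
move=> hg e0; pose c := g - e / 2.
exists (lowset c); last first.
  move=> x nx.
  pose j := Num.bound (2 / e).
  have hj : j.+1%:R^-1 <= e / 2.
    rewrite -[e / 2]invrK lef_pV2 ?posrE ?invr_gt0 ?divr_gt0 ?ltr0n// invf_div.
    rewrite (le_trans (ltW (archi_boundP _)))//; first by rewrite divr_ge0// ltW.
    by rewrite ler_nat.
  have /existsNP[m hm] : ~ forall m : nat, exists2 n, (m <= n)%N & b n x <= n%:R * (c - j.+1%:R^-1).
    by move=> h; apply: nx; exists j.
  exists m => n mn; rewrite leNgt; apply/negP => hlt; apply: hm; exists n => //.
  rewrite (le_trans (ltW hlt))// ler_wpM2l//; move: (j.+1%:R^-1) hj => z hz; rewrite /c; lra.
split; first exact: measurable_lowset.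
have [//|P1] := ergodic (measurable_lowset c) (lowset_invariant c).
exfalso.
pose D := 2 * C + `|c| + 1.
have D0 : 0 < D by rewrite ltr_wpDl// addr_ge0// mulr_ge0// C_ge0.
(* Visits to the bad set then cost on average [e / 4] per step, half of the gap [e / 2] between [g]
   and [c]; for large [n] the rest beats the constant [D * N]. *)
have [N N0 hN] : exists2 N, (0 < N)%N & fine (P (~` goodset c N)) <= e / (4 * D).
  have hmu := @nondecreasing_cvg_mu _ _ _ P (goodset c) (measurable_goodset c)
    (bigcup_measurable (fun k _ => measurable_goodset c k)).
  have nd : nondecreasing_seq (goodset c).
    move=> N N' NN'; apply/subsetPset => x [n /andP[n1 nN] h]; exists n => //.
    by rewrite n1 (leq_trans nN).
  have PU : P (\bigcup_n goodset c n) = 1%E.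
    apply/eqP; rewrite eq_le; apply/andP; split.
      by apply: probability_le1; apply: bigcup_measurable => k _; exact: measurable_goodset.
    rewrite -P1; apply: le_measure; rewrite ?inE.
    - exact: measurable_lowset.
    - by apply: bigcup_measurable => k _; exact: measurable_goodset.
    move=> x [j hj]; have [n n1 hn] := hj 1%N.
    exists n => //; exists n; first by rewrite n1 leqnn.
    by rewrite (le_trans hn)// ler_wpM2l// gerBl.
  have hcv : (P \o goodset c) n @[n --> \oo] --> 1%E by rewrite -PU; exact: hmu.
  have e1 : 0 < e / (4 * D) by rewrite divr_gt0// mulr_gt0.
  have hcf : (fine \o (P \o goodset c)) n @[n --> \oo] --> (1 : R) by exact: fine_cvg.
  have /cvgrPdist_le/(_ _ e1)[N0 _ hN0] := hcf.
  exists N0.+1 => //; have := hN0 N0.+1 (leqnSn _).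
  rewrite probability_setC//; last exact: measurable_goodset.
  rewrite fineB//; last by apply: fin_num_measure; exact: measurable_goodset.
  by apply: le_trans; exact: ler_norm.
have mB : measurable (~` goodset c N) by apply: measurableC; exact: measurable_goodset.
have bI : bddm (\1_(~` goodset c N) : T -> R) by exact: bddm_indic.
have key n : g * n%:R <= c * n%:R + D * (n%:R * (e / (4 * D))) + D * N%:R.
  apply: (le_trans (hg n)).
  have bs : bddm (fun x => \sum_(k < n) (\1_(~` goodset c N) (iter k th x) : R)).
    exact: (bddm_sum n (fun k => bddm_iter mth k bI)).
  have b3 : bddm (fun x => c * n%:R + D * \sum_(k < n) (\1_(~` goodset c N) (iter k th x) : R) + D * N%:R).
    apply: bddmD; last exact: bddm_cst.
    by apply: bddmD; [exact: bddm_cst|exact: bddmZ].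
  have hD : 2 * C + `|c| <= D by rewrite /D; lra.
  apply: (le_trans (Ex_le P (bddm_b n) b3 (fun x => greedy_cover n x N0 hD))).
  rewrite ExD//; [|by apply: bddmD; [exact: bddm_cst|exact: bddmZ]|exact: bddm_cst].
  rewrite ExD//; [|exact: bddm_cst|exact: bddmZ].
  rewrite !Ex_cst ExZ// lerD2r lerD2l ler_pM2l//.
  rewrite (Ex_sum P n (fun k => bddm_iter mth k bI)).
  rewrite (eq_bigr (fun=> fine (P (~` goodset c N)))); last first.
    by move=> k _; rewrite (Ex_iter mth Pth k bI) Ex_indic.
  by rewrite sumr_const card_ord -[leLHS]mulr_natl ler_wpM2l.
pose n := Num.bound (4 * (D * N%:R) / e).
have hn : 4 * (D * N%:R) / e < n%:R.
  by rewrite archi_boundP// divr_ge0 ?(ltW e0)// !mulr_ge0// ltW.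
rewrite ltr_pdivrMr// in hn.
have := key n.
have -> : D * (n%:R * (e / (4 * D))) = n%:R * e / 4 by field; rewrite gt_eqF.
rewrite /c mulrBl; set a := g * n%:R; set z := D * N%:R in hn *.
have -> : e / 2 * n%:R = n%:R * e / 2 by ring.
lra.
Qed.

End subadditive_lower.


(** * The Lyapunov exponent *)

Section random_products.
Context {R : realType} (nu : probability R R) (Pr : probability (@seqT R) R).
Hypothesis Pr_cyl : forall (B : nat -> set R) n, (forall i, measurable (B i)) ->
  Pr (cyl B n) = (\prod_(i < n) nu (B i))%E.
Variables (M : R -> 'M[R]_2) (K : R).
Hypothesis mM : forall i j, measurable_fun setT (fun t => M t i j).
Hypothesis dM : forall t, dt (M t) = 1.
Hypothesis pM : forall t, area_preserving (M t).
Hypothesis hK : forall t, nn (M t) <= K.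

Definition Sprod n (x : @seqT R) : 'M[R]_2 := \prod_(k <- rev (iota 0 n)) M (x k).

Lemma Sprod0 x : Sprod 0 x = 1.
Proof. by rewrite /Sprod big_nil. Qed.

Lemma SprodS n x : Sprod n.+1 x = M (x n) * Sprod n x.
Proof.
rewrite /Sprod (_ : iota 0 n.+1 = iota 0 n ++ [:: n]); last by rewrite -addn1 iotaD.
by rewrite rev_cat big_cat /= big_seq1.
Qed.

Lemma SprodD m n x : Sprod (m + n) x = Sprod n (iter m theta x) * Sprod m x.
Proof.
elim: n => [|n ih]; first by rewrite addn0 Sprod0 mul1r.
by rewrite addnS !SprodS ih mulrA iter_thetaE.
Qed.

Lemma Sprod1 x : Sprod 1 x = M (x 0%N).
Proof. by rewrite SprodS Sprod0 mulr1. Qed.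

Lemma SprodSl n x : Sprod n.+1 x = Sprod n (theta x) * M (x 0%N).
Proof. by have h := SprodD 1 n x; rewrite Sprod1 in h. Qed.

Lemma dt_Sprod n x : dt (Sprod n x) = 1.
Proof. by elim: n => [|n ih]; rewrite ?Sprod0 ?dt1// SprodS dtM dM ih mulr1. Qed.

Lemma measurable_Sprod n i j : measurable_fun setT (fun x => Sprod n x i j).
Proof.
elim: n i j => [|n ih] i j.
  rewrite (_ : (fun x => _) = fun=> (1 : 'M[R]_2) i j); first exact: measurable_cst.
  by apply/funext => x; rewrite Sprod0.
rewrite (_ : (fun x => _) = fun x : @seqT R => M (x n) i 0 * Sprod n x 0 j + M (x n) i 1 * Sprod n x 1 j).
  have mMn k l : measurable_fun setT (fun x : @seqT R => M (x n) k l).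
    exact: (measurableT_comp (mM k l) (measurable_coord n)).
  by apply: measurable_funD; exact: measurable_funM.
by apply/funext => x; rewrite SprodS mul2E.
Qed.

Lemma measurable_nn_Sprod n : measurable_fun setT (fun x => nn (Sprod n x)).
Proof.
have m i j : measurable_fun setT (fun x => `|Sprod n x i j|).
  by apply: measurableT_comp => //; exact: measurable_Sprod.
by rewrite /nn; do !apply: measurable_funD.
Qed.

Definition lognorm n (x : @seqT R) : R := ln (nn (Sprod n x)).

Lemma measurable_lognorm n : measurable_fun setT (lognorm n).
Proof. by apply: measurableT_comp; [exact: measurable_ln|exact: measurable_nn_Sprod]. Qed.

Lemma nn_gt0 A : dt A = 1 -> 0 < nn A :> R.
Proof. by move=> h; rewrite (lt_le_trans ltr01)// nn_ge1. Qed.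

Lemma lognorm_ge0 n x : 0 <= lognorm n x.
Proof. by apply: ln_ge0; apply: nn_ge1; exact: dt_Sprod. Qed.

Lemma K_ge1 : 1 <= K.
Proof. by rewrite (le_trans (nn_ge1 (dM 0))). Qed.

(** [ln 2] is the value of [lognorm 0], because [nn 1 = 2], and [ln K] bounds the effect of one
    factor. *)
Definition logC : R := ln 2 + ln K.

Lemma lognorm0_bound x : `|lognorm 0 x| <= logC.
Proof.
rewrite ger0_norm ?lognorm_ge0// /lognorm Sprod0 nn1 lerDl ln_ge0//.
exact: K_ge1.
Qed.

Lemma ln_nnM A B : dt A = 1 -> dt B = 1 -> ln (nn (A * B)) <= ln (nn A) + ln (nn B) :> R.
Proof.
move=> hA hB; rewrite -lnM ?posrE ?nn_gt0// ler_ln ?posrE ?nnM//.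
- by rewrite nn_gt0// dtM hA hB mulr1.
- by rewrite mulr_gt0 ?nn_gt0.
Qed.

(** The first factor can be removed as well as added at the same price, since its inverse [adj] has
    the same norm. *)
Lemma lognormS_close n x : `|lognorm n.+1 x - lognorm n (theta x)| <= logC.
Proof.
have l2 : 0 <= ln 2 :> R by rewrite ln_ge0// ler1n.
have K0 : 0 < K by rewrite (lt_le_trans ltr01)// K_ge1.
have lK A : dt A = 1 -> nn A <= K -> ln (nn A) <= ln K :> R.
  by move=> hA h; rewrite ler_ln ?posrE ?nn_gt0.
have h1 : lognorm n.+1 x <= lognorm n (theta x) + ln K.
  rewrite /lognorm SprodSl (le_trans (ln_nnM _ _)) ?dt_Sprod ?dM//.
  by rewrite lerD2l lK.
have h2 : lognorm n (theta x) <= lognorm n.+1 x + ln K.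
  rewrite /lognorm; have -> : Sprod n (theta x) = Sprod n.+1 x * adj (M (x 0%N)).
    by rewrite SprodSl -mulrA mul_adj// mulr1.
  rewrite (le_trans (ln_nnM _ _)) ?dt_Sprod ?dt_adj ?dM//.
  by rewrite lerD2l lK// ?dt_adj// nn_adj.
by rewrite /logC ler_norml; apply/andP; split; lra.
Qed.

Lemma lognorm_subadd m n x : lognorm (m + n) x <= lognorm m x + lognorm n (iter m theta x).
Proof. by rewrite /lognorm SprodD addrC ln_nnM ?dt_Sprod. Qed.

Let mth := @measurable_theta R.
Let Pth := fun A mA => @Pr_theta R nu Pr Pr_cyl A mA.

Let bddl n : bddm (lognorm n).
Proof.
exact: (bddm_b measurable_lognorm lognorm0_bound lognormS_close).
Qed.

Lemma Ex_lognorm_ge0 n : 0 <= Ex Pr (lognorm n).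
Proof.
rewrite -(Ex_cst Pr 0); apply: Ex_le => //; first exact: bddm_cst.
exact: lognorm_ge0.
Qed.

Lemma Ex_lognorm_subadd m n : Ex Pr (lognorm (m + n)) <= Ex Pr (lognorm m) + Ex Pr (lognorm n).
Proof.
rewrite -(Ex_iter mth Pth m (bddl n)) -ExD//; last exact: bddm_iter.
apply: Ex_le => //; first by apply: bddmD => //; exact: bddm_iter.
by move=> x; exact: lognorm_subadd.
Qed.

(** By subadditivity this infimum is the limit of the mean log norms per step; as an infimum it
    bounds every finite time from below. *)
Definition lyap : R := inf [set Ex Pr (lognorm n) / n%:R | n in [set n | (0 < n)%N]].

Let lyap_has_inf : has_inf [set Ex Pr (lognorm n) / n%:R | n in [set n | (0 < n)%N]].
Proof.
split; first by exists (Ex Pr (lognorm 1) / 1%:R); exists 1%N.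
by exists 0 => _ [n _ <-]; rewrite divr_ge0// Ex_lognorm_ge0.
Qed.

Lemma lyap_le n : lyap * n%:R <= Ex Pr (lognorm n).
Proof.
case: n => [|n]; first by rewrite mulr0 Ex_lognorm_ge0.
rewrite -ler_pdivlMr ?ltr0n//.
by apply: ge_inf; [exact: (proj2 lyap_has_inf)|exists n.+1].
Qed.

Lemma lyap_ge0 : 0 <= lyap.
Proof.
apply: lb_le_inf; first exact: (proj1 lyap_has_inf).
by move=> _ [n _ <-]; rewrite divr_ge0// Ex_lognorm_ge0.
Qed.

Lemma lyap_lower (e : R) : 0 < e ->
  exists2 Z : set (@seqT R), measurable Z /\ Pr Z = 0%E &
    forall x, ~ Z x -> exists n0, forall n, (n0 <= n)%N -> n%:R * (lyap - e) <= lognorm n x.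
Proof.
apply: (subadditive_liminf mth Pth _ measurable_lognorm lognorm0_bound lognormS_close lognorm_subadd lyap_le).
by move=> A mA hA; apply: (zero_one Pr_cyl (N := 1)).
Qed.

Lemma lognorm_blocks N k r x : lognorm (N * k + r) x <=
  \sum_(i < k) lognorm N (iter i (iter N theta) x) + lognorm r (iter k (iter N theta) x).
Proof.
elim: k x => [|k ih] x; first by rewrite muln0 big_ord0 add0r.
rewrite mulnS -addnA (le_trans (lognorm_subadd _ _ _))//.
rewrite big_ord_recl /= -addrA lerD2l (le_trans (ih _))//.
rewrite -iterSr /= lerD2r; apply: ler_sum => i _.
by rewrite -iterSr.
Qed.

(** Sums over consecutive blocks are additive along [iter N theta], so their negatives are
    subadditive too, and the lower bound for these is an upper bound for the sums. *)
Lemma block_upper (N : nat) (e : R) : (0 < N)%N -> 0 < e ->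
  exists2 Z : set (@seqT R), measurable Z /\ Pr Z = 0%E &
    forall x, ~ Z x -> exists k0, forall k, (k0 <= k)%N ->
      \sum_(i < k) lognorm N (iter i (iter N theta) x) <= k%:R * (Ex Pr (lognorm N) + e).
Proof.
move=> N0 e0.
pose th := iter N (@theta R).
have mthN : measurable_fun setT th by exact: measurable_iter_theta.
have PthN A : measurable A -> Pr (th @^-1` A) = Pr A by exact: (P_iter mth Pth).
pose b k x := - \sum_(i < k) lognorm N (iter i th x).
have [_ [C hC]] := bddl N.
have bs k : bddm (fun x => \sum_(i < k) lognorm N (iter i th x)).
  exact: (bddm_sum k (fun i => bddm_iter mthN i (bddl N))).
have bE k : b k = fun x => (-1) * \sum_(i < k) lognorm N (iter i th x).
  by apply/funext => x; rewrite mulN1r.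
have mb k : measurable_fun setT (b k) by rewrite bE; have [] := bddmZ (-1) (bs k).
have C0 : 0 <= C by rewrite (le_trans _ (hC point)).
have b0 x : `|b 0 x| <= C by rewrite /b big_ord0 oppr0 normr0.
have bS k x : `|b k.+1 x - b k (th x)| <= C.
  rewrite /b big_ord_recl opprK opprD -addrA.
  rewrite (eq_bigr (fun i : 'I_k => lognorm N (iter i th (th x)))).
    by rewrite addNr addr0 normrN.
  by move=> i _; rewrite -iterSr.
have sub m n x : b (m + n) x <= b m x + b n (iter m th x).
  rewrite /b -opprD lerN2 big_split_ord /= lerD2l; apply: ler_sum => i _.
  by rewrite -iterD addnC.
have Eb k : - Ex Pr (lognorm N) * k%:R <= Ex Pr (b k).
  rewrite bE ExZ// (Ex_sum Pr k (fun i => bddm_iter mthN i (bddl N))).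
  rewrite (eq_bigr (fun=> Ex Pr (lognorm N))); last first.
    by move=> i _; rewrite (Ex_iter mthN PthN i (bddl N)).
  by rewrite sumr_const card_ord mulN1r mulNr mulr_natr.
have [|Z mZ hZ] := subadditive_liminf mthN PthN _ mb b0 bS sub Eb e0.
  by move=> A mA hA; apply: (zero_one Pr_cyl N0).
exists Z => // x nZ; have [k0 hk0] := hZ x nZ; exists k0 => k kk0.
have := hk0 k kk0; rewrite /b; move: (\sum_(i < k) _) => s; nra.
Qed.

Lemma lyap_upper (e : R) : 0 < e ->
  exists2 Z : set (@seqT R), measurable Z /\ Pr Z = 0%E &
    forall x, ~ Z x -> exists n0, forall n, (n0 <= n)%N -> lognorm n x <= n%:R * (lyap + e).
Proof.
(* One third is spent on approaching the infimum by a block length [N], one on the average of the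
   blocks, one on the incomplete last block. *)
move=> e0; pose e' := e / 3.
have e'0 : 0 < e' by rewrite divr_gt0.
have [_ [N /= N0 <-] hN] := inf_adherent e'0 lyap_has_inf.
rewrite -/lyap in hN.
have Nr : 0 < N%:R :> R by rewrite ltr0n.
have Ne : 0 < N%:R * e' by rewrite mulr_gt0.
have [Z mZ hZ] := block_upper N0 Ne.
exists Z => // x nZ; have [k0 hk0] := hZ x nZ.
pose C := logC; pose D := C * N.+1%:R.
have bb n y : lognorm n y <= C * n.+1%:R.
  rewrite (le_trans (ler_norm _))//.
  exact: (b_bound lognorm0_bound lognormS_close).
have C0 : 0 <= C by exact: (C_ge0 lognorm0_bound).
exists (maxn (N * k0) (Num.bound (D / e'))) => n; rewrite geq_max => /andP[n1 n2].
pose k := (n %/ N)%N; pose r := (n %% N)%N.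
have nE : n = (N * k + r)%N by rewrite mulnC -divn_eq.
have kk0 : (k0 <= k)%N by rewrite leq_divRL// mulnC.
have rN : (r < N)%N by rewrite ltn_mod.
have h1 := lognorm_blocks N k r x; rewrite -nE in h1.
have h2 := hk0 k kk0.
have h3 := bb r (iter k (iter N theta) x).
have h4 : C * r.+1%:R <= D by rewrite ler_wpM2l// ler_nat ltnS ltnW.
have h5 : Ex Pr (lognorm N) <= N%:R * (lyap + e').
  by rewrite mulrC -ler_pdivrMr// ltW.
have h6 : k%:R * (Ex Pr (lognorm N) + N%:R * e') <= k%:R * (N%:R * (lyap + 2 * e')).
  by rewrite ler_wpM2l//; lra.
have h7 : (N * k)%:R * (lyap + 2 * e') <= n%:R * (lyap + 2 * e').
  rewrite ler_wpM2r//; first by rewrite addr_ge0 ?lyap_ge0// mulr_ge0// ltW.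
  by rewrite ler_nat [leqRHS]nE leq_addr.
have h8 : D <= n%:R * e'.
  rewrite -ler_pdivrMr// (le_trans (ltW (archi_boundP _)))//.
    by rewrite divr_ge0 ?(ltW e'0)// mulr_ge0.
  by rewrite ler_nat.
rewrite natrM in h7.
have e1 : k%:R * (N%:R * (lyap + 2 * e')) = N%:R * k%:R * (lyap + 2 * e') by ring.
have e2 : n%:R * (lyap + e) = n%:R * (lyap + 2 * e') + n%:R * e' by rewrite /e'; field.
rewrite e2; rewrite e1 in h6; lra.
Qed.

(** The null sets of the one-sided bounds depend on the tolerance; the tolerances [j.+1%:R^-1] leave
    countably many of them. *)
Theorem lyap_limit : exists2 Z : set (@seqT R), measurable Z /\ Pr Z = 0%E &
  forall x, ~ Z x -> (fun n => n%:R^-1 * lognorm n x) @ \oo --> lyap.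
Proof.
have ej (j : nat) : 0 < j.+1%:R^-1 :> R by rewrite invr_gt0 ltr0n.
have low (j : nat) : exists Z : set (@seqT R), (measurable Z /\ Pr Z = 0%E) /\
    forall x, ~ Z x -> exists n0, forall n, (n0 <= n)%N -> n%:R * (lyap - j.+1%:R^-1) <= lognorm n x.
  by have [Z mZ hZ] := lyap_lower (ej j); exists Z.
have up (j : nat) : exists Z : set (@seqT R), (measurable Z /\ Pr Z = 0%E) /\
    forall x, ~ Z x -> exists n0, forall n, (n0 <= n)%N -> lognorm n x <= n%:R * (lyap + j.+1%:R^-1).
  by have [Z mZ hZ] := lyap_upper (ej j); exists Z.
have [Zl hZl] := choice low; have [Zu hZu] := choice up.
pose Z := \bigcup_j (Zl j `|` Zu j).
have hl j := (hZl j).1; have hu j := (hZu j).1.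
have mZj j : measurable (Zl j `|` Zu j) by apply: measurableU; [exact: (hl j).1|exact: (hu j).1].
exists Z.
  split; first exact: bigcup_measurable.
  have /negligibleP : Pr.-negligible Z.
    apply: negligible_bigcup => j; apply: negligibleU.
      by apply/negligibleP; [exact: (hl j).1|exact: (hl j).2].
    by apply/negligibleP; [exact: (hu j).1|exact: (hu j).2].
  by apply; exact: bigcup_measurable.
move=> x nZ; apply/cvgrPdist_le => e e0.
pose j := Num.bound e^-1.
have hj : j.+1%:R^-1 <= e.
  rewrite -[leRHS]invrK lef_pV2 ?posrE ?invr_gt0 ?ltr0n//.
  rewrite (le_trans (ltW (archi_boundP _)))//; first by rewrite invr_ge0 ltW.
  by rewrite ler_nat.
have [n1 hn1] : exists n0, forall n, (n0 <= n)%N -> n%:R * (lyap - j.+1%:R^-1) <= lognorm n x.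
  by apply: (hZl j).2 => Yx; apply: nZ; exists j => //; left.
have [n2 hn2] : exists n0, forall n, (n0 <= n)%N -> lognorm n x <= n%:R * (lyap + j.+1%:R^-1).
  by apply: (hZu j).2 => Yx; apply: nZ; exists j => //; right.
exists (maxn 1 (maxn n1 n2)) => // n /=; rewrite !geq_max => /and3P[n0 nn1 nn2].
have nr : 0 < n%:R :> R by rewrite ltr0n.
have h3 : n%:R^-1 * lognorm n x <= lyap + j.+1%:R^-1 by rewrite ler_pdivrMl// hn2.
have h4 : lyap - j.+1%:R^-1 <= n%:R^-1 * lognorm n x by rewrite ler_pdivlMl// hn1.
move: (n%:R^-1 * lognorm n x) (j.+1%:R^-1) hj h3 h4 => z w hw h3 h4.
by rewrite ler_norml; apply/andP; split; lra.
Qed.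

(** A bound known only for long products of even length reaches every [N] through the multiple
    [N * (2 * n1).+2], by subadditivity of the mean. *)
Lemma lyap_ge (c : R) n1 : (forall n, (n1 <= n)%N -> n%:R * c <= Ex Pr (lognorm (2 * n))) ->
  c / 2 <= lyap.
Proof.
move=> hc; apply: lb_le_inf; first exact: (proj1 lyap_has_inf).
move=> _ [N /= N0 <-].
have mul k : Ex Pr (lognorm (N * k.+1)) <= k.+1%:R * Ex Pr (lognorm N).
  elim: k => [|k ih]; first by rewrite muln1 mul1r.
  rewrite mulnS (le_trans (Ex_lognorm_subadd _ _))// -[k.+2%:R]natr1 mulrDl mul1r addrC.
  by rewrite lerD2r.
have Nr : 0 < N%:R :> R by rewrite ltr0n.
rewrite ler_pdivlMr//.
have h := mul (2 * n1).+1.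
have e : (N * (2 * n1).+2 = 2 * (N * n1.+1))%N by rewrite -[(2 * n1).+2]/(2 + 2 * n1)%N -mulnS mulnCA.
rewrite e in h.
have h2 : (n1 <= N * n1.+1)%N by rewrite (leq_trans (leqnSn _))// leq_pmull.
have := le_trans (hc _ h2) h; rewrite natrM.
have -> : (2 * n1).+2%:R = 2 * n1.+1%:R :> R by rewrite -[(2 * n1).+2]/(2 + 2 * n1)%N -mulnS natrM.
have p : 0 < n1.+1%:R :> R by rewrite ltr0n.
have -> : N%:R * n1.+1%:R * c = n1.+1%:R * (N%:R * c) by ring.
have -> : 2 * n1.+1%:R * Ex Pr (lognorm N) = n1.+1%:R * (2 * Ex Pr (lognorm N)) by ring.
rewrite ler_pM2l//; lra.
Qed.

(** * Exponential decay of the probability of small norms *)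

Definition box (a : R) : set (R * R) := `[- a, a]%classic `*` `[- a, a]%classic.

Lemma measurable_box a : measurable (box a).
Proof. by apply: measurableX; exact: measurable_itv. Qed.

Lemma area_box a : 0 < a -> area (box a) = ((2 * a) ^+ 2)%:E.
Proof.
move=> a0; rewrite /area product_measure1E//= /leb !lebesgue_measure_itv /= lte_fin.
by rewrite ifT ?gtrN// -EFinB -EFinM; congr EFin; ring.
Qed.

Lemma measurable_hit_box n v a : measurable [set x | box a (act (Sprod n x) v)].
Proof.
have mf : measurable_fun setT (fun x => act (Sprod n x) v).
  apply/measurable_fun_pairP; split; rewrite /comp /act /=;
  by apply: measurable_funD; apply: measurable_funM;
    try exact: measurable_Sprod; exact: measurable_cst.
by rewrite -[X in measurable X]setTI; apply: mf => //; exact: measurable_box.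
Qed.

(** One more average inserts a factor at the right end of the product, that is, the matrix of the
    first coordinate; [seq_integral] merges it with the remaining sequence. *)
Lemma iter_Qop n v : iter n (Qop nu M) (\1_(box 1)) v =
  fine (Pr [set x | box 1 (act (Sprod n x) v)]).
Proof.
have mB := measurable_box 1.
elim: n v => [|n ih] v.
  rewrite /= indicE; have [h|h] := pselect (box 1 v).
    rewrite mem_set//= (_ : [set x | _] = setT) ?probability_setT//.
    by apply/seteqP; split => x //= _; rewrite Sprod0 act1.
  rewrite memNset//= (_ : [set x | _] = set0) ?measure0//.
  by apply/seteqP; split => x //=; rewrite Sprod0 act1.
rewrite /= /Qop; congr fine.
pose F (z : R * @seqT R) : \bar R := (\1_(box 1) (act (Sprod n z.2) (act (M z.1) v)))%:E.
have mF : measurable_fun setT F.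
  have mI : measurable_fun setT (\1_(box 1) : R * R -> R) by exact: measurable_indic.
  apply/measurable_EFinP; apply: (measurableT_comp mI).
  have m1 i j : measurable_fun setT (fun z : R * @seqT R => M z.1 i j) by exact: (measurableT_comp (mM i j)).
  have m2 i j : measurable_fun setT (fun z : R * @seqT R => Sprod n z.2 i j) by exact: (measurableT_comp (measurable_Sprod n i j)).
  apply/measurable_fun_pairP; split; rewrite /comp /act /=;
  by apply: measurable_funD; apply: measurable_funM => //;
    apply: measurable_funD; apply: measurable_funM => //; exact: measurable_cst.
have F0 z : (0 <= F z)%E by rewrite lee_fin.
transitivity (\int[nu]_t \int[Pr]_x F (t, x))%E.
  apply: eq_integral => t _; rewrite ih.
  have -> : (\int[Pr]_x F (t, x) = Pr [set x | box 1 (act (Sprod n x) (act (M t) v))])%E.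
    by rewrite -[X in _ = Pr X]setIT -integral_indic//; exact: measurable_hit_box.
  by rewrite fineK//; apply: fin_num_measure; exact: measurable_hit_box.
rewrite -(seq_integral Pr_cyl mF F0) -[X in _ = Pr X]setIT -integral_indic//; last exact: measurable_hit_box.
apply: eq_integral => x _; rewrite /F !indicE; congr (_%:R)%:E; congr nat_of_bool.
have -> : (x \in [set y | box 1 (act (Sprod n.+1 y) v)]) = (act (Sprod n.+1 x) v \in box 1).
  by apply/idP/idP; rewrite !inE.
by rewrite SprodSl actM.
Qed.

Hypothesis contraction : exists k : R, (0 < k < 1) /\ forall h, unit_fun h -> (L2 h < +oo)%E ->
    (L2 (Qop nu M (Qop nu M h)) <= (1 - k)%:E * L2 h)%E.

Lemma unit_fun_box : unit_fun (\1_(box 1) : R * R -> R).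
Proof.
split; first exact: measurable_indic (measurable_box 1).
by move=> v; rewrite indicE; case: (_ \in _); rewrite ?lexx ?ler01.
Qed.

Lemma L2_box : L2 (\1_(box 1)) = 4%:E :> \bar R.
Proof.
rewrite /L2 -(_ : ((2 * 1) ^+ 2)%:E = 4%:E); last by congr EFin; ring.
rewrite -area_box// -[X in _ = area X]setIT -integral_indic//; last exact: measurable_box.
apply: eq_integral => v _; congr EFin; rewrite indicE.
by case: (_ \in _); rewrite ?expr1n ?expr0n.
Qed.

(* [iter (2 * n) Qop] applied to the unit box is at least this probability on the box of half-side [rho^-1], while its L2 norm decays like [(1 - k) ^+ n]. *)
Lemma small_norm_prob : exists (k : R), 0 < k < 1 /\ forall n (rho : R), 1 <= rho ->
  fine (Pr [set x | nn (Sprod (2 * n) x) <= rho]) ^+ 2 <= rho ^+ 2 * (1 - k) ^+ n.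
Proof.
have [k [k01 hk]] := contraction; exists k; split => // n rho rho1.
have [k0 k1] := andP k01.
pose h n := iter n (Qop nu M) (\1_(box 1) : R * R -> R).
have uh m : unit_fun (h m).
  by elim: m => [|m ih]; [exact: unit_fun_box|exact: Qop_unit].
have L2h m : (L2 (h (2 * m)%N) <= (4 * (1 - k) ^+ m)%:E)%E.
  elim: m => [|m ih]; first by rewrite muln0 /h /= L2_box expr0 mulr1.
  have -> : h (2 * m.+1)%N = Qop nu M (Qop nu M (h (2 * m)%N)) by rewrite mulnS.
  apply: (le_trans (hk _ (uh _) (le_lt_trans ih (ltry _)))).
  have -> : (4 * (1 - k) ^+ m.+1)%:E = ((1 - k)%:E * (4 * (1 - k) ^+ m)%:E)%E.
    by rewrite -EFinM exprS; congr EFin; ring.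
  by apply: lee_wpmul2l => //; rewrite lee_fin; lra.
set E := [set x | _]; pose p := fine (Pr E); rewrite -/p.
have mE : measurable E.
  have -> : E = (fun x => nn (Sprod (2 * n) x)) @^-1` `]-oo, rho]%classic.
    by apply/seteqP; split => x /=; rewrite in_itv.
  by rewrite -[X in measurable X]setTI; apply: measurable_nn_Sprod => //; exact: measurable_itv.
have p0 : 0 <= p by exact: fine_ge0.
have rho0 : 0 < rho by rewrite (lt_le_trans ltr01).
have ple v : box rho^-1 v -> p <= h (2 * n)%N v.
  move=> [/=]; rewrite !in_itv /= => /andP[a1 a2] /andP[b1 b2].
  rewrite /h iter_Qop /p; apply: fine_le; rewrite ?fin_num_measure//.
    exact: measurable_hit_box.
  apply: le_measure; rewrite ?inE//.
    exact: measurable_hit_box.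
  move=> x; rewrite /E /= /nn; set A := Sprod _ x => hA.
  have n1 : `|v.1| <= rho^-1 by rewrite ler_norml a1.
  have n2 : `|v.2| <= rho^-1 by rewrite ler_norml b1.
  have row (c d : R) : `|c| + `|d| <= rho -> -1 <= c * v.1 + d * v.2 <= 1.
    move=> hcd; rewrite -ler_norml (le_trans (ler_normD _ _))// !normrM.
    apply: (@le_trans _ _ ((`|c| + `|d|) * rho^-1)).
      by rewrite mulrDl lerD// ler_wpM2l.
    by rewrite ler_pdivrMr// mul1r.
  have := normr_ge0 (A 0 0); have := normr_ge0 (A 0 1).
  have := normr_ge0 (A 1 0); have := normr_ge0 (A 1 1) => z1 z2 z3 z4.
  by split; rewrite /= in_itv /=; apply: row; lra.
have : ((p ^+ 2 * (2 / rho) ^+ 2)%:E <= (4 * (1 - k) ^+ n)%:E)%E.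
  apply: le_trans (L2h n).
  have mb := measurable_box rho^-1.
  apply: (@le_trans _ _ (\int[area]_(v in box rho^-1) ((h (2 * n)%N v) ^+ 2)%:E)%E); last first.
    by apply: msq_le.
  apply: (@le_trans _ _ (\int[area]_(v in box rho^-1) cst (p ^+ 2)%:E v)%E).
    by rewrite integral_cst//= [X in (_ <= _ * X)%E]area_box ?invr_gt0// -EFinM.
  apply: ge0_le_integral => //.
  - by move=> v _; rewrite lee_fin sqr_ge0.
  - by apply: measurable_sqE; have [mh _] := uh (2 * n)%N; exact: measurable_funS mh.
  - by move=> v /ple hv; rewrite lee_fin ler_pXn2r ?nnegrE// (le_trans p0).
rewrite lee_fin expr_div_n mulrA ler_pdivrMr ?exprn_gt0//.
have -> : 4 * (1 - k) ^+ n * rho ^+ 2 = rho ^+ 2 * (1 - k) ^+ n * 2 ^+ 2 by ring.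
by rewrite ler_pM2r// exprn_gt0.
Qed.

Theorem lyap_gt0 : 0 < lyap.
Proof.
have [k [/andP[k0 k1] hp]] := small_norm_prob.
(* The rate [q > 1] is small enough for [w < 1]. Once [w ^+ n <= 1 / 4], a product of [2 * n]
   factors has norm above [q ^+ n] with probability at least one half. *)
pose q : R := 1 + k / 4; pose w := q ^+ 2 * (1 - k).
have q1 : 1 < q by rewrite /q; lra.
have w0 : 0 <= w by rewrite /w mulr_ge0 ?sqr_ge0//; lra.
have w1 : w < 1 by rewrite /w /q; nra.
have [n1 hn1] : exists n1, forall n, (n1 <= n)%N -> w ^+ n <= 1 / 4.
  have : w ^+ n @[n --> \oo] --> (0 : R).
    by apply: cvg_expr; rewrite ger0_norm.
  move=> /cvgrPdist_le/(_ (1 / 4) (ltac:(lra)))[n1 _ h]; exists n1 => n hn.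
  have := h n hn; rewrite sub0r normrN; exact/le_trans/ler_norm.
have lq : 0 < ln q by rewrite ln_gt0.
suff : ln q / 2 / 2 <= lyap by apply: lt_le_trans; rewrite !divr_gt0.
apply: (lyap_ge (n1 := n1)) => n hn.
pose E := [set x | nn (Sprod (2 * n) x) <= q ^+ n].
have mE : measurable E.
  have -> : E = (fun x => nn (Sprod (2 * n) x)) @^-1` `]-oo, q ^+ n]%classic.
    by apply/seteqP; split => x /=; rewrite in_itv.
  by rewrite -[X in measurable X]setTI; apply: measurable_nn_Sprod => //; exact: measurable_itv.
have qn1 : 1 <= q ^+ n by rewrite exprn_ege1// ltW.
have pE : fine (Pr E) <= 1 / 2.
  have p0 : 0 <= fine (Pr E) by exact: fine_ge0.
  have h1 := hp n _ qn1.
  have h2 : (q ^+ n) ^+ 2 * (1 - k) ^+ n = w ^+ n by rewrite /w exprMn exprAC.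
  rewrite h2 in h1; have := le_trans h1 (hn1 n hn); rewrite -/E; nra.
pose f : @seqT R -> R := fun x => n%:R * ln q + (- (n%:R * ln q)) * \1_E x.
have bf : bddm f.
  by apply: bddmD; [exact: bddm_cst|apply: bddmZ; exact: bddm_indic].
have Ef : Ex Pr f = n%:R * ln q + (- (n%:R * ln q)) * fine (Pr E).
  rewrite /f ExD; [|exact: bddm_cst|by apply: bddmZ; exact: bddm_indic].
  by rewrite Ex_cst ExZ ?Ex_indic//; exact: bddm_indic.
have nl : 0 <= n%:R * ln q by rewrite mulr_ge0// ltW.
apply: (@le_trans _ _ (Ex Pr f)).
  by rewrite Ef; move: pE nl; move: (fine (Pr E)) => p; nra.
apply: Ex_le => // x; rewrite /f indicE.
have [h|h] := pselect (E x).
  by rewrite mem_set//= mulr1 subrr lognorm_ge0.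
rewrite memNset//= mulr0 addr0 /lognorm mulr_natl -lnXn ?(lt_trans ltr01)//.
rewrite ler_ln ?posrE ?nn_gt0 ?dt_Sprod ?(lt_le_trans ltr01)//.
by rewrite leNgt; apply/negP => hl; apply: h; exact: ltW.
Qed.

End random_products.


(** * The support of the law and truncation of the couplings *)

Section support.
Context {R : realType} (nu : probability R R).

Lemma ballRE (x r y : R) : ball x r y <-> `|x - y| < r.
Proof. by rewrite -(@ball_normE _ R^o). Qed.

(* Rational balls form a countable base, so the null ones cover the complement of the support. *)
Lemma msupport_conull : nu.-negligible (~` msupport nu).
Proof.
pose F k : set R := if unpickle k is Some p then
    let B := ball (ratr p.1 : R) (ratr p.2) in if nu B == 0%E then B else set0
  else set0.
have F0 k : nu.-negligible (F k).
  rewrite /F; case: unpickle => [p /=|]; last exact: negligible_set0.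
  case: eqP => h; last exact: negligible_set0.
  by apply/negligibleP => //; exact: measurable_ball.
apply: negligibleS (negligible_bigcup F0) => x /existsNP[r /not_implyP[r0 hr]].
have nr : nu (ball x r) = 0%E.
  by apply/eqP; rewrite eq_le measure_ge0 andbT leNgt; apply/negP.
have [q] := rat_in_itvoo (ltac:(lra) : x < x + r / 4).
rewrite in_itv /= => /andP[q1 q2].
have [p] := rat_in_itvoo (ltac:(lra) : r / 4 < r / 2).
rewrite in_itv /= => /andP[p1 p2].
exists (pickle (q, p)); first exact: Logic.I.
rewrite /F pickleK /=.
rewrite ifT; first by apply/ballRE; rewrite gtr0_norm; lra.
apply/eqP/eqP; rewrite eq_le measure_ge0 andbT -nr; apply: le_measure; rewrite ?inE; try exact: measurable_ball.
move=> y /ballRE; rewrite ltr_norml => /andP[h1 h2].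
by apply/ballRE; rewrite ltr_norml; apply/andP; split; lra.
Qed.

Lemma compact_support_bound : compactly_supported nu ->
  exists2 r : R, 0 < r & forall x, msupport nu x -> `|x| <= r.
Proof.
move=> [A [cA sA]]; have [r [_ hr]] := @compact_bounded R R^o A cA.
exists (`|r| + 1); first by rewrite ltr_wpDl.
move=> x /sA Ax; apply: hr => //.
by rewrite (le_lt_trans (ler_norm _))// ltrDl.
Qed.

(** The transfer matrices are unbounded over all couplings. Composing with this retraction gives a
    uniform bound and changes nothing on the support. *)
Definition clamp (r t : R) : R := Num.max (- r) (Num.min r t).

Lemma clamp_id (r t : R) : `|t| <= r -> clamp r t = t.
Proof.
by rewrite ler_norml => /andP[h1 h2]; rewrite /clamp min_r// max_r.
Qed.

Lemma clamp_bound (r t : R) : 0 < r -> `|clamp r t| <= r.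
Proof.
move=> r0; rewrite ler_norml /clamp le_max lexx /= ge_max ge_min lexx andbT.
by rewrite (le_trans _ (ltW r0))// oppr_le0 ltW.
Qed.

Lemma clamp_close (r s t : R) : `|s| <= r -> `|s - clamp r t| <= `|s - t|.
Proof.
rewrite ler_norml => /andP[h1 h2].
have [h|h] := lerP r t.
  have -> : clamp r t = r by rewrite /clamp min_l// max_r//; lra.
  by rewrite !ler0_norm; lra.
have [h'|h'] := lerP (- r) t.
  by have -> : clamp r t = t by rewrite /clamp min_r ?max_r// ltW.
have -> : clamp r t = - r by rewrite /clamp min_r ?(ltW h)// max_l// ltW.
by rewrite !ger0_norm; lra.
Qed.

Lemma measurable_clamp (r : R) : measurable_fun setT (clamp r).
Proof.
apply: measurable_maxr; first exact: measurable_cst.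
by apply: measurable_minr => //; exact: measurable_cst.
Qed.

End support.

(** * Measurability, local bounds and continuity of the block matrices in the coupling *)

Section transfer_regularity.
Context {R : realType} (f : nat -> R) (E : R).

Lemma measurable_blockM (g : R -> R) n i j : measurable_fun setT g ->
  measurable_fun setT (fun t => blockM n f (g t) E i j).
Proof.
move=> mg; elim: n i j => [|n ih] i j.
  rewrite (_ : (fun t => _) = fun=> (1 : 'M[R]_2) i j); first exact: measurable_cst.
  by apply/funext => t; rewrite blockM0.
have mt k l : measurable_fun setT (fun t => transfer (f n) (g t) E k l).
  case: (boolP (k == 0 :> nat)) => hk; case: (boolP (l == 0 :> nat)) => hl;
    rewrite (_ : (fun t => _) = fun t => if k == 0 :> nat then
       (if l == 0 :> nat then E - f n * g t else -1) else (if l == 0 :> nat then 1 else 0));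
    try (by apply/funext => t; rewrite mxE); rewrite ?hk ?(negbTE hk) ?hl ?(negbTE hl);
    try exact: measurable_cst.
  apply: measurable_funB; first exact: measurable_cst.
  by apply: measurable_funM => //; exact: measurable_cst.
rewrite (_ : (fun t => _) = fun t => transfer (f n) (g t) E i 0 * blockM n f (g t) E 0 j +
   transfer (f n) (g t) E i 1 * blockM n f (g t) E 1 j).
  by apply: measurable_funD; exact: measurable_funM.
by apply/funext => t; rewrite blockMS mul2E.
Qed.

Lemma nn_blockM_bound n (r : R) : exists K : R, forall t, `|t| <= r -> nn (blockM n f t E) <= K.
Proof.
elim: n => [|n [K hK]].
  by exists 2 => t _; rewrite blockM0 nn1.
exists ((`|E| + `|f n| * r + 2) * K) => t ht; rewrite blockMS.
apply: (le_trans (nnM _ _)); apply: ler_pM; rewrite ?nn_ge0 ?hK//.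
rewrite /nn !transferE normrN normr1 normr0 addr0.
have := ler_normB E (f n * t); rewrite normrM.
have : `|f n| * `|t| <= `|f n| * r by rewrite ler_wpM2l.
lra.
Qed.

Lemma nn_blockM_continuous n (t rho : R) : 0 < rho ->
  exists2 de : R, 0 < de & forall t', `|t - t'| < de ->
    nn (blockM n f t E - blockM n f t' E) <= rho.
Proof.
elim: n rho => [|n ih] rho rho0.
  by exists 1 => // t' _; rewrite !blockM0 subrr /nn !mxE normr0 !addr0 ltW.
pose a := nn (transfer (f n) t E) + `|f n| + 1.
pose c := nn (blockM n f t E) + 1.
have a0 : 0 < a by rewrite /a; have := nn_ge0 (transfer (f n) t E); have := normr_ge0 (f n); lra.
have c0 : 0 < c by rewrite /c; have := nn_ge0 (blockM n f t E); lra.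
have [de de0 hde] := ih (rho / (2 * a)) (ltac:(by rewrite divr_gt0// mulr_gt0)).
pose e := Num.min de (Num.min 1 (rho / (2 * a * c))).
have e0 : 0 < e.
  by rewrite !lt_min de0 ltr01 divr_gt0// !mulr_gt0.
exists e => // t'; rewrite !lt_min => /and3P[/hde h1 h2 h3].
have tdiff : nn (transfer (f n) t E - transfer (f n) t' E) = `|f n| * `|t - t'|.
  rewrite /nn !add2E !opp2E !transferE !subrr normr0 !addr0 -normrM -[RHS]normrN.
  by congr `|_|; ring.
rewrite !blockMS; apply: (le_trans (nn_mul_close _ _ _ _)); rewrite tdiff.
have ta : nn (transfer (f n) t' E) <= a.
  have := nn_le_close (transfer (f n) t' E) (transfer (f n) t E); rewrite tdiff.
  have : `|f n| * `|t - t'| <= `|f n| * 1 by rewrite ler_wpM2l// ltW.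
  rewrite /a; lra.
have k1 : `|f n| * `|t - t'| * nn (blockM n f t E) <= a * (rho / (2 * a * c)) * c.
  apply: ler_pM; rewrite ?mulr_ge0 ?nn_ge0//; last by rewrite /c lerDl.
  apply: ler_pM => //; last exact: ltW.
  by rewrite /a; have := nn_ge0 (transfer (f n) t E); lra.
have k2 : nn (transfer (f n) t' E) * nn (blockM n f t E - blockM n f t' E) <= a * (rho / (2 * a)).
  by apply: ler_pM; rewrite ?nn_ge0.
have -> : rho = a * (rho / (2 * a * c)) * c + a * (rho / (2 * a)).
  by field; rewrite !gt_eqF.
exact: lerD.
Qed.

End transfer_regularity.

(** * Comparison of the operator norm with the sum of absolute entries *)

Section operator_norm.
Context {R : realType}.
Implicit Types A : 'M[R]_2.

Lemma vnorm_le (v : 'cV[R]_2) : vnorm v <= `|v 0 0| + `|v 1 0|.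
Proof.
rewrite /vnorm -[leRHS]ger0_norm; last by rewrite addr_ge0.
rewrite -sqrtr_sqr; apply: ler_wsqrtr; rewrite sqrrD !real_normK ?num_real//.
by rewrite lerD2r lerDl mulrn_wge0// mulr_ge0.
Qed.

Lemma le_vnorm (v : 'cV[R]_2) i : `|v i 0| <= vnorm v.
Proof.
rewrite -sqrtr_sqr; apply: ler_wsqrtr.
have : i = 0 \/ i = 1 by case: i => [[|[|//]]] hi; [left|right]; apply/val_inj.
by move=> [->|->]; rewrite ?lerDl ?lerDr sqr_ge0.
Qed.

Lemma mulmx_col2 A (v : 'cV[R]_2) i : (A *m v) i 0 = A i 0 * v 0 0 + A i 1 * v 1 0.
Proof.
rewrite mxE !big_ord_recl big_ord0 addr0.
by rewrite (_ : lift ord0 ord0 = 1 :> 'I_2)//; apply/val_inj.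
Qed.

(** Basis vectors show that each of the four entries is at most the operator norm, which gives the
    factor 4. *)
Lemma opnorm_bounds A : opnorm A <= nn A <= 4 * opnorm A.
Proof.
have ub v : vnorm v = 1 -> vnorm (A *m v) <= nn A.
  move=> v1; apply: (le_trans (vnorm_le _)); rewrite !mulmx_col2.
  have h i : `|v i 0| <= 1 by rewrite -v1 le_vnorm.
  have row (i : 'I_2) : `|A i 0 * v 0 0 + A i 1 * v 1 0| <= `|A i 0| + `|A i 1|.
    rewrite (le_trans (ler_normD _ _))// !normrM lerD// ler_piMr//.
  by rewrite /nn; have := row 0; have := row 1; lra.
pose D := [set vnorm (A *m v) | v in [set v : 'cV[R]_2 | vnorm v = 1]].
have uD : ubound D (nn A) by move=> _ [v v1 <-]; exact: ub.
have ent (i j : 'I_2) : `|A i j| <= opnorm A.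
  pose e : 'cV[R]_2 := \col_k (k == j)%:R.
  have jE : j = 0 \/ j = 1 by case: j {e} => [[|[|//]]] hj; [left|right]; apply/val_inj.
  have e1 : vnorm e = 1.
    by rewrite /vnorm !mxE; case: jE => ->; rewrite !eqxx /= expr1n expr0n ?addr0 ?add0r sqrtr1.
  apply: (@le_trans _ _ (vnorm (A *m e))).
    have -> : A i j = (A *m e) i 0.
      by rewrite mulmx_col2 !mxE; case: jE => ->; rewrite !eqxx /= !(mulr1, mulr0) ?addr0 ?add0r.
    exact: le_vnorm.
  by apply: ub_le_sup; [exists (nn A)|exists e].
apply/andP; split.
  apply: ge_sup => //; exists (vnorm (A *m (\col_k (k == 0)%:R))).
  exists (\col_k (k == 0)%:R) => //=.
  by rewrite /vnorm !mxE /= expr1n expr0n addr0 sqrtr1.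
rewrite /nn; have := ent 0 0; have := ent 0 1; have := ent 1 0; have := ent 1 1; lra.
Qed.

Lemma ln_opnorm_close A : 1 <= nn A -> `|ln (opnorm A) - ln (nn A)| <= ln 4.
Proof.
move=> n1; have /andP[h1 h2] := opnorm_bounds A.
have o0 : 0 < opnorm A by lra.
have n0 : 0 < nn A by lra.
have l1 : ln (opnorm A) <= ln (nn A) by rewrite ler_ln ?posrE.
have l2 : ln (nn A) <= ln 4 + ln (opnorm A).
  by rewrite -lnM ?posrE// ler_ln ?posrE// mulr_gt0.
have l4 : 0 <= ln 4 :> R by rewrite ln_ge0// ler1n.
by rewrite ler_norml; apply/andP; split; lra.
Qed.

Lemma cvg_div_bounded_diff (u v : nat -> R) (C l : R) :
  (forall n, `|u n - v n| <= C) ->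
  (fun n => n%:R^-1 * v n) @ \oo --> l -> (fun n => n%:R^-1 * u n) @ \oo --> l.
Proof.
move=> huv hv; apply/cvgrPdist_le => e e0.
have C0 : 0 <= C by rewrite (le_trans _ (huv 0%N)).
have e2 : 0 < e / 2 by rewrite divr_gt0.
have /cvgrPdist_le/(_ _ e2)[n0 _ hn0] := hv.
exists (maxn 1 (maxn n0 (Num.bound (C / (e / 2))))) => // n /=.
rewrite !geq_max => /and3P[n1 nn0 nb].
have nr : 0 < n%:R :> R by rewrite ltr0n.
have h1 := hn0 n nn0.
have h2 : `|n%:R^-1 * u n - n%:R^-1 * v n| <= e / 2.
  rewrite -mulrBr normrM gtr0_norm ?invr_gt0// ler_pdivrMl//.
  rewrite (le_trans (huv n))// -ler_pdivrMr// (le_trans (ltW (archi_boundP _)))//.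
    by rewrite divr_ge0// ltW.
  by rewrite ler_nat.
have -> : l - n%:R^-1 * u n = (l - n%:R^-1 * v n) - (n%:R^-1 * u n - n%:R^-1 * v n) by ring.
by rewrite (le_trans (ler_normB _ _))//; move: h1 h2; lra.
Qed.

End operator_norm.

(** * Passage to an arbitrary i.i.d. sequence of couplings *)

Theorem mainTheorem13 (R : realType) (alpha : nat) (f : nat -> R)
  (nu : probability R R) :
  (0 < alpha)%N ->
  (forall i, (i < alpha)%N -> 0 < f i) ->
  compactly_supported nu ->
  support_card_ge nu (35 * alpha) ->
  forall (E : R) (d : measure_display) (T : measurableType d)
    (P : probability T R) (X : nat -> T -> R),
  iid_with_law P X nu ->
  exists L : R, 0 < L /\
    {ae P, forall w, (fun n : nat => n%:R^-1 * ln (opnorm (nstep alpha f E (X ^~ w) n)))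
                     @ \oo --> L}.
Proof.
move=> a0 f0 cnu [s [us [ss hs]]] E d T P X [mX [indX lawX]].
have [r r0 hr] := compact_support_bound cnu.
pose M (t : R) := blockM alpha f (clamp r t) E.
have mM i j : measurable_fun setT (fun t => M t i j).
  by apply: measurable_blockM; exact: measurable_clamp.
have dM t : dt (M t) = 1 by exact: dt_blockM.
have pM t : area_preserving (M t) by exact: area_preserving_blockM.
have [K hK'] := nn_blockM_bound f E alpha r.
have hK t : nn (M t) <= K by apply: hK'; exact: clamp_bound.
have hf i : (i < alpha)%N -> f i != 0 by move=> /f0 h; rewrite gt_eqF.
have s4 : (4 * alpha < size s)%N by rewrite ss ltn_pmul2r.
have sr i : (i < size s)%N -> `|nth 0 s i| <= r by move=> hi; apply: hr; apply: hs; exact: mem_nth.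
pose tau (i : 'I_(size s)) := nth 0 s i.
have Mtau i : M (tau i) = blockM alpha f (tau i) E by rewrite /M clamp_id// sr.
have contr : exists k : R, 0 < k < 1 /\ forall h, unit_fun h -> (L2 h < +oo)%E ->
    (L2 (Qop nu M (Qop nu M h)) <= (1 - k)%:E * L2 h)%E.
  have [rho [e [rho0 e0 core]]] := sqM_no_almost_invariant_mass E a0 hf us s4.
  apply: (@Qop2_contraction R nu M mM dM pM (size s) tau rho e rho0 e0).
  - move=> g m m' dg hg; apply: core => // i.
    by have := hg i; rewrite !Mtau.
  - by move=> i rh rh0; apply: hs => //; exact: mem_nth.
  move=> i rh rh0; have [de de0 hde] := nn_blockM_continuous f E alpha (tau i) rh0.
  exists de => // t /ballRE ht; rewrite Mtau; apply: hde.
  exact: le_lt_trans (clamp_close t (sr i (ltn_ord i))) ht.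
(* The whole process is one random sequence; by independence its law gives cylinders their product
   value. *)
pose Y : T -> @seqT R := fun w n => X n w.
have mY : measurable_fun setT Y by exact: measurable_to_seqT.
pose YY : {mfun T >-> @seqT R} := HB.pack Y (isMeasurableFun.Build _ _ _ _ _ mY).
pose Pr : probability (@seqT R) R := distribution P YY.
have PrE A : Pr A = P (Y @^-1` A) by [].
have Pr_cyl (B : nat -> set R) n : (forall i, measurable (B i)) ->
    Pr (cyl B n) = (\prod_(i < n) nu (B i))%E.
  move=> mB; rewrite PrE.
  have := indX (iota 0 n) B (iota_uniq 0 n) mB.
  have -> : \bigcap_(i in [set j | j \in iota 0 n]) (X i @^-1` B i) = Y @^-1` cyl B n.
    apply/seteqP; split => w h i /=.
      by move=> hi; apply: (h i); rewrite /= mem_iota add0n.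
    by rewrite mem_iota add0n => /andP[_ hi]; exact: h.
  move=> ->; rewrite -(big_mkord xpredT (fun i => nu (B i))) /index_iota subn0.
  by apply: eq_bigr => i _; rewrite lawX.
have [Z [mZ Z0] hZ] := lyap_limit Pr_cyl mM dM hK.
exists (lyap Pr M); split; first exact: (lyap_gt0 Pr_cyl mM dM hK contr).
have [N [mN N0 sN]] := msupport_conull nu.
(* Outside this set the limit holds for the sequence and no coupling leaves the support, so clamping
   changes none of the factors. *)
have neg : P.-negligible ((Y @^-1` Z) `|` \bigcup_n (X n @^-1` N)).
  apply: negligibleU.
    apply/negligibleP; last exact: Z0.
    by rewrite -[X in measurable X]setTI; exact: (mY measurableT).
  apply: negligible_bigcup => n; apply/negligibleP; last exact: etrans (lawX n N mN) N0.
  by rewrite -[X in measurable X]setTI; exact: mX.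
suff sub : ~` [set w | (fun n : nat => n%:R^-1 * ln (opnorm (nstep alpha f E (X ^~ w) n)))
    @ \oo --> lyap Pr M] `<=` (Y @^-1` Z) `|` \bigcup_n (X n @^-1` N).
  exact: negligibleS sub neg.
move=> w hw; apply: contrapT => /not_orP[nZ nN]; apply: hw => /=.
have bX n : `|X n w| <= r.
  apply: hr; apply: contrapT => h; apply: nN; exists n => //.
  exact: sN.
have SE n : nstep alpha f E (X ^~ w) n = Sprod M n (Y w).
  by rewrite /nstep /Sprod; apply: eq_bigr => k _; rewrite /M (clamp_id (bX k)).
apply: (@cvg_div_bounded_diff _ _ (fun n => lognorm M n (Y w)) (ln 4)); last exact: hZ.
move=> n; rewrite SE; apply: ln_opnorm_close.
by apply: nn_ge1; exact: dt_Sprod.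
Qed.
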